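(* Let $N\ge 3$ be an integer, let $p,q,r,s>1$, let $a,b\in\mathbb{R}$ satisfy $b>a-2>-N$, put $p_S(a,b)=\frac{N+2+2b-a}{N-2+a}$, and for a domain $\Omega\subseteq\mathbb{R}^N$ containing the origin consider the system $$\begin{cases}\operatorname{div}(|x|^aDu_1)+|x|^bu_1^{p}u_2^{q}=0,\\ \operatorname{div}(|x|^aDu_2)+|x|^bu_1^{r}u_2^{s}=0,\quad u_1,u_2>0,\ \text{ in }\Omega.\end{cases}\tag{$*$}$$ (a) For $\Omega=\mathbb{R}^N$, system $( * )$ has no positive solution whenever $\max\{p+q,\,r+s\}<p_S(a,b)$. (b) Let $\Omega$ be a bounded, open, smooth domain star-shaped with respect to the origin. Then system $( * )$ with the boundary conditions $u_1=u_2=0$ on $\partial\Omega$ has no positive solution in $\Omega$ whenever $\min\{p+q,\,r+s\}\ge p_S(a,b)$. For $\Omega=\mathbb{R}^N$, system $( * )$ admits a positive solution if $q-s=r-p\ge 1$ and $r+s\ge p_S(a,b)$.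
   Context: $D$ denotes the gradient. Throughout, $\Omega$ is an open domain containing the origin and $\Omega_0=\Omega\setminus\{0\}$. A positive solution in $\Omega$ is a pair $(u_1,u_2)$ with $u_1,u_2:\Omega\to(0,\infty)$ of class $C^2(\Omega_0)\cap C(\overline{\Omega})$ satisfying the system pointwise everywhere in $\Omega_0$ (and the boundary conditions when these are imposed). *)

(* Defs.v *)
(* R^N is the row vector space 'rV[R]_N over an arbitrary R : realType. *)
From HB Require Import structures.
From mathcomp Require Import all_boot all_order all_algebra.
From mathcomp Require Import all_classical all_reals all_analysis.

Set Implicit Arguments.
Unset Strict Implicit.
Unset Printing Implicit Defensive.

Import Order.TTheory GRing.Theory Num.Theory.
Import numFieldNormedType.Exports.

Local Open Scope classical_set_scope.
Local Open Scope ring_scope.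

(* The norm `|x| that the library puts on 'rV[R]_N is the sup norm, so the
   Euclidean norm is defined here. Both induce the same topology and the same
   bounded sets, hence the library's [open], [closure], [connected],
   [bounded_set] and [continuous] are used unchanged. *)
Definition enorm (R : realType) (N : nat) (x : 'rV[R]_N) : R :=
  Num.sqrt (\sum_(i < N) x 0 i ^+ 2).

Definition partial (R : realType) (N : nat) (i : 'I_N) (f : 'rV[R]_N -> R) :
    'rV[R]_N -> R :=
  'D_(delta_mx 0 i) f.

Definition grad (R : realType) (N : nat) (f : 'rV[R]_N -> R) (x : 'rV[R]_N) :
    'rV[R]_N :=
  \row_(i < N) partial i f x.

Definition divergence (R : realType) (N : nat) (F : 'rV[R]_N -> 'rV[R]_N)
    (x : 'rV[R]_N) : R :=
  \sum_(i < N) partial i (fun y => F y 0 i) x.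

(* Class C^k on an open set U: the partial derivatives of order at most k exist
   and are continuous on U. *)
Fixpoint Ck (R : realType) (N k : nat) (U : set 'rV[R]_N)
    (f : 'rV[R]_N -> R) : Prop :=
  {within U, continuous f} /\
  (if k is k'.+1 then
     forall i : 'I_N,
       (forall x, U x -> derivable f x (delta_mx 0 i)) /\ Ck k' U (partial i f)
   else True).

Definition bdry (R : realType) (N : nat) (Omega : set 'rV[R]_N) :
    set 'rV[R]_N :=
  closure Omega `\` interior Omega.

(* Smooth means C^infinity boundary: near each of its points the boundary is a
   regular level set of a C^infinity function, and Omega lies on one side. *)
Definition smooth_boundary (R : realType) (N : nat) (Omega : set 'rV[R]_N) :
    Prop :=
  forall x0, bdry Omega x0 ->
  exists (U : set 'rV[R]_N) (phi : 'rV[R]_N -> R),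
    [/\ open U, U x0, forall k, Ck k U phi, forall x, U x -> grad phi x != 0 &
        forall x, U x -> (Omega x <-> phi x < 0) /\
                         (bdry Omega x <-> phi x = 0)].

Definition star_shaped0 (R : realType) (N : nat) (Omega : set 'rV[R]_N) :
    Prop :=
  forall x (t : R), Omega x -> 0 <= t -> t <= 1 -> Omega (t *: x).

Definition punctured (R : realType) (N : nat) (Omega : set 'rV[R]_N) :
    set 'rV[R]_N :=
  Omega `\ 0.

Definition p_S (R : realType) (N : nat) (a b : R) : R :=
  (N%:R + 2 + 2 * b - a) / (N%:R - 2 + a).

(* Functions on Omega or on its closure are total functions constrained only
   there; the derivatives at a point of the open set Omega \ {0} depend only on
   the values near that point. *)
Record positive_solution (R : realType) (N : nat) (a b p q r s : R)
    (Omega : set 'rV[R]_N) (u1 u2 : 'rV[R]_N -> R) : Prop := {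
  ps_pos1 : forall x, Omega x -> 0 < u1 x ;
  ps_pos2 : forall x, Omega x -> 0 < u2 x ;
  ps_C2_1 : Ck 2 (punctured Omega) u1 ;
  ps_C2_2 : Ck 2 (punctured Omega) u2 ;
  ps_C0_1 : {within closure Omega, continuous u1} ;
  ps_C0_2 : {within closure Omega, continuous u2} ;
  ps_eq1 : forall x, punctured Omega x ->
    divergence (fun y => enorm y `^ a *: grad u1 y) x
      + enorm x `^ b * (u1 x `^ p * u2 x `^ q) = 0 ;
  ps_eq2 : forall x, punctured Omega x ->
    divergence (fun y => enorm y `^ a *: grad u2 y) x
      + enorm x `^ b * (u1 x `^ r * u2 x `^ s) = 0 }.

Definition zero_boundary (R : realType) (N : nat) (Omega : set 'rV[R]_N)
    (u1 u2 : 'rV[R]_N -> R) : Prop :=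
  forall x, bdry Omega x -> u1 x = 0 /\ u2 x = 0.

(* Main.v *)
Require Import Defs.
From HB Require Import structures.
From mathcomp Require Import all_boot all_order all_algebra.
From mathcomp Require Import all_classical all_reals all_analysis.
From mathcomp Require Import ring lra.
Import Order.TTheory GRing.Theory Num.Theory.
Import numFieldNormedType.Exports.
Local Open Scope classical_set_scope.
Local Open Scope ring_scope.

(** Put [2 m = N - 2 + a] and [W_i = |x|^m u_i]. In the cylindrical coordinates
    [t = ln |x|], [theta = x / |x|] the system becomes, writing
    [L = d^2/dt^2 + Lap_theta],

      [L W_1 - m^2 W_1 + |x|^d1 W_1^p W_2^q = 0],
      [L W_2 - m^2 W_2 + |x|^d2 W_1^r W_2^s = 0],

    with [d1 = m (p_S - (p + q))] and [d2 = m (p_S - (r + s))]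
    ([cylLap_of_equation], [critical_gap]). The inversion in the sphere of radius [l]
    is the reflection [t -> 2 ln l - t]; it preserves [L] and affects the weights only.

    Both nonexistence results rest on moving spheres centred at the origin
    ([moving_spheres]): if the exponents of the weights are nonnegative and the [W_i]
    tend to zero at the origin, then [W_i (x) <= W_i (x^l)] for [|x| <= l] and every [l],
    where [x^l] is the reflected point; equivalently, the [W_i] are nondecreasing along
    rays ([ordered_ray]). For small [l] this is the maximum principle, the linearised
    source being smaller than [m^2 W] near the origin. The inequality passes to larger
    [l] because it is strict inside, on compact sets ([ordered_strict]), while near the
    sphere [|x| = l] the test function [2 - (|x| / l)^be], with [be] large, excludes
    contact from below ([touching_bound], [ordered_open]). Strictness comes from the
    growth of the weights, or, when they are constant, from a barrier along rays
    issued from a region where the [W_i] vanish ([contact_free_barrier]).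

    In (a) the exponents [d1], [d2] are positive. The [W_i] are bounded below for
    [|x| >= 1], hence [L W_1 <= - W_1] at infinity, and the comparison with a sine in
    [ln |x|] gives a contradiction ([oscillation], [liouville]).

    In the first half of (b) the exponents are nonpositive, and an inversion of radius
    [1] changes their signs. Extended by zero, [W_i] composed with it vanishes near the
    origin because [Omega] is bounded, and its positivity set is stable under
    expansions because [Omega] is star-shaped. Moving spheres make it nondecreasing along
    rays, but it tends to zero at infinity, since [|x|^m u_i] does at the origin
    ([star_shaped_nonexistence]).

    In the second half of (b) the hypothesis says [p + q = r + s], so a scalar radial
    solution [u_1 = u_2] is enough. In the variable [y = |x|^k / k^2], [k = 2 + b - a], it
    solves the Emden-Fowler equation [y phi'' + (nu + 1) phi' + phi^sigma = 0] with
    [nu = 2 m / k] and [sigma = r + s]. The problem with a truncated nonlinearity has a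
    global solution by Picard iteration ([fixed_point]), and the Pohozaev energy,
    nonincreasing for [sigma >= p_S], keeps it positive ([profile_positive]). *)

Set Implicit Arguments.
Unset Strict Implicit.
Unset Printing Implicit Defensive.

(** * Chain rule for functions with continuous partial derivatives *)

Lemma continuous_sumr (R : realType) (T : topologicalType) (I : Type) (r : seq I) (F : I -> T -> R) (y : T) :
 (forall i, {for y, continuous (F i)}) -> {for y, continuous (fun v => \sum_(i <- r) F i v)}.
Proof.
move=> cF; elim: r => [|i r IHr].
  under [X in {for _, continuous X}]eq_fun do rewrite big_nil.
  exact: cst_continuous.
under [X in {for _, continuous X}]eq_fun do rewrite big_cons.
exact: continuousD (cF i) IHr.
Qed.

Section Calculus.
Context {R : realType} {N : nat}.
Implicit Types (f : 'rV[R]_N -> R) (x y v : 'rV[R]_N).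

Lemma is_derive_line f x v (t : R) : derivable f (x + t *: v) v ->
  is_derive t 1 (fun s => f (x + s *: v)) ('D_v f (x + t *: v)).
Proof.
move=> fx.
have E : (fun h : R => h^-1 *: (((fun s => f (x + s *: v)) \o shift t) h%:A
            - f (x + t *: v)))
   = (fun h : R => h^-1 *: ((f \o shift (x + t *: v)) (h *: v) - f (x + t *: v))).
  apply/funext => h /=; congr (_ *: (f _ - _)).
  by rewrite [h%:A]mulr1 scalerDl addrCA.
by split; [rewrite /derivable E|rewrite /derive E].
Qed.

Lemma mean_value_bound (g g' : R -> R) (c e h : R) :
  (forall s : R, `|s| <= `|h| -> is_derive s 1 g (g' s)) ->
  (forall s : R, `|s| <= `|h| -> `|g' s - c| <= e) ->
  `|g h - g 0 - c * h| <= e * `|h|.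
Proof.
move=> dg ge.
have cg s : `|s| <= `|h| -> {for s, continuous g}.
  by move=> /dg ds; apply/differentiable_continuous/derivable1_diffP.
have sub s : (Num.min 0 h <= s <= Num.max 0 h) -> `|s| <= `|h|.
  by case: (leP 0 h) => h0 /andP[a b]; rewrite ler_norml; apply/andP; split;
   rewrite ?(ger0_norm h0) ?(ltr0_norm h0); lra.
have [c' c'in E] : exists2 s, `|s| <= `|h| & g h - g 0 = g' s * h.
  case: (leP 0 h) => h0.
    have [||z zin ->] := @MVT_segment R g g' 0 h h0.
    - move=> z; rewrite in_itv/= => /andP[a b]; apply: dg; apply: sub.
      by rewrite min_l ?max_r // !ltW.
    - apply: continuous_in_subspaceT => z; rewrite inE/= in_itv/= => zz.
      by apply: cg; apply: sub; rewrite min_l ?max_r.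
    exists z; last by rewrite subr0.
    by apply: sub; move: zin; rewrite in_itv/= min_l ?max_r.
  have [||z zin Ez] := @MVT_segment R g g' h 0 (ltW h0).
  - move=> z; rewrite in_itv/= => /andP[a b]; apply: dg; apply: sub.
    by rewrite min_r ?max_l // ?ltW.
  - apply: continuous_in_subspaceT => z; rewrite inE/= in_itv/= => zz.
    by apply: cg; apply: sub; rewrite min_r ?max_l // ltW.
  exists z; last by rewrite -opprB Ez sub0r mulrN opprK.
  by apply: sub; move: zin; rewrite in_itv/= min_r ?max_l // ltW.
by rewrite E -mulrBl normrM ler_wpM2r // ge.
Qed.

(** The points [hyb x y 0], ..., [hyb x y N] lead from [x] to [y], replacing one
    coordinate at a time. *)
Let hyb x y (k : nat) : 'rV[R]_N :=
  \row_(i < N) if (i < k)%N then y 0 i else x 0 i.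

Lemma rV_ltP x (e : R) : 0 < e -> (`|x| < e <-> forall i, `|x 0 i| < e).
Proof.
move=> e0; have -> : `|x| = \big[Num.max/0]_ij `|x ij.1 ij.2| by rewrite -mx_normrE.
split.
  move=> H i; apply: le_lt_trans H.
  exact: (le_bigmax _ (fun ij : 'I_1 * 'I_N => `|x ij.1 ij.2|) (0,i)).
by move=> H; apply/bigmax_ltP; split => // -[j i] _ /=; rewrite (ord1 j).
Qed.

Lemma rV_leP x (e : R) : 0 <= e -> (`|x| <= e <-> forall i, `|x 0 i| <= e).
Proof.
move=> e0; have -> : `|x| = \big[Num.max/0]_ij `|x ij.1 ij.2| by rewrite -mx_normrE.
split.
  move=> H i; apply: le_trans H.
  exact: (le_bigmax _ (fun ij : 'I_1 * 'I_N => `|x ij.1 ij.2|) (0,i)).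
by move=> H; apply/bigmax_leP; split => // -[j i] _ /=; rewrite (ord1 j).
Qed.

Lemma coord_le_norm x i : `|x 0 i| <= `|x|.
Proof. by have /(rV_leP x (normr_ge0 x)) := lexx `|x|; apply. Qed.

(** Telescoping along the points [hyb x y k] reduces the increment of [f] to
    increments in one coordinate, where the mean value inequality applies. *)
Lemma partial_increment f x (e : R) : 0 < e ->
  (forall i, \forall y \near x, derivable f y (delta_mx 0 i)) ->
  (forall i, {for x, continuous (partial i f)}) ->
  \forall y \near x,
    `|f y - f x - \sum_(i < N) partial i f x * (y 0 i - x 0 i)|
      <= \sum_(i < N) e * `|y 0 i - x 0 i|.
Proof.
move=> e0 df cf.
have H : \forall y \near x, forall i, derivable f y (delta_mx 0 i) /\
    `|partial i f y - partial i f x| <= e.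
  refine (@filter_forall _ _ (fun i y => derivable f y (delta_mx 0 i) /\
    `|partial i f y - partial i f x| <= e) (nbhs x) _ _) => i.
  near=> y; split; first by near: y; exact: df.
  rewrite distrC; near: y.
  by have /cvgrPdist_le := cf i; apply.
move/nbhs_ballP : H => [d /= d0 H].
near=> y.
have yx : `|y - x| < d.
  near: y; apply/nbhs_ballP; exists d => //= z.
  by rewrite -ball_normE/= distrC.
have hx : hyb x y 0 = x by apply/rowP => i; rewrite mxE.
have hy : hyb x y N = y by apply/rowP => i; rewrite mxE ltn_ord.
have -> : f y - f x = \sum_(k < N) (f (hyb x y k.+1) - f (hyb x y k)).
  rewrite -[in LHS]hx -[in LHS]hy.
  by rewrite -(big_mkord xpredT (fun k => f (hyb x y k.+1) - f (hyb x y k)))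
    telescope_sumr.
rewrite -sumrB; apply: le_trans (ler_norm_sum _ _ _) _.
apply: ler_sum => k _.
have E (s : R) : hyb x y k + s *: delta_mx 0 k =
    \row_i (if i == k then x 0 k + s else hyb x y k 0 i).
  apply/rowP => i; rewrite !mxE eqxx/=.
  by case: eqVneq => [->|]; rewrite ?ltnn ?mulr1 ?mulr0 ?addr0.
have -> : f (hyb x y k.+1) = f (hyb x y k + (y 0 k - x 0 k) *: delta_mx 0 k).
  congr f; rewrite E; apply/rowP => i; rewrite !mxE ltnS.
  case: eqVneq => [->|nik]; first by rewrite leqnn addrCA subrr addr0.
  by rewrite leq_eqVlt (negbTE (_ : nat_of_ord i != k)).
have -> : f (hyb x y k) = f (hyb x y k + 0 *: delta_mx 0 k).
  by rewrite scale0r addr0.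
have near_hyb (s : R) : `|s| <= `|y 0 k - x 0 k| ->
    ball x d (hyb x y k + s *: delta_mx 0 k).
  move=> sk; rewrite -ball_normE /= distrC; apply/rV_ltP => // i.
  move/(rV_ltP _ d0): yx => yx.
  rewrite E !mxE; case: eqVneq => [->|nik].
    rewrite addrC addKr; apply: le_lt_trans sk _.
    by have := yx k; rewrite !mxE.
  by case: ifP => _; [have := yx i; rewrite !mxE|rewrite subrr normr0].
apply: (@mean_value_bound (fun s => f (hyb x y k + s *: delta_mx 0 k))
  (fun s => partial k f (hyb x y k + s *: delta_mx 0 k))) => s sk.
  by apply: is_derive_line; have [] := H _ (near_hyb _ sk) k.
by have [] := H _ (near_hyb _ sk) k.
Unshelve. all: by end_near. Qed.

Lemma C1_differential f x :
  (forall i, \forall y \near x, derivable f y (delta_mx 0 i)) ->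
  (forall i, {for x, continuous (partial i f)}) ->
  is_diff x f (fun v => \sum_(i < N) partial i f x * v 0 i).
Proof.
move=> df cf.
pose d v := \sum_(i < N) partial i f x * v 0 i.
have lin_d : linear d.
  move=> a u v; rewrite /d scaler_sumr -big_split/=; apply: eq_bigr => i _.
  by rewrite !mxE mulrDr; congr (_ + _); rewrite mulrCA.
pose dM := GRing.isLinear.Build _ _ _ _ _ lin_d.
pose D : {linear _ -> _} := HB.pack d dM.
have cD : continuous D.
  move=> y; apply: continuous_sumr => i.
  by apply: continuousM; [exact: cst_continuous|exact: coord_continuous].
have E : f \o shift x = cst (f x) + (D : 'rV[R]_N -> R) +o_ (0 : 'rV[R]_N) id.
  apply/eqaddoP => _/posnumP[e].
  (* N + 1 rather than N keeps the divisor positive in dimension 0 *)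
  have e'0 : 0 < e%:num / (N%:R + 1) by rewrite divr_gt0 // ltr_wpDl.
  have := partial_increment e'0 df cf.
  rewrite (near_shift 0) /= subr0; apply: filterS => h.
  rewrite /=.
  under eq_bigr do rewrite !mxE addrK.
  under [X in _ <= X -> _]eq_bigr do rewrite !mxE addrK.
  rewrite -/(d h) => K.
  have -> : (f \o shift x - (cst (f x) + (D : _ -> _))) h = f (h + x) - f x - d h.
    by rewrite /= !fctE opprD addrA.
  apply: le_trans K _.
  apply: (@le_trans _ _ (\sum_(i < N) e%:num / (N%:R + 1) * `|h|)).
    by apply: ler_sum => i _; rewrite (ler_wpM2l (ltW e'0)) ?coord_le_norm.
  rewrite sumr_const card_ord -[X in X <= _]mulr_natl mulrA ler_wpM2r //.
  rewrite mulrCA ger_pMr // ler_pdivrMr ?mul1r ?lerDl // ?ltr_wpDl.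
have dE : 'd f x = D :> (_ -> _) by exact: diff_unique.
split; last exact: dE.
by apply/diff_locallyP; rewrite dE.
Qed.

(** The partial derivatives need exist only near the point and be continuous only
    at the point, so a function of class [Ck 2] and each of its partial derivatives
    both qualify. *)
Lemma is_derive_curve f (g : R -> 'rV[R]_N) (g' : 'I_N -> R) (t : R) :
  (forall i, \forall y \near g t, derivable f y (delta_mx 0 i)) ->
  (forall i, {for g t, continuous (partial i f)}) ->
  (forall i, is_derive t 1 (fun s => g s 0 i) (g' i)) ->
  is_derive t 1 (f \o g) (\sum_(i < N) partial i f (g t) * g' i).
Proof.
move=> df cf dg.
have Df := C1_differential df cf.
have Dg : derivable g t 1.
  apply/derivable_mxP => i j; rewrite (ord1 i).
  by have [] := dg j.
have dg1 : differentiable g t by exact/derivable1_diffP.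
have dfg : differentiable (f \o g) t by apply: differentiable_comp => //.
split; first exact/derivable1_diffP.
rewrite deriveE // diff_comp //= diff_val -deriveE // derive_mx //.
apply: eq_bigr => i _; rewrite mxE; congr (_ * _).
by have [_] := dg i.
Qed.

End Calculus.

(** * First and second derivatives in one variable *)

Section OneVariable.
Context {R : realType}.
Implicit Types (f g : R -> R) (a b k x : R).

(** A fixed direction in [is_derive], so that the derivation rules below produce
    derivatives written with the ring operations of [R] rather than with [*:]. *)
Definition isd g x a : Prop := is_derive (x : R) (1 : R) g a.

Lemma isd_eq g x a b : isd g x a -> a = b -> isd g x b.
Proof. by move=> ? <-. Qed.

Lemma isdC k x : isd (fun=> k) x 0.
Proof. exact: is_derive_cst. Qed.

Lemma isdI x : isd (fun s => s) x 1.
Proof. exact: is_derive_id. Qed.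

Lemma isdD f g x a b : isd f x a -> isd g x b ->
  isd (fun s => f s + g s) x (a + b).
Proof. by move=> df dg; exact: is_deriveD. Qed.

Lemma isdM f g x a b : isd f x a -> isd g x b ->
  isd (fun s => f s * g s) x (a * g x + f x * b).
Proof.
move=> df dg; apply: isd_eq; first exact: (@is_deriveM _ _ f g x 1 a b).
by rewrite -[_ *: _]/(_ * _) -[X in _ + X]/(_ * _); ring.
Qed.

Lemma isdZ f x a k : isd f x a -> isd (fun s => k * f s) x (k * a).
Proof. by move=> df; apply: isd_eq (isdM (isdC k x) df) _; ring. Qed.

Lemma isdN f x a : isd f x a -> isd (fun s => - f s) x (- a).
Proof. by move=> df; exact: is_deriveN. Qed.

Lemma isdB f g x a b : isd f x a -> isd g x b ->
  isd (fun s => f s - g s) x (a - b).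
Proof. by move=> df dg; exact: is_deriveB. Qed.

Lemma isd_comp f g x a b : isd f (g x) a -> isd g x b ->
  isd (fun s => f (g s)) x (a * b).
Proof. by move=> df dg; exact: (@is_derive1_comp _ f g). Qed.

Lemma isd_near f g x a : (\forall s \near x, f s = g s) ->
  isd f x a -> isd g x a.
Proof. by move=> fg df; exact: near_eq_is_derive df. Qed.

Lemma isd_expR x : isd (@expR R) x (expR x).
Proof. exact: is_derive_expR. Qed.

Lemma isd_powR x k : 0 < x -> isd (fun s => s `^ k) x (k * x `^ (k - 1)).
Proof. by move=> x0; exact: is_derive1_powR. Qed.

Lemma isd_continuous g x a : isd g x a -> {for x, continuous g}.
Proof.
by move=> [dg _]; apply/differentiable_continuous/derivable1_diffP.
Qed.

(** The derivatives at [0] of [g] to the second order. All second derivatives of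
    functions on R^N are taken along a curve through a point, which sits at the
    parameter [0]; a relation carries existence and value at once. *)
Definition has2 g a b : Prop := exists g1 : R -> R,
  [/\ \forall s \near (0 : R), isd g s (g1 s), g1 0 = a & isd g1 0 b].

Lemma has2_near f g a b : (\forall s \near (0 : R), f s = g s) ->
  has2 f a b -> has2 g a b.
Proof.
move=> /near_join fg [f1 [df f10 df1]]; exists f1; split => //.
by apply: filterS2 fg df => s fgs; exact: isd_near.
Qed.

Lemma has2_lin f g a b a' b' k : has2 f a b -> has2 g a' b' ->
  has2 (fun s => k * f s + g s) (k * a + a') (k * b + b').
Proof.
move=> [f1 [df f10 df1]] [g1 [dg g10 dg1]].
exists (fun s => k * f1 s + g1 s); split; last 2 first.
- by rewrite f10 g10.
- by apply: isdD => //; apply: isdZ.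
by apply: filterS2 df dg => s ds dgs; apply: isdD => //; apply: isdZ.
Qed.

Lemma has2_mul f g a b a' b' : has2 f a b -> has2 g a' b' ->
  has2 (fun s => f s * g s) (a * g 0 + f 0 * a')
    (b * g 0 + 2 * a * a' + f 0 * b').
Proof.
move=> [f1 [df f10 df1]] [g1 [dg g10 dg1]].
exists (fun s => f1 s * g s + f s * g1 s); split; last 2 first.
- by rewrite f10 g10.
- apply: isd_eq.
    apply: isdD; apply: isdM; [exact: df1|exact: nbhs_singleton dg| |exact: dg1].
    exact: nbhs_singleton df.
  by rewrite f10 g10; ring.
by apply: filterS2 df dg => s ds dgs; apply: isdM.
Qed.

Lemma has2_cst k : has2 (fun=> k) 0 0.
Proof.
exists (fun=> 0); split => //; last exact: isdC.
by near=> s; exact: isdC.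
Unshelve. all: by end_near. Qed.

(** Reversing a curve changes the sign of the first derivative only. This is why
    inversions, which reverse dilations, preserve second order equations. *)
Lemma has2N g a b : has2 g a b -> has2 (fun s => g (- s)) (- a) b.
Proof.
move=> [g1 [dg g10 dg1]]; exists (fun s => - g1 (- s)); split.
- have : \forall s \near (0 : R), isd g (- s) (g1 (- s)).
    have H : -%R @ (0 : R) --> (0 : R).
      by rewrite -[X in _ --> X]oppr0; exact: opp_continuous.
    exact: (H _ dg).
  apply: filterS => s ds.
  apply: isd_eq; first by apply: isd_comp ds _; apply: isdN; apply: isdI.
  by rewrite mulrN1.
- by rewrite oppr0 g10.
- have d0 : isd g1 (- 0) b by rewrite oppr0.
  apply: isd_eq.
    by apply: isdN; apply: isd_comp d0 _; apply: isdN; apply: isdI.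
  by rewrite mulrN1 opprK.
Qed.

Lemma has2_expR k : has2 (fun s => expR (k * s)) k (k ^+ 2).
Proof.
have D (s : R) : isd (fun s => expR (k * s)) s (k * expR (k * s)).
  apply: isd_eq.
    by apply: isd_comp (isd_expR _) _; apply: isdZ; apply: isdI.
  by rewrite mulr1 mulrC.
exists (fun s => k * expR (k * s)); split.
- by near=> s; exact: D.
- by rewrite mulr0 expR0 mulr1.
- by apply: isd_eq (isdZ k (D 0)) _; rewrite mulr0 expR0 mulr1.
Unshelve. all: by end_near. Qed.

(** If [b] were negative, [g1] would vanish at the minimum [0] and be negative to
    its right, and [g] would decrease there. *)
Lemma has2_min g a b :
  has2 g a b -> (\forall s \near (0 : R), g 0 <= g s) -> 0 <= b.
Proof.
move=> [g1 [dg g10 dg1]] mg; rewrite leNgt; apply/negP => b0.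
have /nbhs_ballP[e /= e0 H] : \forall s \near (0 : R),
   isd g s (g1 s) /\ g 0 <= g s by exact: filterS2 dg mg => s.
have B (s : R) : `|s| < e -> isd g s (g1 s) /\ g 0 <= g s.
  by move=> se; apply: H; rewrite /ball/= sub0r normrN.
have g1z : g1 0 = 0.
  have d0 : isd g 0 0.
    apply: (@derive1_at_min _ g (- e) e 0).
    - by rewrite lerNl (le_trans _ (ltW e0))// oppr_le0 ltW.
    - move=> t; rewrite in_itv/= => /andP[a1 a2].
      by have [[]] := B t ltac:(by rewrite ltr_norml a1).
    - by rewrite in_itv/= e0 oppr_lt0 e0.
    - move=> t; rewrite in_itv/= => /andP[a1 a2].
      by have [] := B t ltac:(by rewrite ltr_norml a1).
  have d0' : isd g 0 (g1 0) by exact: nbhs_singleton dg.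
  by have [_ <-] := d0'; have [_] := d0.
have cv : h^-1 *: ((g1 \o shift 0) h%:A - g1 0) @[h --> 0^'] --> b.
  by have [ex <-] := dg1; exact: ex.
have : \forall h \near (0 : R)^', h^-1 *: ((g1 \o shift 0) h%:A - g1 0) < 0.
  by move/cvgr_lt : cv; apply.
move=> /nbhs_ballP[d /= d0 K].
pose s := Num.min e d / 2.
have m0 : 0 < Num.min e d by rewrite lt_min e0.
have s0 : 0 < s by rewrite divr_gt0.
have se : s < Num.min e d by rewrite /s ltr_pdivrMr // ltr_pMr // ltr1n.
have neg t : 0 < t -> t <= s -> g1 t < 0.
  move=> t0 ts; have := K t.
  rewrite /ball/= sub0r normrN gtr0_norm // (le_lt_trans ts) => [|]; last first.
    by apply: lt_le_trans se _; rewrite ge_min lexx orbT.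
  move=> /(_ isT) /(_ (lt0r_neq0 t0)); rewrite g1z subr0 addr0 [t%:A]mulr1.
  by rewrite -[_ *: _]/(_ * _) pmulr_rlt0 // invr_gt0.
have le t : 0 <= t -> t <= s -> `|t| < e.
  move=> t0 ts; rewrite ger0_norm //; apply: le_lt_trans ts _.
  by apply: lt_le_trans se _; rewrite ge_min lexx.
have [||c] := @MVT R g g1 0 s s0.
- move=> t; rewrite in_itv/= => /andP[a1 a2].
  by have [] := B t (le t (ltW a1) (ltW a2)).
- apply: derivable_within_continuous => t; rewrite in_itv/= => /andP[a1 a2].
  by have [[]] := B t (le t a1 a2).
rewrite in_itv/= subr0 => /andP[c0 cs] E.
have [_] := B s (le s (ltW s0) (lexx _)).
rewrite -subr_ge0 E leNgt => /negP; apply.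
by rewrite pmulr_llt0 // neg // ltW.
Qed.

End OneVariable.

(** * Euclidean norm, rotations and inversions *)

Section Geometry.
Context {R : realType} {N : nat}.
Implicit Types (x y e : 'rV[R]_N) (i j k : 'I_N) (s t l c : R).

Lemma enorm_ge0 x : 0 <= enorm x.
Proof. exact: sqrtr_ge0. Qed.

Lemma sqr_enorm x : enorm x ^+ 2 = \sum_(i < N) x 0 i ^+ 2.
Proof. by rewrite sqr_sqrtr // sumr_ge0 // => i _; exact: sqr_ge0. Qed.

Lemma enorm_eq0 x : (enorm x == 0) = (x == 0).
Proof.
rewrite -sqrf_eq0 sqr_enorm psumr_eq0; last by move=> i _; exact: sqr_ge0.
apply/allP/eqP => [H|-> i _]; last by rewrite mxE expr0n /= eqxx.
apply/rowP => i; rewrite mxE; apply/eqP; rewrite -sqrf_eq0.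
by apply: H; rewrite mem_index_enum.
Qed.

Lemma enorm_gt0 x : (0 < enorm x) = (x != 0).
Proof. by rewrite lt0r enorm_ge0 enorm_eq0 andbT. Qed.

Lemma enormZ l x : enorm (l *: x) = `|l| * enorm x.
Proof.
rewrite -sqrtr_sqr -sqrtrM ?sqr_ge0 // mulr_sumr; congr Num.sqrt.
by apply: eq_bigr => i _; rewrite mxE exprMn.
Qed.

Lemma coord_le_enorm x i : `|x 0 i| <= enorm x.
Proof.
rewrite -sqrtr_sqr ler_wsqrtr // (bigD1 i) //= lerDl.
by apply: sumr_ge0 => k _; exact: sqr_ge0.
Qed.

Lemma norm_le_enorm x : `|x| <= enorm x.
Proof. by apply/rV_leP => [|i]; [exact: enorm_ge0|exact: coord_le_enorm]. Qed.

Lemma continuous_sqr_enorm : continuous (fun x => \sum_(i < N) x 0 i ^+ 2).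
Proof.
move=> x; apply: continuous_sumr => i; apply: (@continuous_comp _ _ _ (fun y => y 0 i) (fun t : R => t ^+ 2)).
  exact: coord_continuous.
exact: exprn_continuous.
Qed.

Lemma continuous_enorm : continuous (@enorm R N).
Proof.
move=> x; apply: (@continuous_comp _ _ _ _ (@Num.sqrt R)).
  exact: continuous_sqr_enorm.
exact: sqrt_continuous.
Qed.

(** The rotation by the angle [s] in the plane of the coordinates [i] and [j],
    written as a perturbation of [x] that is affine in [cos s] and [sin s]. *)
Definition rot i j s x : 'rV[R]_N := \row_k (x 0 k
  + (cos s - 1) * (x 0 i * (k == i)%:R + x 0 j * (k == j)%:R)
  + sin s * (x 0 i * (k == j)%:R - x 0 j * (k == i)%:R)).

Definition inversion l x : 'rV[R]_N := (l ^+ 2 / enorm x ^+ 2) *: x.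

Lemma rot0 i j x : rot i j 0 x = x.
Proof. by apply/rowP => k; rewrite mxE cos0 sin0 subrr !mul0r !addr0. Qed.

Lemma rotZ i j s l x : rot i j s (l *: x) = l *: rot i j s x.
Proof. by apply/rowP => k; rewrite !mxE; ring. Qed.

Lemma enorm_rot i j s x : i != j -> enorm (rot i j s x) = enorm x.
Proof.
move=> ij; congr Num.sqrt.
rewrite (bigD1 i) //= (bigD1 j) 1?eq_sym //= [RHS](bigD1 i) //= [in RHS](bigD1 j) 1?eq_sym //=.
rewrite !addrA; congr (_ + _); last first.
  apply: eq_bigr => k /andP[ki kj]; rewrite mxE (negbTE ki) (negbTE kj).
  by rewrite /= !mulr0 subrr addr0 !mulr0 !addr0.
rewrite !mxE !eqxx (negbTE ij) eq_sym (negbTE ij) /= !mulr0 !mulr1.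
have := cos2Dsin2 s; set C := cos s; set S := sin s => E.
transitivity ((C ^+ 2 + S ^+ 2) * (x 0 i ^+ 2 + x 0 j ^+ 2)); first by ring.
by rewrite E mul1r.
Qed.

Lemma enorm_dil s x : enorm (expR s *: x) = expR s * enorm x.
Proof. by rewrite enormZ ger0_norm // expR_ge0. Qed.

Lemma inversion_rot l i j s x : i != j ->
  inversion l (rot i j s x) = rot i j s (inversion l x).
Proof. by move=> ij; rewrite /inversion enorm_rot // rotZ. Qed.

Lemma inversion_dil l s x :
  inversion l (expR s *: x) = expR (- s) *: inversion l x.
Proof.
rewrite /inversion enorm_dil !scalerA; congr (_ *: _).
rewrite expRN; have := expR_gt0 s; rewrite lt0r => /andP[s0 _].
have [->|x0] := eqVneq (enorm x) 0.
  by rewrite mulr0 expr0n invr0 !mulr0 mul0r.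
by field; rewrite s0 x0.
Qed.

Lemma enorm_inversion l x : enorm (inversion l x) = l ^+ 2 / enorm x.
Proof.
rewrite enormZ ger0_norm ?divr_ge0 ?sqr_ge0 //.
have [->|x0] := eqVneq (enorm x) 0; first by rewrite invr0 !mulr0.
by field.
Qed.

Lemma inversionK l x : l != 0 -> x != 0 -> inversion l (inversion l x) = x.
Proof.
move=> l0; rewrite -enorm_eq0 => x0.
rewrite {1}/inversion enorm_inversion /inversion scalerA.
rewrite [X in X *: _](_ : _ = 1) ?scale1r //.
by field; rewrite x0.
Qed.

Lemma inversion_neq0 l x : l != 0 -> x != 0 -> inversion l x != 0.
Proof.
move=> l0 x0; rewrite -enorm_eq0 enorm_inversion mulf_neq0 ?invr_eq0 ?enorm_eq0 //.
by rewrite sqrf_eq0.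
Qed.

Lemma inversion_fix l x : enorm x = l -> l != 0 -> inversion l x = x.
Proof. by move=> xl l0; rewrite /inversion xl divff ?scale1r // sqrf_eq0. Qed.

Lemma continuous_scale_curve (g : R -> R) x s : {for s, continuous g} ->
  {for s, continuous (fun t => g t *: x)}.
Proof. by move=> cg; apply: cvgZl cg. Qed.

Lemma dil_cvg x : (fun s : R => expR s *: x) @ (0 : R) --> x.
Proof.
rewrite -[X in _ --> X]scale1r -[X in X *: _]expR0.
by apply: cvgZr_tmp; exact: continuous_expR.
Qed.

Lemma rV_cvg (T : Type) (F : set_system T) (FF : Filter F) (g : T -> 'rV[R]_N) x :
  (forall k, (g t 0 k) @[t --> F] --> x 0 k) -> g @ F --> x.
Proof.
move=> H; apply/cvgrPdist_lt => e e0.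
rewrite nearE; have := @filter_forall _ _ (fun k (a : T) => `|x 0 k - g a 0 k| < e) F FF.
move=> /(_ (fun k => (proj1 (cvgrPdist_lt _ _) (H k)) e e0)).
by apply: filterS => t Ht; apply/rV_ltP => // k; rewrite !mxE; exact: Ht.
Qed.

Lemma rot_cvg i j x : (fun s : R => rot i j s x) @ (0 : R) --> x.
Proof.
apply: rV_cvg => k.
rewrite (_ : (fun s => _) = (fun s => x 0 k
  + (cos s - 1) * (x 0 i * (k == i)%:R + x 0 j * (k == j)%:R)
  + sin s * (x 0 i * (k == j)%:R - x 0 j * (k == i)%:R))); last first.
  by apply/funext => s; rewrite mxE.
have E : x 0 k + (cos 0 - 1) * (x 0 i * (k == i)%:R + x 0 j * (k == j)%:R)
  + sin 0 * (x 0 i * (k == j)%:R - x 0 j * (k == i)%:R) = x 0 k.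
  by rewrite cos0 sin0 subrr !mul0r !addr0.
rewrite -[X in _ --> X]E; apply: cvgD; [apply: cvgD; first exact: cvg_cst|];
  apply: cvgM; try exact: cvg_cst; last exact: continuous_sin.
by apply: cvgB; [exact: continuous_cos|exact: cvg_cst].
Qed.

End Geometry.

(** * The Laplacian of the cylinder *)

Lemma has2_eq (R : realType) (g : R -> R) (a b a' b' : R) :
  has2 g a b -> a = a' -> b = b' -> has2 g a' b'.
Proof. by move=> ? <- <-. Qed.

Lemma isd_sum (R : realType) n (h : 'I_n -> R -> R) (x : R) (d : 'I_n -> R) :
  (forall k, isd (h k) x (d k)) -> isd (fun s => \sum_k h k s) x (\sum_k d k).
Proof.
move=> dh; rewrite (_ : (fun s => _) = \sum_k h k); first exact: is_derive_sum.
by apply/funext => s; rewrite fct_sumE.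
Qed.

Section CylindricalLaplacian.
Context {R : realType} {N : nat}.
Implicit Types (W V : 'rV[R]_N -> R) (x y e : 'rV[R]_N) (i j k : 'I_N)
  (L M l c : R).

(** With [t = ln |x|] and [theta = x / |x|], the number [L] is the value at [x] of
    [d^2/dt^2 + Lap_theta] applied to [W], the Laplacian of the cylinder
    R x S^(N-1). Dilations are the translations in [t], and the Laplacian of the
    sphere is the sum over the pairs [i < j] of the squares of the infinitesimal
    rotations; the factor 1/2 accounts for the ordered pairs. *)
Definition cylLap W x L : Prop := exists (a c : R) (A C : 'I_N -> 'I_N -> R),
  [/\ has2 (fun s => W (expR s *: x)) a c,
      forall i j, i != j -> has2 (fun s => W (rot i j s x)) (A i j) (C i j) &
      L = c + 2^-1 * \sum_i \sum_(j | j != i) C i j].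

Lemma cylLap_lin W V x L M l : cylLap W x L -> cylLap V x M ->
  cylLap (fun y => l * W y + V y) x (l * L + M).
Proof.
move=> [a [c [A [C [rW tW ->]]]]] [a' [c' [A' [C' [rV tV ->]]]]].
exists (l * a + a'), (l * c + c'), (fun i j => l * A i j + A' i j),
  (fun i j => l * C i j + C' i j); split.
- exact: has2_lin rW rV.
- by move=> i j ij; exact: has2_lin (tW i j ij) (tV i j ij).
rewrite (_ : \sum_i \sum_(j | j != i) (l * C i j + C' i j) =
  l * (\sum_i \sum_(j | j != i) C i j) + \sum_i \sum_(j | j != i) C' i j).
  by ring.
rewrite mulr_sumr -big_split; apply: eq_bigr => i _.
by rewrite mulr_sumr -big_split.
Qed.

Lemma cylLap_near W V x L : (\forall y \near x, W y = V y) ->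
  cylLap W x L -> cylLap V x L.
Proof.
move=> WV [a [c [A [C [rW tW ->]]]]].
exists a, c, A, C; split => //.
  by apply: has2_near rW; exact: (@dil_cvg _ _ x _ WV).
by move=> i j ij; apply: has2_near (tW i j ij); exact: (@rot_cvg _ _ i j x _ WV).
Qed.

(** Inversions commute with rotations and reverse dilations: on the cylinder they
    are the reflections of [t], hence isometries. *)
Lemma cylLap_inversion W x L l :
  cylLap W (inversion l x) L -> cylLap (fun y => W (inversion l y)) x L.
Proof.
move=> [a [c [A [C [rW tW ->]]]]]; exists (- a), c, A, C; split => //.
  by under eq_fun do rewrite inversion_dil; exact: (has2N rW).
by move=> i j ij; under eq_fun do rewrite inversion_rot //; exact: tW.
Qed.

(** The maximum principle: [W] has a minimum along each of the curves that define
    the operator. *)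
Lemma cylLap_min W x L : cylLap W x L -> (\forall y \near x, W x <= W y) -> 0 <= L.
Proof.
move=> [a [c [A [C [rW tW ->]]]]] mW; apply: addr_ge0.
  apply: has2_min rW _; rewrite expR0 scale1r.
  exact: (@dil_cvg _ _ x _ mW).
rewrite mulr_ge0 // sumr_ge0 // => i _; rewrite sumr_ge0 // => j ji.
apply: has2_min (tW i j _) _; first by rewrite eq_sym.
by rewrite rot0; exact: (@rot_cvg _ _ i j x _ mW).
Qed.

Lemma cylLap_radial (h : R -> R) x (a c : R) :
  has2 (fun s => h (expR s * enorm x)) a c -> cylLap (fun y => h (enorm y)) x c.
Proof.
move=> hh; exists a, c, (fun _ _ => 0), (fun _ _ => 0); split.
- by under eq_fun do rewrite enorm_dil.
- move=> i j ij; under eq_fun do rewrite enorm_rot //.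
  exact: has2_cst.
- by rewrite big1 ?mulr0 ?addr0 // => i _; rewrite big1.
Qed.

Lemma sum_delta (F : 'I_N -> R) i : \sum_k F k * (k == i)%:R = F i.
Proof.
rewrite (bigD1 i) //= eqxx mulr1 big1 ?addr0 // => k /negbTE ->.
by rewrite mulr0.
Qed.

(** The chain rule applied twice, the second time to the partial derivatives. *)
Lemma has2_C2_curve (U : set 'rV[R]_N) (f : 'rV[R]_N -> R) x
    (g : R -> 'rV[R]_N) (g1 : 'I_N -> R -> R) (g2 : 'I_N -> R) :
  open U -> Ck 2 U f -> U x -> g 0 = x -> g @ (0 : R) --> x ->
  (forall (k : 'I_N) (s : R), isd (fun t => g t 0 k) s (g1 k s)) ->
  (forall k : 'I_N, isd (g1 k) 0 (g2 k)) ->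
  has2 (f \o g) (\sum_k partial k f x * g1 k 0)
    (\sum_k ((\sum_j partial j (partial k f) x * g1 j 0) * g1 k 0
             + partial k f x * g2 k)).
Proof.
move=> oU [cf C1] Ux g0 cg dg dg1.
have nU y : U y -> \forall z \near y, U z by move=> Uy; exact: open_nbhs_nbhs.
have cont (h : 'rV[R]_N -> R) y : {within U, continuous h} -> U y ->
    {for y, continuous h}.
  by move=> ch Uy; move: ch; rewrite continuous_open_subspace //; apply; rewrite inE.
have step (h : 'rV[R]_N -> R) s : U (g s) -> (forall i : 'I_N,
      (forall y, U y -> derivable h y (delta_mx 0 i)) /\
      {within U, continuous (partial i h)}) ->
    isd (h \o g) s (\sum_k partial k h (g s) * g1 k s).
  move=> Us H; apply: is_derive_curve.
  - by move=> i; near=> y; apply: (H i).1; near: y; exact: nU.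
  - by move=> i; apply: cont => //; exact: (H i).2.
  - by move=> i; exact: dg.
exists (fun s => \sum_k partial k f (g s) * g1 k s); split.
- have : \forall s \near (0 : R), U (g s) by apply: (cg); exact: nU.
  apply: filterS => s Us; apply: step => // i; have [df Ck1] := C1 i; split => //.
  by have [] := Ck1.
- by apply: eq_bigr => k _; rewrite g0.
- apply: isd_sum => k; have [df Ck1] := C1 k.
  have := isdM (step _ 0 _ _) (dg1 k); rewrite /= g0; apply => //.
  by move=> i; have [_ /(_ i)[? []]] := Ck1.
Unshelve. all: by end_near. Qed.

(** With [H] the Hessian and [D] the gradient, the summand is the square of an
    infinitesimal rotation. The identity is the polar form of the Laplacian,
    [Lap_theta = |x|^2 Lap - (x.D)^2 - (N - 2) x.D]. *)
Lemma rotational_sum (H : 'I_N -> 'I_N -> R) (D x : 'I_N -> R) :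
  \sum_i \sum_(j | j != i) (H i i * x j ^+ 2 + H j j * x i ^+ 2
    - (H i j + H j i) * (x i * x j) - D i * x i - D j * x j)
  = 2 * ((\sum_i x i ^+ 2) * \sum_i H i i)
   - 2 * (\sum_i \sum_j H i j * (x i * x j)) - 2 * (N%:R - 1) * (\sum_i D i * x i).
Proof.
pose C i j := H i i * x j ^+ 2 + H j j * x i ^+ 2
  - (H i j + H j i) * (x i * x j) - D i * x i - D j * x j.
rewrite -/(C _ _).
have -> : \sum_i \sum_(j | j != i) C i j =
    \sum_i \sum_j C i j - \sum_i C i i.
  rewrite -sumrB; apply: eq_bigr => i _.
  by rewrite [X in _ = X - _](bigD1 i) //= addrAC subrr add0r.
have -> : \sum_i C i i = - 2 * (\sum_i D i * x i).
  by rewrite mulr_sumr; apply: eq_bigr => i _; rewrite /C ; ring.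
have -> : \sum_i \sum_j C i j = \sum_i \sum_j (H i i * x j ^+ 2) +
   \sum_i \sum_j (H j j * x i ^+ 2) - (\sum_i \sum_j H i j * (x i * x j)
    + \sum_i \sum_j H j i * (x i * x j)) - \sum_i \sum_(j < N) D i * x i
    - \sum_(i < N) \sum_j D j * x j.
  rewrite -!big_split -!sumrB; apply: eq_bigr => i _ /=.
  by rewrite -!big_split -!sumrB; apply: eq_bigr => j _; rewrite /C /=; ring.
have -> : \sum_i \sum_j (H i i * x j ^+ 2) = (\sum_i x i ^+ 2) * \sum_i H i i.
  rewrite mulrC mulr_suml; apply: eq_bigr => i _.
  by rewrite -mulr_sumr.
have -> : \sum_i \sum_j (H j j * x i ^+ 2) = (\sum_i x i ^+ 2) * \sum_i H i i.
  rewrite exchange_big mulrC mulr_suml; apply: eq_bigr => i _.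
  by rewrite -mulr_sumr.
have -> : \sum_i \sum_j H j i * (x i * x j) =
     \sum_i \sum_j H i j * (x i * x j).
  rewrite exchange_big; apply: eq_bigr => i _; apply: eq_bigr => j _.
  by rewrite [x j * _]mulrC.
have -> : \sum_i \sum_(j < N) D i * x i = N%:R * (\sum_i D i * x i).
  by rewrite mulr_sumr; apply: eq_bigr => i _; rewrite sumr_const card_ord mulr_natl.
have -> : \sum_(i < N) \sum_j D j * x j = N%:R * (\sum_i D i * x i).
  by rewrite sumr_const card_ord mulr_natl.
by ring.
Qed.

Definition laplacian (f : 'rV[R]_N -> R) x : R := \sum_k partial k (partial k f) x.

Definition radial_deriv (f : 'rV[R]_N -> R) x : R := \sum_k partial k f x * x 0 k.

Lemma has2_powR_dil (n m : R) : 0 < n ->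
  has2 (fun s => (expR s * n) `^ m) (n `^ m * m) (n `^ m * m ^+ 2).
Proof.
move=> n0; have := has2_lin (n `^ m) (has2_expR m) (has2_cst 0).
rewrite !addr0; apply: has2_near; near=> s.
rewrite addr0 powRM ?expR_ge0 ?ltW // mulrC; congr (_ * _).
by rewrite /powR (gt_eqF (expR_gt0 s)) expRK.
Unshelve. all: by end_near. Qed.

(** In polar coordinates [|x|^2 Lap = d^2/dt^2 + (N - 2) d/dt + Lap_theta], and the
    factor [|x|^m = exp (m t)] shifts [d/dt] by [m]. *)
Lemma cylLap_C2 (U : set 'rV[R]_N) (f : 'rV[R]_N -> R) x (m : R) :
  open U -> Ck 2 U f -> U x -> x != 0 ->
  cylLap (fun y => enorm y `^ m * f y) x
   (enorm x `^ m * (m ^+ 2 * f x + (2 * m - (N%:R - 2)) * radial_deriv f x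
      + enorm x ^+ 2 * laplacian f x)).
Proof.
move=> oU C2f Ux x0.
pose D k := partial k f x; pose H j k := partial j (partial k f) x.
pose r2 := \sum_k ((\sum_j H j k * x 0 j) * x 0 k + D k * x 0 k).
have rad : has2 (fun s => f (expR s *: x)) (radial_deriv f x) r2.
  have E0 : expR 0 *: x = x by rewrite expR0 scale1r.
  have d1 (k : 'I_N) (s : R) : isd (fun t => expR t * x 0 k) s (expR s * x 0 k).
    by apply: isd_eq (isdM (isd_expR s) (isdC (x 0 k) s)) _; rewrite mulr0 addr0.
  apply: has2_eq (@has2_C2_curve U f x (fun s => expR s *: x)
    (fun k s => expR s * x 0 k) (fun k => x 0 k) oU C2f Ux E0 (@dil_cvg _ _ x) _ _) _ _.
  - by move=> k s; under eq_fun do rewrite mxE; exact: d1.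
  - by move=> k; apply: isd_eq (d1 k 0) _; rewrite expR0 mul1r.
  - by apply: eq_bigr => k _; rewrite expR0 mul1r.
  apply: eq_bigr => k _; rewrite expR0 mul1r; congr (_ * _ + _).
  by apply: eq_bigr => j _; rewrite mul1r.
pose C i j := H i i * x 0 j ^+ 2 + H j j * x 0 i ^+ 2
  - (H i j + H j i) * (x 0 i * x 0 j) - D i * x 0 i - D j * x 0 j.
have tan i j : i != j -> exists a, has2 (fun s => f (rot i j s x)) a (C i j).
  move=> ij.
  pose d k := x 0 i * (k == j)%:R - x 0 j * (k == i)%:R.
  pose dd k := x 0 i * (k == i)%:R + x 0 j * (k == j)%:R.
  eexists; apply: has2_eq (@has2_C2_curve U f x (fun s => rot i j s x)
    (fun k s => - sin s * dd k + cos s * d k)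
    (fun k => - dd k) oU C2f Ux (rot0 i j x) (@rot_cvg _ _ i j x) _ _) (erefl _) _.
  - move=> k s; under eq_fun do rewrite mxE -/(d k) -/(dd k).
    apply: isd_eq.
      apply: isdD; first apply: isdD; first exact: isdC.
        by apply: isdM (isdB _ (isdC _ _)) (isdC _ _); exact: is_derive_cos.
      by apply: isdM (isdC _ _); exact: is_derive_sin.
    by rewrite /=; ring.
  - move=> k; apply: isd_eq.
      apply: isdD; apply: isdM (isdC _ _); last exact: is_derive_cos.
      by apply: isdN; exact: is_derive_sin.
    by rewrite /= sin0 cos0; ring.
  rewrite sin0 cos0.
  under eq_bigr => k _.
    under eq_bigr do rewrite oppr0 mul0r add0r mul1r.
    rewrite oppr0 mul0r add0r mul1r.
    over.
  have E (F : 'I_N -> R) : \sum_k F k * d k = F j * x 0 i - F i * x 0 j.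
    under eq_bigr do rewrite /d mulrBr !mulrA.
    by rewrite sumrB !sum_delta.
  have E' (F : 'I_N -> R) : \sum_k F k * dd k = F i * x 0 i + F j * x 0 j.
    under eq_bigr do rewrite /dd mulrDr !mulrA.
    by rewrite big_split /= !sum_delta.
  transitivity (\sum_k (H j k * x 0 i - H i k * x 0 j) * d k - \sum_k D k * dd k).
    rewrite -sumrB; apply: eq_bigr => k _.
    by rewrite mulrN -(E (fun l : 'I_N => H l k)).
  rewrite (E (fun k => H j k * x 0 i - H i k * x 0 j)) (E' D) /C.
  move: (H i i) (H i j) (H j i) (H j j) (D i) (D j) (x 0 i) (x 0 j) => *.
  by ring.
have [A HA] : exists A : 'I_N -> 'I_N -> R, forall i j, i != j ->
    has2 (fun s => f (rot i j s x)) (A i j) (C i j).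
  have /choice[A HA] : forall p : 'I_N * 'I_N, exists a, p.1 != p.2 ->
      has2 (fun s => f (rot p.1 p.2 s x)) a (C p.1 p.2).
    move=> [i j] /=; case: (boolP (i == j)) => ij; first by exists 0.
    by have [a Ha] := tan i j ij; exists a.
  by exists (fun i j => A (i, j)) => i j; exact: HA (i, j).
have P : has2 (fun s => (expR s * enorm x) `^ m) (enorm x `^ m * m)
    (enorm x `^ m * m ^+ 2).
  by apply: has2_powR_dil; rewrite enorm_gt0.
exists (enorm x `^ m * m * f x + enorm x `^ m * radial_deriv f x),
  (enorm x `^ m * m ^+ 2 * f x + 2 * (enorm x `^ m * m) * radial_deriv f x + enorm x `^ m * r2),
  (fun i j => enorm x `^ m * A i j), (fun i j => enorm x `^ m * C i j); split.
- under eq_fun do rewrite enorm_dil.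
  by have := has2_mul P rad; rewrite expR0 scale1r mul1r.
- move=> i j ij; under eq_fun do rewrite enorm_rot //.
  have := has2_lin (enorm x `^ m) (HA i j ij) (has2_cst 0).
  rewrite !addr0; apply: has2_near.
  by near=> s; rewrite addr0.
rewrite (_ : \sum_i \sum_(j | j != i) enorm x `^ m * C i j =
  enorm x `^ m * \sum_i \sum_(j | j != i) C i j); last first.
  by rewrite mulr_sumr; apply: eq_bigr => i _; rewrite mulr_sumr.
have S := rotational_sum H D (fun i => x 0 i).
have -> : r2 = \sum_i \sum_j H i j * (x 0 i * x 0 j) + radial_deriv f x.
  rewrite /r2 big_split /=; congr (_ + _).
  rewrite exchange_big; apply: eq_bigr => k _; rewrite mulr_suml; apply: eq_bigr => j _.
  by ring.
rewrite S -sqr_enorm /laplacian -/(radial_deriv f x); field.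
Unshelve. all: by end_near. Qed.

End CylindricalLaplacian.

(** * Power inequalities and annuli *)

Section PowerInequalities.
Context {R : realType}.
Implicit Types (x y p q nu : R).

Lemma continuous_powR p x : 0 < x -> {for x, continuous (fun t : R => t `^ p)}.
Proof. by move=> x0; apply: isd_continuous (isd_powR p x0). Qed.

Lemma continuous_powR_ge0 (T : topologicalType) (f : T -> R) (t : T) p :
  0 < p -> (forall u, 0 <= f u) -> {for t, continuous f} ->
  {for t, continuous (fun u => f u `^ p)}.
Proof.
move=> p0 f0 cf; have := f0 t; rewrite le_eqVlt => /orP[/eqP ft|ft]; last first.
  by apply: (@continuous_comp _ _ _ f (fun v : R => v `^ p)) => //; exact: continuous_powR.
apply/cvgrPdist_lt => e e0; rewrite -ft powR0 ?gt_eqF //.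
have e'0 : 0 < e `^ p^-1 by rewrite powR_gt0.
move/cvgrPdist_lt : cf => /(_ _ e'0); rewrite -ft.
apply: filterS => u; rewrite !sub0r !normrN !ger0_norm ?powR_ge0 //.
move=> H; have := gt0_ltr_powR p0 (f0 u) (ltW e'0) H.
by rewrite -powRrM mulVf ?gt_eqF // powRr1 // ltW.
Qed.

(** The tangent line inequality for a convex function. *)
Lemma powR_sub_le x y p : 1 <= p -> 0 < x -> 0 <= y -> y <= x ->
  x `^ p - y `^ p <= p * x `^ (p - 1) * (x - y).
Proof.
move=> p1 x0; rewrite le_eqVlt => /orP[/eqP <- _|y0].
  rewrite powR0 ?subr0 ?gt_eqF ?(lt_le_trans ltr01) //.
  rewrite -mulrA [X in p * X]mulrC (mulr_powRB1 (ltW x0) (lt_le_trans ltr01 p1)).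
  by apply: ler_peMl => //; exact: powR_ge0.
rewrite le_eqVlt => /orP[/eqP ->|yx]; first by rewrite !subrr mulr0.
have [||c] := @MVT R (fun t => t `^ p) (fun t => p * t `^ (p - 1)) y x yx.
- move=> t; rewrite in_itv/= => /andP[yt _]; exact: isd_powR (lt_trans y0 yt).
- apply: derivable_within_continuous => t; rewrite in_itv/= => /andP[yt _].
  by have [] := isd_powR p (lt_le_trans y0 yt).
rewrite in_itv/= => /andP[yc cx] ->.
rewrite ler_wpM2r ?subr_ge0 ?(ltW yx) // ler_wpM2l ?(le_trans ler01 p1) //.
by rewrite ge0_ler_powR ?nnegrE ?subr_ge0 ?(ltW cx) ?(ltW x0) ?(ltW (lt_trans y0 yc)).
Qed.

(** The first factor falls by exactly [nu] and is compared with its tangent line. The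
    second one may fall by at most [nu], and if it rises it only helps. *)
Lemma source_drop x y x' y' p q nu : 1 <= p -> 1 <= q -> 0 < x -> 0 < y ->
  0 <= x' -> 0 <= y' -> 0 <= nu -> x - x' = nu -> y - y' <= nu ->
  x `^ p * y `^ q - x' `^ p * y' `^ q <=
  (p * x `^ (p - 1) * y `^ q + q * x `^ p * y `^ (q - 1)) * nu.
Proof.
move=> p1 q1 x0 y0 x'0 y'0 nu0 ex ey.
have xx : x' <= x by rewrite -subr_ge0 ex.
have p0 := le_trans ler01 p1; have q0 := le_trans ler01 q1.
have H1 : x `^ p - x' `^ p <= p * x `^ (p - 1) * nu.
  by rewrite -ex; exact: powR_sub_le.
have H2 : y `^ q - y' `^ q <= q * y `^ (q - 1) * nu.
  case: (leP y' y) => yy.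
    apply: le_trans (powR_sub_le q1 y0 y'0 yy) _.
    by rewrite ler_wpM2l // mulr_ge0 // powR_ge0.
  apply: (@le_trans _ _ 0); last by rewrite !mulr_ge0 // powR_ge0.
  by rewrite subr_le0 ge0_ler_powR ?nnegrE // ltW.
have H3 : x' `^ p <= x `^ p by rewrite ge0_ler_powR ?nnegrE // ltW.
have -> : x `^ p * y `^ q - x' `^ p * y' `^ q =
  (x `^ p - x' `^ p) * y `^ q + x' `^ p * (y `^ q - y' `^ q) by ring.
rewrite [X in _ <= X]mulrDl; apply: lerD.
  rewrite -mulrA [_ * nu]mulrC mulrA.
  by apply: ler_wpM2r; [exact: powR_ge0|].
apply: (@le_trans _ _ (x' `^ p * (q * y `^ (q - 1) * nu))).
  by apply: ler_wpM2l; [exact: powR_ge0|].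
have -> : q * x `^ p * y `^ (q - 1) * nu = x `^ p * (q * y `^ (q - 1) * nu) by ring.
by apply: ler_wpM2r => //; rewrite !mulr_ge0 // powR_ge0.
Qed.

End PowerInequalities.

Section Annuli.
Context {R : realType} {N : nat}.
Implicit Types (x y : 'rV[R]_N).

Definition annulus (a b : R) : set 'rV[R]_N := [set y | a <= enorm y <= b].

Lemma closed_superlevel (f : 'rV[R]_N -> R) (c : R) : continuous f -> closed [set y | c <= f y].
Proof.
move=> cf; by apply: (@preimage_closed _ _ f [set t | c <= t]) => [y _|]; [exact: cf|exact: closed_ge].
Qed.

Lemma compact_annulus (a b : R) : compact (annulus a b).
Proof.
apply: bounded_closed_compact.
  exists b; split; first exact: num_real.
  move=> M bM y /= /andP[_ yb]; apply: ltW; apply: le_lt_trans bM.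
  exact: le_trans (norm_le_enorm y) yb.
rewrite (_ : annulus a b = @enorm R N @^-1` `[a, b]%classic).
  by apply: preimage_closed => [y _|]; [exact: continuous_enorm|exact: itv_closed].
by apply/seteqP; split => y; rewrite /annulus/= in_itv.
Qed.

Lemma compact_subset_annulus (a b : R) (K : set 'rV[R]_N) : closed K ->
  K `<=` annulus a b -> compact K.
Proof. by move=> cK KA; exact: (subclosed_compact cK (@compact_annulus a b) KA). Qed.

Lemma EVT_max_at (f : 'rV[R]_N -> R) (K : set 'rV[R]_N) : K !=set0 -> compact K ->
  (forall y, K y -> {for y, continuous f}) ->
  exists2 c, K c & forall t, K t -> f t <= f c.
Proof.
move=> K0 cK cf; have [|c] := EVT_max_rV K0 cK (f := f).
  by apply: continuous_in_subspaceT => y; rewrite inE; exact: cf.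
rewrite inE => Kc H; exists c => // t Kt.
by apply: H; rewrite inE.
Qed.

Lemma continuous_inversion (l : R) x : x != 0 -> {for x, continuous (inversion l)}.
Proof.
move=> x0; apply: (@continuousZ _ _ _ (fun y => l ^+ 2 / enorm y ^+ 2) id).
  apply: continuousM; first exact: cst_continuous.
  apply: (@continuousV _ _ (fun y => enorm y ^+ 2)).
    by rewrite sqrf_eq0 enorm_eq0.
  by apply: continuousM; exact: continuous_enorm.
by [].
Qed.

Lemma near_neq0 x : x != 0 -> \forall y \near x, y != 0.
Proof.
move=> x0; have : \forall y \near x, 0 < enorm y.
  by move/cvgr_gt : (@continuous_enorm R N x); apply; rewrite enorm_gt0.
by apply: filterS => y; rewrite enorm_gt0.
Qed.

Lemma near_enorm_lt x (c : R) : enorm x < c -> \forall y \near x, enorm y < c.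
Proof. by move=> xc; move/cvgr_lt : (@continuous_enorm R N x); apply. Qed.

Lemma near_enorm_gt x (c : R) : c < enorm x -> \forall y \near x, c < enorm y.
Proof. by move=> xc; move/cvgr_gt : (@continuous_enorm R N x); apply. Qed.

End Annuli.

(** * A barrier in a cone *)

Section Barrier.
Context {R : realType} {N : nat}.
Implicit Types (x y e : 'rV[R]_N) (i j k : 'I_N).

Definition dotp e y : R := \sum_k e 0 k * y 0 k.

Lemma dotp_rot e i j (s : R) x : dotp e (rot i j s x) = dotp e x
  + (cos s - 1) * (x 0 i * e 0 i + x 0 j * e 0 j)
  + sin s * (x 0 i * e 0 j - x 0 j * e 0 i).
Proof.
rewrite /dotp.
transitivity (\sum_k (e 0 k * x 0 k
   + ((cos s - 1) * x 0 i - sin s * x 0 j) * (e 0 k * (k == i)%:R)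
   + ((cos s - 1) * x 0 j + sin s * x 0 i) * (e 0 k * (k == j)%:R))).
  by apply: eq_bigr => k _; rewrite mxE; ring.
rewrite !big_split /= -!mulr_sumr !sum_delta; ring.
Qed.

Lemma dotpZr e (l : R) y : dotp e (l *: y) = l * dotp e y.
Proof. by rewrite mulr_sumr; apply: eq_bigr => k _; rewrite mxE; ring. Qed.

Lemma sqr_enorm_sub e y : enorm (y - e) ^+ 2 =
  enorm y ^+ 2 + enorm e ^+ 2 - 2 * dotp e y.
Proof.
rewrite !sqr_enorm mulr_sumr -!big_split -sumrB.
by apply: eq_bigr => k _ /=; rewrite !mxE; ring.
Qed.

Lemma dotp_le e y : enorm e = 1 -> dotp e y <= enorm y.
Proof.
move=> e1; have [->|y0] := eqVneq y 0.
  by rewrite /dotp big1 ?enorm_ge0 // => k _; rewrite mxE mulr0.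
have r0 : 0 < enorm y by rewrite enorm_gt0.
have := sqr_ge0 (enorm ((enorm y)^-1 *: y - e)).
rewrite sqr_enorm_sub enormZ ger0_norm ?invr_ge0 ?(ltW r0) // mulVf ?(lt0r_neq0 r0) // e1 dotpZr.
rewrite expr1n => H.
have : (enorm y)^-1 * dotp e y <= 1 by lra.
by rewrite mulrC ler_pdivrMr ?mul1r.
Qed.

Lemma continuous_dotp e : continuous (dotp e).
Proof.
move=> y; apply: continuous_sumr => k.
by apply: continuousM; [exact: cst_continuous|exact: coord_continuous].
Qed.

Lemma has2_cos_sin (u v w : R) :
  has2 (fun s => u + (cos s - 1) * v + sin s * w) w (- v).
Proof.
have D (s : R) : isd (fun s => u + (cos s - 1) * v + sin s * w) s
    (- sin s * v + cos s * w).
  apply: isd_eq.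
    apply: isdD; first apply: isdD; first exact: isdC.
      by apply: isdM (isdB _ (isdC _ _)) (isdC _ _); exact: is_derive_cos.
    by apply: isdM (isdC _ _); exact: is_derive_sin.
  by rewrite /=; ring.
exists (fun s => - sin s * v + cos s * w); split.
- by near=> s; exact: D.
- by rewrite sin0 cos0; ring.
apply: isd_eq.
  apply: isdD; apply: isdM (isdC _ _); last exact: is_derive_cos.
  by apply: isdN; exact: is_derive_sin.
by rewrite /= sin0 cos0; ring.
Unshelve. all: by end_near. Qed.

(** The quotient [z = dotp e y / enorm y] is the cosine of the angle between [y] and
    the unit vector [e], so the barrier lives on the cone [z >= c]. With
    [K = R2 ^ (- al)] it is positive inside, vanishes on the sphere of radius [R2]
    and vanishes to the second order on the side of the cone. *)
Definition barrier (al K c : R) e y : R :=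
  (enorm y `^ (- al) - K) * (dotp e y / enorm y - c) ^+ 2.

Lemma cylLap_barrier (al K c : R) e x : x != 0 -> enorm e = 1 ->
  let z := dotp e x / enorm x in
  cylLap (barrier al K c e) x
    (al ^+ 2 * enorm x `^ (- al) * (z - c) ^+ 2 + (enorm x `^ (- al) - K)
       * (2 * (1 - z ^+ 2) - 2 * (N%:R - 1) * z * (z - c))).
Proof.
move=> x0 e1 z; have r0 : 0 < enorm x by rewrite enorm_gt0.
have rn := lt0r_neq0 r0.
set h := enorm x `^ (- al) - K.
have rad : has2 (fun s => barrier al K c e (expR s *: x))
    ((z - c) ^+ 2 * (enorm x `^ (- al) * - al) + 0)
    ((z - c) ^+ 2 * (enorm x `^ (- al) * (- al) ^+ 2) + 0).
  have := has2_lin ((z - c) ^+ 2) (has2_powR_dil (- al) r0) (has2_cst (- (z - c) ^+ 2 * K)).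
  apply: has2_near; near=> s.
  rewrite /barrier enorm_dil dotpZr -mulf_div divff ?gt_eqF ?expR_gt0 // mul1r -/z.
  by ring.
pose a i j := (enorm x)^-1 * (x 0 i * e 0 j - x 0 j * e 0 i).
pose b i j := (enorm x)^-1 * - (x 0 i * e 0 i + x 0 j * e 0 j).
have tan i j : has2 (fun s => dotp e (rot i j s x) / enorm x - c) (a i j) (b i j).
  have := has2_lin (enorm x)^-1 (has2_cos_sin (dotp e x) (x 0 i * e 0 i + x 0 j * e 0 j)
    (x 0 i * e 0 j - x 0 j * e 0 i)) (has2_cst (- c)).
  rewrite !addr0; apply: has2_near; near=> s.
  by rewrite dotp_rot [X in _ = X - c]mulrC.
pose C i j := h * (b i j * (z - c) + 2 * a i j * a i j + (z - c) * b i j) + 0.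
pose A i j := h * (a i j * (z - c) + (z - c) * a i j) + 0.
have tan2 i j : i != j -> has2 (fun s => barrier al K c e (rot i j s x)) (A i j) (C i j).
  move=> ij; have := has2_lin h (has2_mul (tan i j) (tan i j)) (has2_cst 0).
  rewrite !rot0; apply: has2_near; near=> s.
  by rewrite /barrier enorm_rot // -/h expr2 addr0.
exists ((z - c) ^+ 2 * (enorm x `^ (- al) * - al) + 0),
  ((z - c) ^+ 2 * (enorm x `^ (- al) * (- al) ^+ 2) + 0), A, C; split => //.
have -> : \sum_i \sum_(j | j != i) C i j = h * \sum_i \sum_(j | j != i)
   ((2 * (e 0 i * e 0 i) / enorm x ^+ 2) * x 0 j ^+ 2
    + (2 * (e 0 j * e 0 j) / enorm x ^+ 2) * x 0 i ^+ 2
    - (2 * (e 0 i * e 0 j) / enorm x ^+ 2 + 2 * (e 0 j * e 0 i) / enorm x ^+ 2)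
       * (x 0 i * x 0 j)
    - (2 * (z - c) * e 0 i / enorm x) * x 0 i - (2 * (z - c) * e 0 j / enorm x) * x 0 j).
  rewrite mulr_sumr; apply: eq_bigr => i _; rewrite mulr_sumr; apply: eq_bigr => j _.
  by rewrite /C /a /b; field.
rewrite (rotational_sum (fun i j => 2 * (e 0 i * e 0 j) / enorm x ^+ 2)
  (fun i => 2 * (z - c) * e 0 i / enorm x) (fun i => x 0 i)) -sqr_enorm.
have -> : \sum_i 2 * (e 0 i * e 0 i) / enorm x ^+ 2 = 2 / enorm x ^+ 2.
  rewrite -mulr_suml -mulr_sumr; congr (_ / _).
  by rewrite -[RHS]mulr1 -(expr1n _ 2) -e1 sqr_enorm.
have -> : \sum_i \sum_j 2 * (e 0 i * e 0 j) / enorm x ^+ 2 * (x 0 i * x 0 j)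
   = 2 * z ^+ 2.
  rewrite (_ : 2 * z ^+ 2 = 2 / enorm x ^+ 2 * (dotp e x * dotp e x)).
    rewrite /dotp big_distrlr /= mulr_sumr; apply: eq_bigr => i _.
    by rewrite mulr_sumr; apply: eq_bigr => j _; field.
  by rewrite /z; field.
have -> : \sum_i 2 * (z - c) * e 0 i / enorm x * x 0 i = 2 * (z - c) * z.
  rewrite (_ : 2 * (z - c) * z = 2 * (z - c) / enorm x * dotp e x).
    by rewrite /dotp mulr_sumr; apply: eq_bigr => i _; field.
  by rewrite {2}/z; field.
by field.
Unshelve. all: by end_near. Qed.

(** Multiplied by [2 * (1 - c)], the expression dominates the square of
    [n * (z - c) - 2 * (1 - c)]. Near the side of the cone [2 * (1 - z ^+ 2)] wins
    over the cross term, elsewhere the large constant [K] does. *)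
Lemma barrier_coefficient (c z n K : R) : 3 / 4 <= c -> c < 1 -> c <= z -> z <= 1 ->
  1 <= n -> K * (2 * (1 - c)) = n ^+ 2 ->
  0 <= K * (z - c) ^+ 2 + 2 * (1 - z ^+ 2) - 2 * (n - 1) * z * (z - c).
Proof.
move=> c34 c1 cz z1 n1 EK.
have g0 : 0 < 2 * (1 - c) by lra.
rewrite -(pmulr_rge0 _ g0).
have -> : 2 * (1 - c) * (K * (z - c) ^+ 2 + 2 * (1 - z ^+ 2) - 2 * (n - 1) * z * (z - c))
  = n ^+ 2 * (z - c) ^+ 2 + 2 * (1 - c) * (2 * (1 - z ^+ 2) - 2 * (n - 1) * z * (z - c)).
  by rewrite -EK; ring.
apply: (@le_trans _ _ ((n * (z - c) - 2 * (1 - c)) ^+ 2)); first exact: sqr_ge0.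
rewrite -subr_ge0.
have -> : n ^+ 2 * (z - c) ^+ 2 +
  2 * (1 - c) * (2 * (1 - z ^+ 2) - 2 * (n - 1) * z * (z - c)) -
  (n * (z - c) - 2 * (1 - c)) ^+ 2 =
  2 * (1 - c) * (2 * (z * (1 - z)) + 2 * ((n - 1) * (z - c) * (1 - z))) by ring.
apply: mulr_ge0; first exact: ltW.
by rewrite addr_ge0 // mulr_ge0 // !mulr_ge0 //; lra.
Qed.

End Barrier.

(** * One equation of the system under an inversion *)

Section HalfSystem.
Context {R : realType} {N : nat} (A B : 'rV[R]_N -> R) (m p q d : R).
Implicit Types (x y : 'rV[R]_N) (l be mu : R).

Definition source x : R := enorm x `^ d * (A x `^ p * B x `^ q).

(** The sum of the derivatives of the source in [A] and in [B]: it bounds the change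
    of the source per unit of a simultaneous change of both unknowns. *)
Definition sensitivity x : R := enorm x `^ d *
  (p * A x `^ (p - 1) * B x `^ q + q * A x `^ p * B x `^ (q - 1)).

Context (p1 : 1 <= p) (q1 : 1 <= q) (d0 : 0 <= d)
  (A0 : forall x, 0 <= A x) (B0 : forall x, 0 <= B x)
  (eqA : forall x, x != 0 -> 0 < A x -> 0 < B x ->
     cylLap A x (m ^+ 2 * A x - source x)).

Lemma inversion_outward l x : 0 <= l -> x != 0 -> enorm x <= l ->
  enorm x <= enorm (inversion l x).
Proof.
move=> l0; rewrite -enorm_gt0 => r0 xl.
by rewrite enorm_inversion ler_pdivlMr // -expr2 lerXn2r ?nnegrE // ltW.
Qed.

Lemma kelvin_difference l x : l != 0 -> x != 0 -> 0 < A x -> 0 < B x ->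
  0 < A (inversion l x) -> 0 < B (inversion l x) ->
  cylLap (fun y => A (inversion l y) - A y) x
    (m ^+ 2 * (A (inversion l x) - A x) - (source (inversion l x) - source x)).
Proof.
move=> l0 x0 Ax Bx Ax' Bx'.
have := cylLap_lin (-1) (eqA x0 Ax Bx)
  (cylLap_inversion (eqA (inversion_neq0 l0 x0) Ax' Bx')).
rewrite (_ : (fun y => -1 * A y + A (inversion l y)) =
  (fun y => A (inversion l y) - A y)); last by apply/funext => y; ring.
by congr cylLap; ring.
Qed.

Lemma cylLap_test_function l be x : 0 < l -> x != 0 ->
  cylLap (fun y => 2 - (enorm y / l) `^ be) x
    (- (be ^+ 2 * (enorm x / l) `^ be)).
Proof.
move=> l0; rewrite -enorm_gt0 => r0.
have rl : 0 < enorm x / l by rewrite divr_gt0.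
apply: (@cylLap_radial _ _ (fun t => 2 - (t / l) `^ be) x
  (-1 * ((enorm x / l) `^ be * be))).
have := has2_lin (-1) (has2_powR_dil be rl) (has2_cst 2).
rewrite !addr0.
rewrite (_ : -1 * ((enorm x / l) `^ be * be ^+ 2) = - (be ^+ 2 * (enorm x / l) `^ be)); last by ring.
apply: has2_near; near=> s.
by rewrite mulrA; ring.
Unshelve. all: by end_near. Qed.

Lemma test_function_bounds l be x : 0 < l -> 0 <= be -> enorm x <= l ->
  1 <= 2 - (enorm x / l) `^ be <= 2.
Proof.
move=> l0 be0 xl.
have P0 : 0 <= (enorm x / l) `^ be by exact: powR_ge0.
have P1 : (enorm x / l) `^ be <= 1.
  rewrite -[leRHS](_ : 1 `^ be = 1); last by rewrite powR1.
  rewrite ge0_ler_powR ?nnegrE ?divr_ge0 ?enorm_ge0 ?(ltW l0) //.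
  by rewrite ler_pdivrMr ?mul1r.
by apply/andP; split; lra.
Qed.

(** The reflected difference of [A] touches the negative test function [- mu * phi]
    from above at [x], so the cylinder Laplacian of their difference is nonnegative
    there. The test function contributes [- be^2 (|x| / l)^be], and the source drops by
    at most [sensitivity x * mu * phi x], because its weight grows outwards. *)
Lemma touching_bound l be mu x : 0 < l -> x != 0 -> enorm x <= l ->
  0 <= be -> 0 < mu -> 0 < A x -> 0 < B x ->
  0 < A (inversion l x) -> 0 < B (inversion l x) ->
  let phi y := 2 - (enorm y / l) `^ be in
  A (inversion l x) - A x = - (mu * phi x) ->
  - (mu * phi x) <= B (inversion l x) - B x ->
  (\forall y \near x, - (mu * phi y) <= A (inversion l y) - A y) ->
  m ^+ 2 * phi x + be ^+ 2 * (enorm x / l) `^ be <= sensitivity x * phi x.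
Proof.
move=> l0 x0 xl be0 mu0 Ax Bx Ax' Bx' phi EA EB near_x.
have ln := lt0r_neq0 l0.
have phi0 : 0 <= phi x by have := test_function_bounds l0 be0 xl; rewrite /phi; lra.
have L := cylLap_lin mu (cylLap_test_function be l0 x0)
  (kelvin_difference ln x0 Ax Bx Ax' Bx').
have : 0 <= mu * - (be ^+ 2 * (enorm x / l) `^ be) +
   (m ^+ 2 * (A (inversion l x) - A x) - (source (inversion l x) - source x)).
  apply: cylLap_min L _; apply: filterS near_x => y /= Hy.
  by rewrite EA -/(phi x) addrN -/(phi y) addrC -lerBlDr sub0r.
have drop : source x - source (inversion l x) <= sensitivity x * (mu * phi x).
  have xo := inversion_outward (ltW l0) x0 xl.
  apply: (@le_trans _ _ (enorm x `^ d * (A x `^ p * B x `^ q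
      - A (inversion l x) `^ p * B (inversion l x) `^ q))).
    rewrite mulrBr lerD2l lerN2 ler_wpM2r ?mulr_ge0 ?powR_ge0 //.
    by rewrite ge0_ler_powR ?nnegrE ?enorm_ge0.
  rewrite -mulrA ler_wpM2l ?powR_ge0 //.
  apply: source_drop => //; first by rewrite mulr_ge0 // ltW.
    by rewrite -opprB EA opprK.
  by rewrite -opprB lerNl.
rewrite EA => H.
have : mu * (m ^+ 2 * phi x + be ^+ 2 * (enorm x / l) `^ be) <= mu * (sensitivity x * phi x).
  move: drop H; move: (source x) (source _) (sensitivity x) (phi x) (_ `^ be) => *.
  by lra.
by rewrite ler_pM2l.
Qed.

(** At a contact point the reflected difference of [A] has the minimum [0], while the
    source is strictly larger on the reflected side because its weight is. *)
Lemma contact_free_weight l x : 0 < d -> 0 < l -> x != 0 -> enorm x < l ->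
  0 < A x -> 0 < B x ->
  (\forall y \near x, A y <= A (inversion l y)) ->
  B x <= B (inversion l x) -> A x < A (inversion l x).
Proof.
move=> dp l0 x0 xl Ax Bx nA BB.
have ln := lt0r_neq0 l0.
have AA : A x <= A (inversion l x) by exact: nbhs_singleton nA.
rewrite lt_neqAle AA andbT; apply/eqP => E.
have Ax' : 0 < A (inversion l x) by rewrite -E.
have Bx' := lt_le_trans Bx BB.
have : 0 <= m ^+ 2 * (A (inversion l x) - A x) -
   (source (inversion l x) - source x).
  apply: cylLap_min (kelvin_difference ln x0 Ax Bx Ax' Bx') _.
  by apply: filterS nA => y Hy; rewrite -E subrr subr_ge0.
rewrite -E subrr mulr0 sub0r oppr_ge0 subr_le0 leNgt => /negP; apply.
rewrite /source -E; have r0 : 0 < enorm x by rewrite enorm_gt0.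
have ro : enorm x < enorm (inversion l x).
  by rewrite enorm_inversion ltr_pdivlMr // -expr2 ltrXn2r ?nnegrE // ltW.
have p0 := lt_le_trans ltr01 p1; have q0 := lt_le_trans ltr01 q1.
apply: (@lt_le_trans _ _ (enorm (inversion l x) `^ d * (A x `^ p * B x `^ q))).
  rewrite ltr_pM2r ?mulr_gt0 ?powR_gt0 //.
  by apply: gt0_ltr_powR => //; rewrite nnegrE ?enorm_ge0.
rewrite ler_wpM2l ?powR_ge0 // ler_wpM2l ?powR_ge0 //.
by rewrite ge0_ler_powR ?nnegrE // ltW.
Qed.

(** The strong maximum principle along a ray. Near [k *: x0] the reflected difference
    of [A] is bounded below by [e0 > 0]. Outwards from a small spherical cap around
    that point it stays above a multiple of a barrier on the cone over the cap: the
    barrier satisfies [L b >= m^2 b], the difference satisfies the reverse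
    inequality, and the barrier is below it on the boundary of the truncated cone. *)
Lemma contact_free_barrier l (x0 : 'rV[R]_N) (k : R) :
  m != 0 -> (0 < N)%N -> 0 < l -> x0 != 0 -> enorm x0 < l -> 0 < k -> k < 1 ->
  (forall y, 0 < A y <-> 0 < B y) ->
  (forall y (t : R), 1 <= t -> 0 < A y -> 0 < A (t *: y)) ->
  (forall y, y != 0 -> {for y, continuous A}) ->
  (forall y, y != 0 -> enorm y <= l ->
     A y <= A (inversion l y) /\ B y <= B (inversion l y)) ->
  0 < A (k *: x0) -> A (k *: x0) < A (inversion l (k *: x0)) ->
  A x0 < A (inversion l x0).
Proof.
move=> m0 N0 l0 x00 x0l k0 k1 AB star cA cmp Ay1 vy1.
have ln := lt0r_neq0 l0.
rewrite ltNge; apply/negP => Ax0.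
pose v y := A (inversion l y) - A y.
have cv y : y != 0 -> {for y, continuous v}.
  move=> y0; apply: (@continuousB _ _ _ (fun y => A (inversion l y)) A); last exact: cA.
  apply: continuous_comp; first exact: continuous_inversion.
  by apply: cA; exact: inversion_neq0.
have n0 : 0 < enorm x0 by rewrite enorm_gt0.
pose y1 := k *: x0; pose r1 := k * enorm x0.
have r10 : 0 < r1 by rewrite mulr_gt0.
have ny1 : enorm y1 = r1 by rewrite enormZ ger0_norm // ltW.
have y10 : y1 != 0 by rewrite -enorm_gt0 ny1.
pose e := (enorm x0)^-1 *: x0.
have e1 : enorm e = 1.
  by rewrite enormZ ger0_norm ?invr_ge0 ?(ltW n0) // mulVf // lt0r_neq0.
have ey1 : y1 = r1 *: e.
  by rewrite /y1 /e /r1 scalerA mulfK // lt0r_neq0.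
pose e0 := v y1 / 2.
have e00 : 0 < e0 by rewrite divr_gt0 // subr_gt0.
have [rho /= rho0 Hrho] : exists2 rho : R, 0 < rho & forall y, enorm (y - y1) < rho ->
    0 < A y /\ e0 <= v y.
  have : \forall y \near y1, 0 < A y /\ e0 <= v y.
    near=> y; split.
      by near: y; move/cvgr_gt : (cA _ y10); apply.
    near: y; move/cvgr_ge : (cv _ y10); apply.
    by rewrite /e0 ltr_pdivrMr // ltr_pMr ?ltr1n // subr_gt0.
  move/nbhs_ballP => [rho /= rho0 H]; exists rho => // y yr.
  by apply: H; rewrite -ball_normE /= distrC; apply: le_lt_trans (norm_le_enorm _) yr.
(* the cap z >= 1 - g of the sphere of radius r1 lies in the ball of radius rho
   around y1 *)
pose g := Num.min (1 / 4) (rho ^+ 2 / (4 * r1 ^+ 2)).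
have g0 : 0 < g by rewrite lt_min !divr_gt0 // ?mulr_gt0 ?exprn_gt0.
have g4 : g <= 1 / 4 by rewrite ge_min lexx.
have grho : g * (4 * r1 ^+ 2) <= rho ^+ 2.
  by rewrite -ler_pdivlMr ?mulr_gt0 ?exprn_gt0 // ge_min lexx orbT.
pose c := 1 - g.
have c34 : 3 / 4 <= c by rewrite /c; lra.
have c1 : c < 1 by rewrite /c; lra.
pose z (y : 'rV[R]_N) := dotp e y / enorm y.
have cap y : enorm y = r1 -> c <= z y -> 0 < A y /\ e0 <= v y.
  move=> yr cz; apply: Hrho.
  rewrite -(@ltr_pXn2r _ 2) ?nnegrE ?enorm_ge0 ?(ltW rho0) //.
  rewrite ey1 sqr_enorm_sub enormZ e1 mulr1 ger0_norm ?(ltW r10) // yr.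
  have : dotp (r1 *: e) y = r1 ^+ 2 * z y.
    rewrite /z yr expr2 -mulrA [_ / r1]mulrC mulVKf ?lt0r_neq0 //.
    by rewrite /dotp mulr_sumr; apply: eq_bigr => i _; rewrite mxE mulrA.
  move=> ->.
  have r2 : 0 < r1 ^+ 2 by rewrite exprn_gt0.
  have : r1 ^+ 2 * c <= r1 ^+ 2 * z y by rewrite ler_pM2l.
  have : 0 < g * r1 ^+ 2 by rewrite mulr_gt0.
  rewrite /c; move: (r1 ^+ 2) (z y) (rho ^+ 2) grho r2 => u w t; nra.
pose R2 := (enorm x0 + l) / 2.
have R2x : enorm x0 < R2 by rewrite /R2; lra.
have R2l : R2 < l by rewrite /R2; lra.
have R20 : 0 < R2 by exact: lt_trans R2x.
have r1x : r1 < enorm x0 by rewrite gtr_pMl.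
pose K := [set y : 'rV[R]_N | r1 <= enorm y <= R2 /\ c * enorm y <= dotp e y].
have Kpos y : K y -> [/\ 0 < enorm y, y != 0, c <= z y & z y <= 1].
  move=> [/andP[ry _] cy].
  have ny : 0 < enorm y by exact: lt_le_trans ry.
  split => //; first by rewrite -enorm_gt0.
    by rewrite /z ler_pdivlMr.
  by rewrite /z ler_pdivrMr // mul1r dotp_le.
have KA y : K y -> 0 < A y.
  move=> Ky; have [ny y0 cz _] := Kpos y Ky.
  have [/andP[ry _] _] := Ky.
  pose t := enorm y / r1.
  have t0 : 0 < t by rewrite divr_gt0.
  have t1 : 1 <= t by rewrite ler_pdivlMr // mul1r.
  have -> : y = t *: (t^-1 *: y) by rewrite scalerA divff ?scale1r // lt0r_neq0.
  have nty : enorm (t^-1 *: y) = r1.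
    rewrite enormZ ger0_norm ?invr_ge0 ?(ltW t0) // /t invf_div mulfVK //.
    exact: lt0r_neq0.
  apply: star => //; apply: (cap _ nty _).1.
  rewrite /z nty dotpZr; move: cz; rewrite /z.
  have rn := lt0r_neq0 r10; have nn := lt0r_neq0 ny.
  by suff -> : t^-1 * dotp e y / r1 = dotp e y / enorm y by []; rewrite /t; field; rewrite rn nn.
have cK : compact K.
  apply: (@compact_subset_annulus _ _ r1 R2); last by move=> y [].
  rewrite (_ : K = annulus r1 R2 `&` [set y | 0 <= dotp e y - c * enorm y]).
    apply: closedI; first by apply: compact_closed; [exact: norm_hausdorff|exact: compact_annulus].
    apply: closed_superlevel => y; apply: (@continuousB _ _ _ (dotp e) (fun y => c * enorm y)).
      exact: continuous_dotp.
    by apply: continuousM; [exact: cst_continuous|exact: continuous_enorm].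
  by apply/seteqP; split => y; rewrite /K /annulus/= subr_ge0.
(* al^2 exceeds m^2 by the constant that [barrier_coefficient] asks for *)
pose al := Num.sqrt (m ^+ 2 + N%:R ^+ 2 / (2 * (1 - c))).
have Eal : al ^+ 2 = m ^+ 2 + N%:R ^+ 2 / (2 * (1 - c)).
  by rewrite sqr_sqrtr // addr_ge0 ?sqr_ge0 // divr_ge0 ?sqr_ge0 // /c; lra.
pose H0 := R2 `^ (- al).
have al0 : 0 <= al by exact: sqrtr_ge0.
have hpos y : 0 < enorm y -> enorm y <= R2 -> 0 <= enorm y `^ (- al) - H0.
  move=> ny yR; rewrite subr_ge0 /H0 !powRN lef_pV2 ?posrE ?powR_gt0 //.
  by rewrite ge0_ler_powR ?nnegrE // ltW.
have H00 : 0 <= H0 by exact: powR_ge0.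
(* this multiple keeps the barrier below e0 on the inner sphere *)
pose ep := e0 * r1 `^ al.
have ep0 : 0 < ep by rewrite mulr_gt0 ?powR_gt0.
pose b := barrier al H0 c e.
have cb y : y != 0 -> {for y, continuous b}.
  move=> y0; have ny : 0 < enorm y by rewrite enorm_gt0.
  apply: (@continuousM _ _ (fun y => enorm y `^ (- al) - H0)
     (fun y => (dotp e y / enorm y - c) ^+ 2)).
    apply: (@continuousB _ _ _ (fun y => enorm y `^ (- al)) (cst H0)); last exact: cst_continuous.
    apply: (@continuous_comp _ _ _ (@enorm R N) (fun t : R => t `^ (- al))).
      exact: continuous_enorm.
    exact: continuous_powR.
  have cz : {for y, continuous (fun y => dotp e y / enorm y - c)}.
    apply: (@continuousB _ _ _ (fun y => dotp e y / enorm y) (cst c)); last exact: cst_continuous.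
    apply: (@continuousM _ _ (dotp e) (fun y => (enorm y)^-1)); first exact: continuous_dotp.
    by apply: (@continuousV _ _ (@enorm R N)); [rewrite lt0r_neq0|exact: continuous_enorm].
  exact: (@continuousM _ _ _ _ _ cz cz).
have Ex0 : dotp e x0 = enorm x0.
  have -> : dotp e x0 = (enorm x0)^-1 * enorm x0 ^+ 2.
    by rewrite sqr_enorm mulr_sumr; apply: eq_bigr => i _; rewrite mxE expr2 mulrA.
  by rewrite expr2 mulKf // lt0r_neq0.
have Kx0 : K x0.
  split; first by rewrite !ltW.
  by rewrite Ex0 ger_pMl // ltW.
(* P minimises v - ep * b; b x0 > 0 >= v x0 makes the minimum negative, and then
   P lies in the interior of K *)
have [P KP minP] : exists2 P, K P & forall y, K y -> v P - ep * b P <= v y - ep * b y.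
  have [||P KP HP] := @EVT_max_at R N (fun y => ep * b y - v y) K _ cK.
  - by exists x0.
  - move=> y /Kpos[_ y0 _ _]; apply: (@continuousB _ _ _ (fun y => ep * b y) v); last exact: cv.
    by apply: continuousM; [exact: cst_continuous|exact: cb].
  by exists P => // y /HP; lra.
have [nP P0 czP zP1] := Kpos P KP.
have [/andP[rP PR] cP] := KP.
have Pl : enorm P < l by exact: le_lt_trans R2l.
have bx0 : 0 < b x0.
  rewrite /b /barrier Ex0 divff ?lt0r_neq0 // mulr_gt0 ?exprn_gt0 ?subr_gt0 //.
  rewrite /H0 !powRN ltf_pV2 ?posrE ?powR_gt0 //.
  apply: gt0_ltr_powR; rewrite ?nnegrE ?enorm_ge0 ?(ltW R20) //.
  rewrite sqrtr_gt0 ltr_wpDl ?sqr_ge0 // divr_gt0 ?exprn_gt0 ?ltr0n //.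
  by rewrite mulr_gt0 // subr_gt0.
have vx0 : v x0 <= 0 by rewrite subr_le0.
have vP : v P < ep * b P.
  have := minP _ Kx0; have : 0 < ep * b x0 by rewrite mulr_gt0.
  lra.
have [AP BP] := cmp P P0 (ltW Pl).
have vP0 : 0 <= v P by rewrite subr_ge0.
have bP : 0 < b P by rewrite -(pmulr_rgt0 _ ep0); exact: le_lt_trans vP.
pose h := enorm P `^ (- al) - H0.
have h0 : 0 <= h by exact: hpos.
have hn0 : h != 0.
  by apply/eqP => hE; move: bP; rewrite /b /barrier -/h hE mul0r ltxx.
have zn0 : z P - c != 0.
  by apply/eqP => hE; move: bP; rewrite /b /barrier -/(z P) hE expr0n mulr0 ltxx.
have PR' : enorm P < R2.
  rewrite lt_neqAle PR andbT; apply/eqP => E; move: hn0.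
  by rewrite /h E subrr eqxx.
have czP' : c < z P by rewrite lt_neqAle czP andbT eq_sym -subr_eq0.
have rP' : r1 < enorm P.
  rewrite lt_neqAle rP andbT; apply/eqP => E.
  have [_ e0v] := cap P (esym E) czP.
  move: vP; rewrite ltNge => /negP; apply; apply: le_trans e0v.
  have -> : e0 = ep * (enorm P `^ (- al) * 1).
    by rewrite mulr1 -E /ep -mulrA -powRD ?subrr ?powRr0 ?mulr1 // lt0r_neq0 ?implybT.
  rewrite ler_pM2l // /b /barrier -/(z P) ler_pM ?sqr_ge0 //.
    by rewrite gerBl.
  by rewrite expr_le1 ?subr_ge0 //; lra.
have nearK : \forall y \near P, K y.
  near=> y; split.
    apply/andP; split; apply: ltW; near: y; [exact: near_enorm_gt|exact: near_enorm_lt].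
  rewrite -subr_ge0; apply: ltW; near: y.
  have cc : {for P, continuous (fun y => dotp e y - c * enorm y)}.
    apply: (@continuousB _ _ _ (dotp e) (fun y => c * enorm y)); first exact: continuous_dotp.
    by apply: continuousM; [exact: cst_continuous|exact: continuous_enorm].
  move/cvgr_gt : cc; apply.
  by rewrite subr_gt0 -ltr_pdivlMr.
have APp := KA P KP; have BPp := (AB P).1 APp.
have L := cylLap_lin (- ep) (cylLap_barrier al H0 c P0 e1)
  (kelvin_difference ln P0 APp BPp (lt_le_trans APp AP) (lt_le_trans BPp BP)).
pose LB := al ^+ 2 * enorm P `^ (- al) * (z P - c) ^+ 2 +
  h * (2 * (1 - z P ^+ 2) - 2 * (N%:R - 1) * z P * (z P - c)).
have HL : 0 <= - ep * LB + (m ^+ 2 * v P - (source (inversion l P) - source P)).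
  apply: cylLap_min L _; apply: filterS nearK => y Ky.
  by have := minP y Ky; rewrite -/b -/(v y) -/(v P); lra.
have SS : source P <= source (inversion l P).
  rewrite /source ler_pM ?mulr_ge0 ?powR_ge0 //.
    by rewrite ge0_ler_powR ?nnegrE ?enorm_ge0 ?inversion_outward // ltW.
  have p0 := le_trans ler01 p1; have q0 := le_trans ler01 q1.
  by rewrite ler_pM ?powR_ge0 // ge0_ler_powR ?nnegrE.
have LBge : m ^+ 2 * b P <= LB.
  have coef : 0 <= (N%:R ^+ 2 / (2 * (1 - c))) * (z P - c) ^+ 2 + 2 * (1 - z P ^+ 2)
       - 2 * (N%:R - 1) * z P * (z P - c).
    apply: barrier_coefficient => //; first by rewrite ler1n.
    by rewrite divfK // lt0r_neq0 // mulr_gt0 // subr_gt0.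
  have E : al ^+ 2 * h * (z P - c) ^+ 2 <= al ^+ 2 * enorm P `^ (- al) * (z P - c) ^+ 2.
    by rewrite ler_wpM2r ?sqr_ge0 // ler_wpM2l ?sqr_ge0 // gerBl.
  have {}coef := mulr_ge0 h0 coef.
  have -> : b P = h * (z P - c) ^+ 2 by [].
  move: E coef; rewrite /LB Eal.
  move: (N%:R ^+ 2 / _) (enorm P `^ _) ((z P - c) ^+ 2) => u w t; nra.
have H1 : m ^+ 2 * v P < m ^+ 2 * (ep * b P) by rewrite ltr_pM2l // exprn_even_gt0.
have H2 : ep * (m ^+ 2 * b P) <= ep * LB by rewrite ler_pM2l.
move: HL SS H1 H2; clear LBge; move: (source _) (source _) LB (v P) (b P) => *.
lra.
Unshelve. all: by end_near. Qed.

End HalfSystem.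

(** * Leaving the positivity set along a ray *)

Section HalfSystemTools.
Context {R : realType} {N : nat}.
Implicit Types (A B : 'rV[R]_N -> R) (x y : 'rV[R]_N) (l : R).

Lemma inversion_scale l x (k : R) : k != 0 ->
  inversion l (k *: x) = (l ^+ 2 / (k * enorm x ^+ 2)) *: x.
Proof.
move=> k0; rewrite /inversion scalerA enormZ exprMn real_normK ?num_real //.
congr (_ *: _); have [->|x0] := eqVneq (enorm x) 0.
  by rewrite expr0n !mulr0 invr0 !mulr0 mul0r.
by field; rewrite x0 k0.
Qed.

Lemma near_gt0_scale A x (k : R) : (forall y, y != 0 -> {for y, continuous A}) ->
  x != 0 -> k != 0 -> 0 < A (k *: x) -> \forall t \near k, 0 < A (t *: x).
Proof.
move=> cA x0 k0 Ak.
have c : {for k, continuous (fun t : R => A (t *: x))}.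
  apply: (@continuous_comp _ _ _ (fun t : R => t *: x) A).
    by apply: continuous_scale_curve.
  by apply: cA; rewrite scaler_eq0 negb_or k0.
by move/cvgr_gt : c; apply.
Qed.

(** Let [t0 *: x] be the last point of the segment from [0] to [x] outside the
    positivity set. Its reflection lies further out on the same ray, hence in the
    positivity set, so the order is strict just after [t0]. *)
Lemma ray_exit A l x (k : R) : 0 < l -> x != 0 -> enorm x < l -> 0 < k -> k < 1 ->
  (forall y, 0 <= A y) -> (forall y, y != 0 -> {for y, continuous A}) ->
  (forall y (t : R), 1 <= t -> 0 < A y -> 0 < A (t *: y)) ->
  0 < A x -> A (k *: x) = 0 ->
  exists k1 : R, [/\ 0 < k1, k1 < 1, 0 < A (k1 *: x) &
    A (k1 *: x) < A (inversion l (k1 *: x))].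
Proof.
move=> l0 x0 xl k0 k1 A0 cA star Ax Ak.
have n0 : 0 < enorm x by rewrite enorm_gt0.
pose S : set R := [set t | 0 < t < 1 /\ A (t *: x) = 0].
have Sk : S k by split => //; rewrite k0.
have supS : has_sup S.
  by split; [exists k|exists 1 => t [/andP[_ /ltW]]].
pose t0 := sup S.
have kt0 : k <= t0 by apply: ub_le_sup => //; exact: supS.2.
have t00 : 0 < t0 by exact: lt_le_trans kt0.
have t01 : t0 <= 1 by apply: ge_sup => [|t [/andP[_ /ltW]]//]; exists k.
have At0 : A (t0 *: x) = 0.
  apply/eqP; have := A0 (t0 *: x); rewrite le_eqVlt eq_sym => /orP[//|At].
  have /nbhs_ballP[e /= e0 He] := near_gt0_scale cA x0 (lt0r_neq0 t00) At.
  have [t [/andP[tp t1'] At0] tt] := sup_adherent e0 supS.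
  have tle : t <= t0 by apply: ub_le_sup => //; [exact: supS.2|split => //; rewrite tp].
  have := He t; rewrite At0 ltxx => /(_ _)/[!falseE]; case.
  rewrite /ball/= ger0_norm ?subr_ge0 //; move: tt; rewrite -/t0; lra.
have t01' : t0 < 1.
  rewrite lt_neqAle t01 andbT; apply/eqP => E.
  by move: At0; rewrite E scale1r => Ex; move: Ax; rewrite Ex ltxx.
have Ainv : 0 < A (inversion l (t0 *: x)).
  rewrite inversion_scale ?lt0r_neq0 //; apply: star => //.
  rewrite ler_pdivlMr ?mulr_gt0 ?exprn_gt0 // mul1r.
  apply: (@le_trans _ _ (enorm x ^+ 2)); first by rewrite ger_pMl ?exprn_gt0.
  by rewrite lerXn2r ?nnegrE ?ltW.
have c : {for t0, continuous (fun t : R => A (inversion l (t *: x)) - A (t *: x))}.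
  have tx : t0 *: x != 0 by rewrite scaler_eq0 negb_or lt0r_neq0.
  apply: (@continuousB _ _ _ (fun t : R => A (inversion l (t *: x))) (fun t : R => A (t *: x))).
    apply: (@continuous_comp _ _ _ (fun t : R => t *: x) (fun y => A (inversion l y))).
      exact: continuous_scale_curve.
    apply: (@continuous_comp _ _ _ (inversion l) A); first exact: continuous_inversion.
    by apply: cA; apply: inversion_neq0 => //; rewrite lt0r_neq0.
  apply: (@continuous_comp _ _ _ (fun t : R => t *: x) A); first exact: continuous_scale_curve.
  exact: cA.
have : \forall t \near t0, 0 < A (inversion l (t *: x)) - A (t *: x).
  by move/cvgr_gt : c; apply; rewrite At0 subr0.
move=> /nbhs_ballP[e /= e0 He].
pose k1' := t0 + Num.min (e / 2) ((1 - t0) / 2).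
have mp : 0 < Num.min (e / 2) ((1 - t0) / 2) by rewrite lt_min !divr_gt0 // subr_gt0.
have me : Num.min (e / 2) ((1 - t0) / 2) <= e / 2 by rewrite ge_min lexx.
have m1 : Num.min (e / 2) ((1 - t0) / 2) <= (1 - t0) / 2 by rewrite ge_min lexx orbT.
have k10 : 0 < k1' by rewrite /k1'; lra.
have k11 : k1' < 1 by rewrite /k1'; lra.
exists k1'; split => //.
  have := A0 (k1' *: x); rewrite le_eqVlt => /orP[/eqP E|//].
  have : k1' <= t0 by apply: ub_le_sup => //; [exact: supS.2|split => //; rewrite k10].
  by rewrite /k1'; lra.
rewrite -subr_gt0; apply: He; rewrite /ball/= distrC ger0_norm /k1'; lra.
Qed.

Lemma near_inversion_gt A x l : x != 0 -> l != 0 ->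
  (forall y, y != 0 -> {for y, continuous A}) -> A x < A (inversion l x) ->
  \forall x' \near x & l' \near l, A x' < A (inversion l' x').
Proof.
move=> x0 l0 cA H.
have i0 : inversion l x != 0 by exact: inversion_neq0.
have c : {for (x, l), continuous (fun z : 'rV[R]_N * R => A (inversion z.2 z.1) - A z.1)}.
  apply: (@continuousB _ _ _ (fun z : 'rV[R]_N * R => A (inversion z.2 z.1)) (fun z => A z.1)).
    apply: (@continuous_comp _ _ _ (fun z : 'rV[R]_N * R => inversion z.2 z.1) A); last exact: cA.
    apply: (@continuousZ _ _ _ (fun z : 'rV[R]_N * R => z.2 ^+ 2 / enorm z.1 ^+ 2) fst); last exact: cvg_fst.
    have cn : {for (x, l), continuous (fun z : 'rV[R]_N * R => enorm z.1)}.
      by apply: (@continuous_comp _ _ _ fst (@enorm R N)); [exact: cvg_fst|exact: continuous_enorm].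
    have cl : {for (x, l), continuous (fun z : 'rV[R]_N * R => z.2)} by exact: cvg_snd.
    apply: (@continuousM _ _ (fun z : 'rV[R]_N * R => z.2 ^+ 2) (fun z => (enorm z.1 ^+ 2)^-1)).
      exact: (continuousM cl cl).
    apply: (@continuousV _ _ (fun z : 'rV[R]_N * R => enorm z.1 ^+ 2)); last exact: (continuousM cn cn).
    by rewrite sqrf_eq0 enorm_eq0.
  by apply: (@continuous_comp _ _ _ fst A); [exact: cvg_fst|exact: cA].
have : \forall z \near (x, l), 0 < A (inversion z.2 z.1) - A z.1.
  by move/cvgr_gt : c; apply; rewrite subr_gt0.
case=> [[U V] /= [Ux Vl] UV]; exists (U, V) => // z Uz.
by have := UV z Uz; rewrite /= subr_gt0.
Qed.

Lemma sensitivity_continuous A B (p q d : R) x : 1 < p -> 1 < q -> x != 0 ->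
  (forall y, 0 <= A y) -> (forall y, 0 <= B y) ->
  {for x, continuous A} -> {for x, continuous B} ->
  {for x, continuous (sensitivity A B p q d)}.
Proof.
move=> p1 q1 x0 A0 B0 cA cB.
have pp : 0 < p by exact: lt_trans p1. have qp : 0 < q by exact: lt_trans q1.
have pq : 0 < p - 1 by rewrite subr_gt0. have qq : 0 < q - 1 by rewrite subr_gt0.
apply: continuousM.
  apply: (@continuous_comp _ _ _ (@enorm R N) (fun t : R => t `^ d)).
    exact: continuous_enorm.
  by apply: continuous_powR; rewrite enorm_gt0.
apply: continuousD; (apply: continuousM; first apply: continuousM;
  [exact: cst_continuous|exact: continuous_powR_ge0|exact: continuous_powR_ge0]).
Qed.

Lemma sensitivity_ge0 A B (p q d : R) x : 0 <= p -> 0 <= q -> 0 <= sensitivity A B p q d x.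
Proof. by move=> p0 q0; rewrite mulr_ge0 ?addr_ge0 ?mulr_ge0 ?powR_ge0. Qed.

Lemma sensitivity_eq0 A B (p q d : R) x : 1 < p -> 1 < q ->
  A x = 0 -> B x = 0 -> sensitivity A B p q d x = 0.
Proof.
move=> p1 q1 A0 B0; rewrite /sensitivity A0 B0 !powR0 ?subr_eq0 ?gt_eqF //.
- by rewrite !(mulr0, addr0).
- exact: lt_trans p1.
- exact: lt_trans q1.
Qed.

End HalfSystemTools.

(** * Moving spheres *)

Section MovingSpheres.
Context {R : realType} {N : nat} (W1 W2 : 'rV[R]_N -> R) (m p q r s d1 d2 : R).
Implicit Types (x y : 'rV[R]_N) (l : R).

Local Notation sens1 := (sensitivity W1 W2 p q d1).
Local Notation sens2 := (sensitivity W2 W1 s r d2).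

Context (m_neq0 : m != 0) (N_gt0 : (0 < N)%N)
  (p_gt1 : 1 < p) (q_gt1 : 1 < q) (r_gt1 : 1 < r) (s_gt1 : 1 < s)
  (d1_ge0 : 0 <= d1) (d2_ge0 : 0 <= d2)
  (W1_ge0 : forall x, 0 <= W1 x) (W2_ge0 : forall x, 0 <= W2 x)
  (W1_cont : forall x, x != 0 -> {for x, continuous W1})
  (W2_cont : forall x, x != 0 -> {for x, continuous W2})
  (W12 : forall x, 0 < W1 x <-> 0 < W2 x)
  (star : forall x (t : R), 1 <= t -> 0 < W1 x -> 0 < W1 (t *: x))
  (eq1 : forall x, x != 0 -> 0 < W1 x -> 0 < W2 x ->
     cylLap W1 x (m ^+ 2 * W1 x - source W1 W2 p q d1 x))
  (eq2 : forall x, x != 0 -> 0 < W2 x -> 0 < W1 x ->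
     cylLap W2 x (m ^+ 2 * W2 x - source W2 W1 s r d2 x))
  (vanish : forall e : R, 0 < e -> exists2 rho : R, 0 < rho &
     forall x, x != 0 -> enorm x < rho -> W1 x < e /\ W2 x < e)
  (rho0 : R) (rho0_gt0 : 0 < rho0)
  (sens_small : forall x, x != 0 -> enorm x <= rho0 ->
     sens1 x < m ^+ 2 /\ sens2 x < m ^+ 2)
  (strict : (0 < d1 /\ 0 < d2) \/
     forall x, x != 0 -> 0 < W1 x -> exists k : R, [/\ 0 < k, k < 1 & W1 (k *: x) = 0]).

Definition ordered l := forall x, x != 0 -> enorm x <= l ->
  W1 x <= W1 (inversion l x) /\ W2 x <= W2 (inversion l x).

Let star2 x (t : R) : 1 <= t -> 0 < W2 x -> 0 < W2 (t *: x).
Proof. by move=> t1 /W12 H; apply/W12; exact: star. Qed.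

Lemma pos_inversion l x : 0 < l -> x != 0 -> enorm x <= l -> 0 < W1 x ->
  0 < W1 (inversion l x).
Proof.
move=> l0 x0 xl H; apply: star => //.
rewrite ler_pdivlMr ?exprn_gt0 ?enorm_gt0 // mul1r lerXn2r ?nnegrE ?enorm_ge0 //.
exact: ltW.
Qed.

(** Since [1 <= phi <= 2], the inequality of [touching_bound] forces both
    [m ^+ 2 <= sensitivity x] and [be^2 (|x| / l)^be <= 2 * sensitivity x]. *)
Lemma touching_excluded (A B : 'rV[R]_N -> R) (P Q d : R) l (be mu : R) x :
  1 < P -> 1 < Q -> 0 <= d -> (forall x, 0 <= A x) -> (forall x, 0 <= B x) ->
  (forall x, x != 0 -> 0 < A x -> 0 < B x ->
     cylLap A x (m ^+ 2 * A x - source A B P Q d x)) ->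
  (forall x, 0 < A x <-> 0 < B x) ->
  (forall x, x != 0 -> enorm x <= l -> 0 < A x -> 0 < A (inversion l x)) ->
  0 < l -> x != 0 -> enorm x < l -> 0 <= be -> 0 < mu ->
  let phi y := 2 - (enorm y / l) `^ be in
  A x - A (inversion l x) = mu * phi x ->
  B x - B (inversion l x) <= mu * phi x ->
  (\forall y \near x, A y - A (inversion l y) <= mu * phi y) ->
  sensitivity A B P Q d x < m ^+ 2 \/
  2 * sensitivity A B P Q d x < be ^+ 2 * (enorm x / l) `^ be -> False.
Proof.
move=> P1 Q1 d0 A0 B0 eqA AB pinv l0 x0 xl be0 mu0 phi EA EB nA alt.
have /andP[phi1 phi2] := test_function_bounds l0 be0 (ltW xl).
have phi0 : 0 < phi x by exact: lt_le_trans phi1.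
have Ax : 0 < A x.
  have := A0 (inversion l x); have : 0 < mu * phi x by rewrite mulr_gt0.
  by rewrite -EA; lra.
have Ax' := pinv x x0 (ltW xl) Ax.
have := @touching_bound R N A B m P Q d (ltW P1) (ltW Q1) d0 A0 B0 eqA l be mu x
  l0 x0 (ltW xl) be0 mu0 Ax ((AB _).1 Ax) Ax' ((AB _).1 Ax').
rewrite -/(phi x) => H.
have {H} : m ^+ 2 * phi x + be ^+ 2 * (enorm x / l) `^ be <=
    sensitivity A B P Q d x * phi x.
  apply: H; first by rewrite -EA opprB.
    by rewrite lerNl opprB.
  by apply: filterS nA => y; rewrite lerNl opprB.
have S0 : 0 <= sensitivity A B P Q d x.
  by apply: sensitivity_ge0; apply: ltW; apply: lt_trans ltr01 _.
have b0 : 0 <= be ^+ 2 * (enorm x / l) `^ be by rewrite mulr_ge0 ?sqr_ge0 ?powR_ge0.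
have m2 : 0 <= m ^+ 2 by exact: sqr_ge0.
case: alt => alt; apply/negP; rewrite -ltNge.
  apply: (@lt_le_trans _ _ (m ^+ 2 * phi x)); first by rewrite ltr_pM2r.
  by rewrite lerDl.
apply: (@le_lt_trans _ _ (2 * sensitivity A B P Q d x)).
  by rewrite mulrC ler_wpM2r.
by apply: lt_le_trans alt _; rewrite lerDr mulr_ge0 // ltW.
Qed.

(** Suppose that one of the quotients [(W - W o inversion) / phi] is positive
    somewhere. They are small near the origin and vanish on the sphere of radius [l],
    so the larger of them has a positive maximum inside. There [- phi], times that
    maximum, touches one of the two reflected differences and lies below the other,
    which the control excludes. *)
Lemma ordered_of_control l (be : R) : 0 < l -> 0 <= be ->
  (forall x, x != 0 -> enorm x < l -> 0 < W1 x ->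
   [\/ sens1 x < m ^+ 2 /\ sens2 x < m ^+ 2,
       2 * sens1 x < be ^+ 2 * (enorm x / l) `^ be /\
       2 * sens2 x < be ^+ 2 * (enorm x / l) `^ be |
       W1 x <= W1 (inversion l x) /\ W2 x <= W2 (inversion l x)]) ->
  ordered l.
Proof.
move=> l0 be0 ctl; have ln := lt0r_neq0 l0.
pose phi y : R := 2 - (enorm y / l) `^ be.
have phi1 y : enorm y <= l -> 1 <= phi y.
  by move=> yl; have /andP[] := test_function_bounds l0 be0 yl.
pose F y := Num.max ((W1 y - W1 (inversion l y)) / phi y)
                    ((W2 y - W2 (inversion l y)) / phi y).
suff main x : x != 0 -> enorm x <= l -> F x <= 0.
  move=> x x0 xl; have := main x x0 xl; rewrite ge_max.
  by rewrite !pmulr_lle0 ?invr_gt0 ?(lt_le_trans ltr01 (phi1 _ xl)) // !subr_le0 => /andP[].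
move=> x00 xl0; rewrite leNgt; apply/negP => F0.
have [rho rhop Hrho] := vanish F0.
pose r0 := Num.min rho (enorm x).
have n0 : 0 < enorm x by rewrite enorm_gt0.
have r00 : 0 < r0 by rewrite lt_min rhop.
have rr : r0 <= rho by rewrite ge_min lexx.
have Fsmall y : y != 0 -> enorm y <= l -> enorm y < r0 -> F y < F x.
  move=> y0 yl yr; have [w1 w2] := Hrho y y0 (lt_le_trans yr rr).
  have ph := phi1 _ yl; have ph0 := lt_le_trans ltr01 ph.
  have B (u v : R) : 0 <= v -> u < F x -> (u - v) / phi y < F x.
    move=> v0 uF; rewrite ltr_pdivrMr //.
    have : F x <= F x * phi y by rewrite ler_pMr.
    by lra.
  by rewrite gt_max !B.
have cF y : y != 0 -> enorm y <= l -> {for y, continuous F}.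
  move=> y0 yl; have ph0 : phi y != 0 by rewrite lt0r_neq0 // (lt_le_trans ltr01) // phi1.
  have cph : {for y, continuous phi}.
    apply: (@continuousB _ _ _ (cst (2 : R)) (fun y => (enorm y / l) `^ be)); first exact: cst_continuous.
    apply: (@continuous_comp _ _ _ (fun y => enorm y / l) (fun t : R => t `^ be)).
      by apply: continuousM; [exact: continuous_enorm|exact: cst_continuous].
    by apply: continuous_powR; rewrite divr_gt0 // enorm_gt0.
  have G (W : 'rV[R]_N -> R) : (forall x, x != 0 -> {for x, continuous W}) ->
     {for y, continuous (fun y => (W y - W (inversion l y)) / phi y)}.
    move=> cW; apply: (@continuousM _ _ (fun y => W y - W (inversion l y)) (fun y => (phi y)^-1)).
      apply: (@continuousB _ _ _ W (fun y => W (inversion l y))); first exact: cW.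
      apply: continuous_comp; first exact: continuous_inversion.
      by apply: cW; exact: inversion_neq0.
    exact: (@continuousV _ _ phi).
  exact: continuous_max (G _ W1_cont) (G _ W2_cont).
have [||y /andP[ry yl]|P /andP[rP Pl] HP] := @EVT_max_at R N F (annulus r0 l).
- by exists x; rewrite /annulus/= xl0 andbT ge_min lexx orbT.
- exact: compact_annulus.
- by apply: cF => //; rewrite -enorm_gt0; exact: lt_le_trans ry.
have P0 : P != 0 by rewrite -enorm_gt0; exact: lt_le_trans rP.
have FxP : F x <= F P by apply: HP; rewrite /annulus/= xl0 andbT ge_min lexx orbT.
have FP0 : 0 < F P by exact: lt_le_trans FxP.
have FyP y : y != 0 -> enorm y <= l -> F y <= F P.
  move=> y0 yl; have [ry|yr] := leP r0 (enorm y); first by apply: HP; rewrite /annulus/= ry.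
  by apply: ltW; apply: lt_le_trans FxP; exact: Fsmall.
have Pl' : enorm P < l.
  rewrite lt_neqAle Pl andbT; apply/eqP => E.
  by move: FP0; rewrite /F inversion_fix // !subrr !mul0r maxxx ltxx.
have phP := lt_le_trans ltr01 (phi1 _ Pl).
have bound y : y != 0 -> enorm y <= l ->
    W1 y - W1 (inversion l y) <= F P * phi y /\ W2 y - W2 (inversion l y) <= F P * phi y.
  move=> y0 yl; have := FyP y y0 yl; rewrite {1}/F ge_max => /andP[].
  by rewrite !ler_pdivrMr ?(lt_le_trans ltr01 (phi1 _ yl)).
have nearB : \forall y \near P, y != 0 /\ enorm y <= l.
  near=> y; split; first by near: y; exact: near_neq0.
  by apply: ltW; near: y; exact: near_enorm_lt.
have [b1 b2] := bound P P0 Pl.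
have W1P : 0 < W1 P.
  move: FP0; rewrite /F lt_max !pmulr_lgt0 ?invr_gt0 // !subr_gt0 => /orP[] H.
    exact: le_lt_trans H.
  by apply/W12; exact: le_lt_trans H.
have pinv1 x' : x' != 0 -> enorm x' <= l -> 0 < W1 x' -> 0 < W1 (inversion l x').
  exact: pos_inversion.
have pinv2 x' : x' != 0 -> enorm x' <= l -> 0 < W2 x' -> 0 < W2 (inversion l x').
  by move=> x'0 x'l /W12 H; apply/W12; exact: pinv1.
have W21 y : 0 < W2 y <-> 0 < W1 y by split => /W12.
have FE : F P = (W1 P - W1 (inversion l P)) / phi P \/
    F P = (W2 P - W2 (inversion l P)) / phi P.
  by rewrite /F; case: leP => _; [right|left].
have [c1|c2|[c31 c32]] := ctl P P0 Pl' W1P; last first.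
- move: FP0; rewrite /F lt_max !pmulr_lgt0 ?invr_gt0 // !subr_gt0 => /orP[];
  by rewrite ltNge ?c31 ?c32.
- case: FE => E; have {}E := congr1 (fun t => t * phi P) E;
    rewrite /= divfK ?lt0r_neq0 // in E.
    apply: (touching_excluded p_gt1 q_gt1 d1_ge0 W1_ge0 W2_ge0 eq1 W12 pinv1 l0 P0
      Pl' be0 FP0 (esym E) b2 _ (or_intror c2.1)).
    by apply: filterS nearB => y [y0 yl]; have [] := bound y y0 yl.
  apply: (touching_excluded s_gt1 r_gt1 d2_ge0 W2_ge0 W1_ge0 eq2 W21 pinv2 l0 P0
    Pl' be0 FP0 (esym E) b1 _ (or_intror c2.2)).
  by apply: filterS nearB => y [y0 yl]; have [] := bound y y0 yl.
- case: FE => E; have {}E := congr1 (fun t => t * phi P) E;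
    rewrite /= divfK ?lt0r_neq0 // in E.
    apply: (touching_excluded p_gt1 q_gt1 d1_ge0 W1_ge0 W2_ge0 eq1 W12 pinv1 l0 P0
      Pl' be0 FP0 (esym E) b2 _ (or_introl c1.1)).
    by apply: filterS nearB => y [y0 yl]; have [] := bound y y0 yl.
  apply: (touching_excluded s_gt1 r_gt1 d2_ge0 W2_ge0 W1_ge0 eq2 W21 pinv2 l0 P0
    Pl' be0 FP0 (esym E) b1 _ (or_introl c1.2)).
  by apply: filterS nearB => y [y0 yl]; have [] := bound y y0 yl.
Unshelve. all: by end_near. Qed.

(** With [be = 0] the test function is the constant [1]. *)
Lemma ordered_start l : 0 < l -> l <= rho0 -> ordered l.
Proof.
move=> l0 lr; apply: (ordered_of_control (be := 0)) => // x x0 xl _.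
by constructor 1; apply: sens_small => //; exact: le_trans (ltW xl) lr.
Qed.

(** Contact is excluded either by the strict growth of the weights or, when every
    ray leaves the positivity set, by a barrier started near the exit point. *)
Lemma ordered_strict l x : ordered l -> 0 < l -> x != 0 -> enorm x < l -> 0 < W1 x ->
  W1 x < W1 (inversion l x) /\ W2 x < W2 (inversion l x).
Proof.
move=> ol l0 x0 xl W1x; have W2x := (W12 x).1 W1x.
have nearl : \forall y \near x, y != 0 /\ enorm y <= l.
  near=> y; split; first by near: y; exact: near_neq0.
  by apply: ltW; near: y; exact: near_enorm_lt.
have [h1 h2] := ol x x0 (ltW xl).
case: strict => [[d1p d2p]|exit].
  split.
    apply: (contact_free_weight (ltW p_gt1) (ltW q_gt1) W2_ge0 eq1) => //.
    by apply: filterS nearl => y [y0 yl]; have [] := ol y y0 yl.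
  apply: (contact_free_weight (ltW s_gt1) (ltW r_gt1) W1_ge0 eq2) => //.
  by apply: filterS nearl => y [y0 yl]; have [] := ol y y0 yl.
have [k [k0 k1 Wk]] := exit x x0 W1x.
have Wk2 : W2 (k *: x) = 0.
  apply/eqP; have := W2_ge0 (k *: x); rewrite le_eqVlt eq_sym => /orP[//|/W12].
  by rewrite Wk ltxx.
have W21 y : 0 < W2 y <-> 0 < W1 y by split => /W12.
split.
  have [k' [k'0 k'1 Wk' vk']] := ray_exit l0 x0 xl k0 k1 W1_ge0 W1_cont star W1x Wk.
  by apply: (@contact_free_barrier R N W1 W2 m p q d1 (ltW p_gt1) (ltW q_gt1)
    d1_ge0 W1_ge0 W2_ge0 eq1 l x k').
have [k' [k'0 k'1 Wk' vk']] := ray_exit l0 x0 xl k0 k1 W2_ge0 W2_cont star2 W2x Wk2.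
apply: (@contact_free_barrier R N W2 W1 m s r d2 (ltW s_gt1) (ltW r_gt1)
    d2_ge0 W2_ge0 W1_ge0 eq2 l x k') => //.
by move=> y y0 yl; have [] := ol y y0 yl.
Unshelve. all: by end_near. Qed.

Lemma ordered_closed l : 0 < l -> (forall l', 0 < l' -> l' < l -> ordered l') ->
  ordered l.
Proof.
move=> l0 ol x x0 xl; have [E|nE] := eqVneq (enorm x) l.
  by rewrite inversion_fix // lt0r_neq0.
have xl' : enorm x < l by rewrite lt_neqAle nE.
have G (W : 'rV[R]_N -> R) : (forall x, x != 0 -> {for x, continuous W}) ->
   (forall l', 0 < l' -> l' < l -> enorm x <= l' -> W x <= W (inversion l' x)) ->
   W x <= W (inversion l x).
  move=> cW H; rewrite leNgt; apply/negP => lt.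
  have c : {for l, continuous (fun l' : R => W (inversion l' x))}.
    apply: (@continuous_comp _ _ _ (fun l' : R => inversion l' x) W); last first.
      by apply: cW; apply: inversion_neq0 => //; rewrite lt0r_neq0.
    apply: (@continuous_scale_curve _ _ (fun l' : R => l' ^+ 2 / enorm x ^+ 2)).
    apply: (@continuousM _ _ (fun t : R => t ^+ 2) (cst (enorm x ^+ 2)^-1)); last exact: cst_continuous.
    exact: exprn_continuous.
  have : \forall l' \near l, W (inversion l' x) < W x by move/cvgr_lt : c; apply.
  move=> /nbhs_ballP[e /= e0 He].
  pose dl := Num.min (e / 2) ((l - enorm x) / 2).
  have dp : 0 < dl by rewrite lt_min !divr_gt0 // subr_gt0.
  have de : dl <= e / 2 by rewrite ge_min lexx.
  have d1' : dl <= (l - enorm x) / 2 by rewrite ge_min lexx orbT.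
  have n0 : 0 <= enorm x by exact: enorm_ge0.
  have := He (l - dl); rewrite /ball/= opprB addrC subrK ger0_norm ?(ltW dp) //.
  have /[swap]/[apply] : dl < e by lra.
  by rewrite ltNge H //; lra.
split; [apply: (G _ W1_cont)|apply: (G _ W2_cont)] => l' l'0 l'l xl'';
by have [] := ol l' l'0 l'l x x0 xl''.
Qed.

(** For [rho0 <= |x| <= k1 * l] the order is strict by compactness, or the sensitivity
    is small because both unknowns vanish, and both properties survive a small change
    of [l]. In the remaining thin shell [(|x| / l')^be >= 1/2], so a test function with
    [be^2] large against the sensitivity excludes contact. In the ball of radius [rho0]
    the sensitivity is below [m ^+ 2]. *)
Lemma ordered_open l : 0 < l -> ordered l ->
  exists2 e : R, 0 < e & forall l', l <= l' -> l' < l + e -> ordered l'.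
Proof.
move=> l0 ol; have m2 : 0 < m ^+ 2 by rewrite exprn_even_gt0.
have cs1 x : x != 0 -> {for x, continuous sens1}.
  by move=> x0; apply: sensitivity_continuous => //; [exact: W1_cont|exact: W2_cont].
have cs2 x : x != 0 -> {for x, continuous sens2}.
  by move=> x0; apply: sensitivity_continuous => //; [exact: W2_cont|exact: W1_cont].
have ann0 (a b : R) x : 0 < a -> annulus a b x -> x != 0.
  by move=> a0 /andP[ax _]; rewrite -enorm_gt0; exact: lt_le_trans ax.
have bnd (f : 'rV[R]_N -> R) : (forall x, x != 0 -> {for x, continuous f}) ->
    exists2 C : R, 0 <= C & forall x, annulus rho0 (2 * l) x -> f x <= C.
  move=> cf; have [ne|e] := pselect (@annulus R N rho0 (2 * l) !=set0).
    have [||c Kc Hc] := @EVT_max_at R N f (annulus rho0 (2 * l)) ne.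
    - exact: compact_annulus.
    - by move=> y /(ann0 _ _ _ rho0_gt0); exact: cf.
    exists `|f c| => // x /Hc fx; apply: le_trans fx (ler_norm _).
  by exists 0 => // x Kx; exfalso; apply: e; exists x.
have [C1 C10 HC1] := bnd _ cs1; have [C2 C20 HC2] := bnd _ cs2.
pose C := C1 + C2.
pose be := Num.sqrt (4 * C + 1).
have Ebe : be ^+ 2 = 4 * C + 1 by rewrite sqr_sqrtr // /C; lra.
have be0 : 0 < be by rewrite sqrtr_gt0 /C; lra.
(* (|x| / l)^be >= 1/2 when |x| >= kap * l; the shell starts at k1 > kap to leave
   room for l' > l *)
pose kap : R := 2^-1 `^ be^-1.
have kap0 : 0 < kap by rewrite powR_gt0 // invr_gt0.
have kapbe : kap `^ be = 2^-1.
  by rewrite -powRrM mulVf ?powRr1 ?invr_ge0 // lt0r_neq0.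
have kap1 : kap < 1.
  rewrite ltNge; apply/negP => k1.
  have : 1 `^ be <= kap `^ be by rewrite ge0_ler_powR ?nnegrE // ltW.
  by rewrite powR1 kapbe; lra.
pose k1 := (1 + kap) / 2.
have k11 : k1 < 1 by rewrite /k1; lra.
have kk1 : kap < k1 by rewrite /k1; lra.
have k10 : 0 < k1 by exact: lt_trans kk1.
pose good l' x := (sens1 x < m ^+ 2 /\ sens2 x < m ^+ 2) \/
  (W1 x < W1 (inversion l' x) /\ W2 x < W2 (inversion l' x)).
have cover : \forall l' \near l, annulus rho0 (l * k1) `<=` good l'.
  have cA : compact (@annulus R N rho0 (l * k1)) by exact: compact_annulus.
  apply: ((compact_near_coveringP _).1 cA R (nbhs l) good _) => x Kx.
  have x0 := ann0 _ _ _ rho0_gt0 Kx.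
  have xl : enorm x < l.
    by have /andP[_ xk] := Kx; apply: le_lt_trans xk _; rewrite gtr_pMr.
  have := W1_ge0 x; rewrite le_eqVlt => /orP[/eqP W1x|W1x].
    have W2x : W2 x = 0.
      apply/eqP; have := W2_ge0 x; rewrite le_eqVlt eq_sym => /orP[//|/W12].
      by rewrite -W1x ltxx.
    have n1 : \forall y \near x, sens1 y < m ^+ 2.
      by move/cvgr_lt : (cs1 x x0); apply; rewrite sensitivity_eq0.
    have n2 : \forall y \near x, sens2 y < m ^+ 2.
      by move/cvgr_lt : (cs2 x x0); apply; rewrite sensitivity_eq0.
    exists ([set y | sens1 y < m ^+ 2 /\ sens2 y < m ^+ 2], setT).
      by split; [exact: filterI n1 n2|exact: filterT].
    by move=> z [/= H _]; left.
  have [g1 g2] := ordered_strict ol l0 x0 xl W1x.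
  have ln := lt0r_neq0 l0.
  have G := filterI (near_inversion_gt x0 ln W1_cont g1) (near_inversion_gt x0 ln W2_cont g2).
  have FF : Filter (filter_prod (nbhs x) (nbhs l)) by exact: filter_prod_filter.
  refine (@filterS _ (filter_prod (nbhs x) (nbhs l)) FF _ _ _ (G FF)).
  by move=> z [/= H1 H2]; right.
have [e /= e0 He] := (nbhs_ballP _ _).1 cover.
pose e' := Num.min (Num.min e l) (l * (k1 / kap - 1)).
have e'1 : e' <= e by rewrite !ge_min lexx.
have e'2 : e' <= l by rewrite !ge_min lexx orbT.
have e'3 : e' <= l * (k1 / kap - 1) by rewrite !ge_min lexx orbT.
exists e'.
  by rewrite !lt_min e0 l0 mulr_gt0 // subr_gt0 ltr_pdivlMr // mul1r.
move=> l' ll' l'e; have l'0 : 0 < l' by exact: lt_le_trans ll'.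
have Hcov : annulus rho0 (l * k1) `<=` good l'.
  by apply: He; rewrite /ball/= distrC ger0_norm ?subr_ge0 //; lra.
have l'k : l' * kap < l * k1.
  rewrite -ltr_pdivlMr // -mulrA; apply: (lt_le_trans l'e).
  by move: e'3; rewrite mulrBr mulr1; lra.
apply: (ordered_of_control (be := be)) => //; first exact: ltW.
move=> x x0 xl' W1x; have [xr|rx] := leP (enorm x) rho0.
  by constructor 1; exact: sens_small.
have [xk|kx] := leP (enorm x) (l * k1).
  have : annulus rho0 (l * k1) x by rewrite /annulus/= (ltW rx).
  by move=> /Hcov[H|[H1 H2]]; [constructor 1|constructor 3; split; exact: ltW].
have x2l : annulus rho0 (2 * l) x by apply/andP; split; lra.
constructor 2.
have half : 2^-1 <= (enorm x / l') `^ be.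
  rewrite -kapbe ge0_ler_powR ?nnegrE ?(ltW be0) ?(ltW kap0) //.
    by rewrite divr_ge0 ?enorm_ge0 // ltW.
  by rewrite ler_pdivlMr // mulrC; apply: ltW; exact: lt_trans kx.
have big : 2 * C < be ^+ 2 * (enorm x / l') `^ be.
  apply: (@lt_le_trans _ _ (be ^+ 2 * 2^-1)); first by rewrite Ebe; lra.
  by rewrite ler_wpM2l ?sqr_ge0.
have := HC1 x x2l; have := HC2 x x2l; rewrite /C in big.
by move: (sens1 x) (sens2 x) => u v *; split; lra.
Qed.

(** The set of radii up to which all inversions are ordered contains [rho0], is closed
    and is open to the right. *)
Theorem moving_spheres l : 0 < l -> ordered l.
Proof.
move=> l0; apply: contrapT => nol.
pose S : set R := [set t | 0 < t /\ forall t', 0 < t' -> t' <= t -> ordered t'].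
have Sr : S rho0.
  by split => // t' t'0 t'r; exact: ordered_start.
have ubS : ubound S l.
  move=> t [t0 Ht]; rewrite leNgt; apply/negP => lt.
  by apply: nol; apply: Ht => //; exact: ltW.
have supS : has_sup S by split; [exists rho0|exists l].
pose L := sup S.
have L0 : 0 < L by apply: lt_le_trans rho0_gt0 _; apply: ub_le_sup => //; exists l.
have below l' : 0 < l' -> l' < L -> ordered l'.
  move=> l'0 l'L; have [t [t0 Ht] lt] := sup_gt supS.1 l'L.
  by apply: Ht => //; exact: ltW.
have oL : ordered L by exact: ordered_closed.
have [e e0 He] := ordered_open L0 oL.
have : S (L + e / 2).
  split; first by rewrite addr_gt0 // divr_gt0.
  move=> t' t'0 t'L; have [tL|Lt] := ltP t' L; first exact: below.
  by apply: He => //; lra.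
move=> /(ub_le_sup (ex_intro _ l ubS)); rewrite -/L; lra.
Qed.

End MovingSpheres.

(** * The divergence equation on the cylinder *)

Section Equation.
Context {R : realType} {N : nat}.
Implicit Types (x y : 'rV[R]_N) (u : 'rV[R]_N -> R) (i j k : 'I_N).

Lemma isd_line (f : 'rV[R]_N -> R) x v (c : R) :
  isd (fun s => f (x + s *: v)) 0 c -> is_derive x v f c.
Proof.
move=> [ex val].
have E : (fun h : R => h^-1 *: (((fun s => f (x + s *: v)) \o shift 0) h%:A
            - f (x + 0 *: v)))
   = (fun h : R => h^-1 *: ((f \o shift x) (h *: v) - f x)).
  apply/funext => h /=; congr (_ *: (f _ - f _)); last by rewrite scale0r addr0.
  by rewrite [h%:A]mulr1 addr0 addrC.
split; first by move: ex; rewrite /derivable E.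
by move: val; rewrite /derive E.
Qed.

Lemma sqr_enorm_line x i (s : R) :
  enorm (x + s *: delta_mx 0 i) ^+ 2 = enorm x ^+ 2 + (2 * x 0 i) * s + s * s.
Proof.
have e1 : enorm (delta_mx 0 i : 'rV[R]_N) ^+ 2 = 1.
  rewrite sqr_enorm (bigD1 i) //= mxE !eqxx expr1n big1 ?addr0 // => k ki.
  by rewrite mxE eqxx (negbTE ki) expr0n.
have -> : x + s *: delta_mx 0 i = x - (- s) *: delta_mx 0 i by rewrite scaleNr opprK.
rewrite sqr_enorm_sub enormZ exprMn e1 real_normK ?num_real //.
have -> : dotp ((- s) *: delta_mx 0 i) x = - s * x 0 i.
  rewrite /dotp -[RHS](sum_delta (fun k => - s * x 0 k)); apply: eq_bigr => k _.
  by rewrite !mxE eqxx /=; ring.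
by ring.
Qed.

(** A radial function is written through the squared norm, a polynomial in the
    coordinates. *)
Lemma is_derive_radial (psi : R -> R) x i (c : R) :
  isd psi (enorm x ^+ 2) c ->
  is_derive x (delta_mx 0 i) (fun y => psi (enorm y ^+ 2)) (2 * x 0 i * c).
Proof.
move=> dpsi; apply: isd_line.
under eq_fun do rewrite sqr_enorm_line.
have dq : isd (fun s => enorm x ^+ 2 + (2 * x 0 i) * s + s * s) 0 (2 * x 0 i).
  apply: isd_eq.
    by apply: isdD; [apply: isdD; [exact: isdC|apply: isdZ; exact: isdI]|apply: isdM; exact: isdI].
  by rewrite /=; ring.
have dpsi' : isd psi (enorm x ^+ 2 + (2 * x 0 i) * 0 + 0 * 0) c.
  by rewrite !mulr0 !addr0.
apply: isd_eq (@isd_comp _ psi (fun s => enorm x ^+ 2 + (2 * x 0 i) * s + s * s) _ _ _ dpsi' dq) _.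
by rewrite mulrC.
Qed.

Lemma powR_enorm (a : R) x : enorm x `^ a = (enorm x ^+ 2) `^ (a / 2).
Proof.
by rewrite -powR_mulrn ?enorm_ge0 // -powRrM mulrC divfK.
Qed.

Lemma is_derive_enorm_powR (a : R) x i : x != 0 ->
  is_derive x (delta_mx 0 i) (fun y => enorm y `^ a)
    (a * enorm x `^ (a - 2) * x 0 i).
Proof.
move=> x0; have r0 : 0 < enorm x ^+ 2 by rewrite exprn_gt0 // enorm_gt0.
rewrite (_ : (fun y => enorm y `^ a) = (fun y => (enorm y ^+ 2) `^ (a / 2))); last first.
  by apply/funext => y; exact: powR_enorm.
apply: is_derive_eq (is_derive_radial i (isd_powR (a / 2) r0)) _.
by rewrite powR_enorm (_ : (a - 2) / 2 = a / 2 - 1); [field|field].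
Qed.

Lemma Ck2_at (U : set 'rV[R]_N) u x : open U -> Ck 2 U u -> U x ->
  [/\ {for x, continuous u}, forall i, derivable u x (delta_mx 0 i),
    forall i, {for x, continuous (partial i u)} &
    forall i j, derivable (partial i u) x (delta_mx 0 j)].
Proof.
move=> oU [cu C1] Ux.
have cont (h : 'rV[R]_N -> R) : {within U, continuous h} -> {for x, continuous h}.
  by move=> ch; move: ch; rewrite continuous_open_subspace //; apply; rewrite inE.
split; first exact: cont.
- by move=> i; exact: (C1 i).1.
- by move=> i; apply: cont; have [_ []] := C1 i.
- by move=> i j; have [_ [_ C2]] := C1 i; exact: (C2 j).1.
Qed.

Lemma divergence_weighted_grad (U : set 'rV[R]_N) u (a : R) x :
  open U -> Ck 2 U u -> U x -> x != 0 ->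
  divergence (fun y => enorm y `^ a *: grad u y) x =
  enorm x `^ a * laplacian u x + a * enorm x `^ (a - 2) * radial_deriv u x.
Proof.
move=> oU C2 Ux x0; have [_ _ _ d2] := Ck2_at oU C2 Ux.
rewrite /divergence /laplacian /radial_deriv !mulr_sumr -big_split /=.
apply: eq_bigr => i _.
rewrite /partial (_ : (fun y => _) = (fun y => enorm y `^ a) * partial i u); last first.
  by apply/funext => y; rewrite !mxE.
have De := is_derive_enorm_powR a i x0.
have Du : is_derive x (delta_mx 0 i) (partial i u) (partial i (partial i u) x).
  by split => //; exact: d2.
have [_ ->] := is_deriveM De Du.
by rewrite -[X in X + _]/(_ * _) -[X in _ + X]/(_ * _) /partial; ring.
Qed.

Context (a b : R).
Let m : R := (N%:R - 2 + a) / 2.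

(** For [2 * m = N - 2 + a] the first order terms cancel in the equation satisfied by
    [|x|^m u]. *)
Lemma cylLap_of_equation (U : set 'rV[R]_N) u1 u2 (p q : R) x :
  open U -> Ck 2 U u1 -> U x -> x != 0 -> 0 <= u1 x -> 0 <= u2 x ->
  divergence (fun y => enorm y `^ a *: grad u1 y) x
      + enorm x `^ b * (u1 x `^ p * u2 x `^ q) = 0 ->
  cylLap (fun y => enorm y `^ m * u1 y) x
    (m ^+ 2 * (enorm x `^ m * u1 x) -
     source (fun y => enorm y `^ m * u1 y) (fun y => enorm y `^ m * u2 y) p q
       (m + (2 + b - a) - m * (p + q)) x).
Proof.
move=> oU C2 Ux x0 u10 u20 E.
have n0 : enorm x != 0 by rewrite enorm_eq0.
have np : 0 < enorm x by rewrite enorm_gt0.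
have := cylLap_C2 m oU C2 Ux x0; congr cylLap.
rewrite (divergence_weighted_grad a oU C2 Ux x0) in E.
have E2 : a * radial_deriv u1 x + enorm x ^+ 2 * laplacian u1 x =
    - (enorm x `^ (2 + b - a) * (u1 x `^ p * u2 x `^ q)).
  have Pa : enorm x `^ a != 0 by rewrite lt0r_neq0 // powR_gt0.
  apply: (mulfI Pa).
  have -> : enorm x `^ a * - (enorm x `^ (2 + b - a) * (u1 x `^ p * u2 x `^ q)) =
      - (enorm x `^ 2 * (enorm x `^ b * (u1 x `^ p * u2 x `^ q))).
    rewrite mulrN !mulrA -!powRD ?n0 ?implybT //; congr (- (_ `^ _ * _ * _)); ring.
  have E3 : enorm x `^ a = enorm x ^+ 2 * enorm x `^ (a - 2).
    rewrite -powR_mulrn ?(ltW np) // -powRD ?n0 ?implybT //; congr (_ `^ _); ring.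
  have -> : enorm x `^ 2 = enorm x ^+ 2 by rewrite -powR_mulrn ?(ltW np).
  rewrite -(mulrN (enorm x ^+ 2)).
  have -> : - (enorm x `^ b * (u1 x `^ p * u2 x `^ q)) =
    enorm x `^ a * laplacian u1 x + a * enorm x `^ (a - 2) * radial_deriv u1 x.
    by apply/eqP; rewrite eq_sym -addr_eq0 E.
  rewrite E3; ring.
have -> : (2 * m - (N%:R - 2)) = a by rewrite /m; field.
rewrite -addrA E2 /source !powRM ?powR_ge0 // -!powRrM.
rewrite mulrDr mulrCA mulrN; congr (_ - _).
rewrite (_ : enorm x `^ (m + (2 + b - a) - m * (p + q)) *
  (enorm x `^ (m * p) * u1 x `^ p * (enorm x `^ (m * q) * u2 x `^ q)) =
  (enorm x `^ (m + (2 + b - a) - m * (p + q)) * enorm x `^ (m * p) * enorm x `^ (m * q))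
   * (u1 x `^ p * u2 x `^ q)); last by ring.
have D (v w : R) : enorm x `^ v * enorm x `^ w = enorm x `^ (v + w).
  by rewrite -powRD // n0 implybT.
rewrite [LHS]mulrA !D; congr (_ * _).
by congr (powR _ _); ring.
Qed.

Lemma sensitivity_powR (u1 u2 : 'rV[R]_N -> R) (p q d : R) x : x != 0 ->
  0 <= u1 x -> 0 <= u2 x ->
  sensitivity (fun y => enorm y `^ m * u1 y) (fun y => enorm y `^ m * u2 y) p q d x =
  enorm x `^ (d + m * (p + q - 1)) *
   (p * u1 x `^ (p - 1) * u2 x `^ q + q * u1 x `^ p * u2 x `^ (q - 1)).
Proof.
move=> x0 u10 u20; have n0 : enorm x != 0 by rewrite enorm_eq0.
rewrite /sensitivity !powRM ?powR_ge0 // -!powRrM.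
rewrite (_ : m * (p + q - 1) = m * (p - 1) + m * q); last by ring.
have D (v w : R) : enorm x `^ (v + w) = enorm x `^ v * enorm x `^ w.
  by rewrite powRD // n0 implybT.
have E : enorm x `^ (m * p) * enorm x `^ (m * (q - 1)) =
   enorm x `^ (m * (p - 1)) * enorm x `^ (m * q).
  by rewrite -!D; congr (_ `^ _); ring.
rewrite addrA !D; move: E.
move: (enorm x `^ d) (enorm x `^ (m * (p - 1))) (enorm x `^ (m * q))
  (enorm x `^ (m * p)) (enorm x `^ (m * (q - 1))) (u1 x `^ p) (u1 x `^ (p - 1))
  (u2 x `^ q) (u2 x `^ (q - 1)) => D0 D1 D2 D3 D4 U1 U1' U2 U2' E.
transitivity (D0 * (p * U1' * U2 * (D1 * D2) + q * U1 * U2' * (D3 * D4))); first by ring.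
by rewrite E; ring.
Qed.

End Equation.

(** * Behaviour at the origin, along rays and at infinity *)

Section Nonexistence.
Context {R : realType} {N : nat}.
Implicit Types (x y : 'rV[R]_N) (u V W : 'rV[R]_N -> R).

Lemma near0_enorm (P : 'rV[R]_N -> Prop) : (\forall y \near (0 : 'rV[R]_N), P y) ->
  exists2 rho : R, 0 < rho & forall y, enorm y < rho -> P y.
Proof.
move=> /nbhs_ballP[e /= e0 He]; exists e => // y ye; apply: He.
by rewrite -ball_normE /= sub0r normrN; apply: le_lt_trans (norm_le_enorm _) ye.
Qed.

Lemma enorm0 : enorm (0 : 'rV[R]_N) = 0.
Proof. by apply/eqP; rewrite enorm_eq0. Qed.

Lemma continuous_enorm_powR (m : R) x : 0 < m ->
  {for x, continuous (fun y => enorm y `^ m)}.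
Proof.
move=> m0; apply: continuous_powR_ge0 => //; first exact: enorm_ge0.
exact: continuous_enorm.
Qed.

Lemma vanish_at_origin (m : R) u : 0 < m -> {for 0, continuous u} ->
  forall e : R, 0 < e -> exists2 rho : R, 0 < rho &
    forall x, enorm x < rho -> enorm x `^ m * u x < e.
Proof.
move=> m0 cu e e0; apply: near0_enorm.
have c : {for 0, continuous (fun y => enorm y `^ m * u y)}.
  by apply: continuousM => //; exact: continuous_enorm_powR.
by move/cvgr_lt : c; apply; rewrite enorm0 powR0 ?mul0r // gt_eqF.
Qed.

Lemma weighted_source_at_origin (k p q : R) u1 u2 : 0 < k -> 1 < p -> 1 < q ->
  (forall y, 0 <= u1 y) -> (forall y, 0 <= u2 y) ->
  {for 0, continuous u1} -> {for 0, continuous u2} ->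
  forall e : R, 0 < e -> exists2 rho : R, 0 < rho & forall x, enorm x < rho ->
    enorm x `^ k * (p * u1 x `^ (p - 1) * u2 x `^ q + q * u1 x `^ p * u2 x `^ (q - 1)) < e.
Proof.
move=> k0 p1 q1 u10 u20 c1 c2; apply: vanish_at_origin => //.
have p0 := lt_trans ltr01 p1; have q0 := lt_trans ltr01 q1.
have p10 : 0 < p - 1 by rewrite subr_gt0.
have q10 : 0 < q - 1 by rewrite subr_gt0.
apply: continuousD; (apply: continuousM; first apply: continuousM;
  [exact: cst_continuous|exact: continuous_powR_ge0|exact: continuous_powR_ge0]).
Qed.

(** The points [x] and [t *: x] are exchanged by the inversion of radius
    [sqrt t * |x|]. *)
Lemma ordered_ray W1 W2 : (forall l : R, 0 < l -> ordered W1 W2 l) ->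
  forall x (t : R), x != 0 -> 1 <= t -> W1 x <= W1 (t *: x) /\ W2 x <= W2 (t *: x).
Proof.
move=> ord x t x0 t1; have n0 : 0 < enorm x by rewrite enorm_gt0.
have t0 : 0 < t by exact: lt_le_trans t1.
have s1 : 1 <= Num.sqrt t by rewrite -sqrtr1 ler_wsqrtr.
have := ord (Num.sqrt t * enorm x) _ x x0 _.
have -> : inversion (Num.sqrt t * enorm x) x = t *: x.
  rewrite /inversion exprMn sqr_sqrtr ?(ltW t0) // mulfK //.
  by rewrite expf_neq0 // lt0r_neq0.
apply; first by rewrite mulr_gt0 // sqrtr_gt0.
by rewrite ler_pMl.
Qed.

Lemma has2_sin_log (n c : R) : 0 < n ->
  exists d, has2 (fun s => sin (ln (expR s * n) - c)) d (- sin (ln n - c)).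
Proof.
move=> n0; exists (cos (ln n - c)).
have D (s : R) : isd (fun s => s + (ln n - c)) s 1.
  by apply: isd_eq (isdD (isdI s) (isdC _ s)) _; rewrite addr0.
have E (s : R) : ln (expR s * n) - c = s + (ln n - c).
  by rewrite lnM ?posrE ?expR_gt0 // expRK addrA.
exists (fun s => cos (s + (ln n - c))); split; last 2 first.
- by rewrite add0r.
- have D0 : isd (@cos R) (0 + (ln n - c)) (- sin (0 + (ln n - c))) by exact: is_derive_cos.
  apply: isd_eq (@isd_comp _ (@cos R) (fun s => s + (ln n - c)) _ _ _ D0 (D 0)) _.
  by rewrite mulr1 add0r.
near=> s; under eq_fun do rewrite E.
have D0 : isd (@sin R) (s + (ln n - c)) (cos (s + (ln n - c))) by exact: is_derive_sin.
by apply: isd_eq (@isd_comp _ (@sin R) (fun s => s + (ln n - c)) _ _ _ D0 (D s)) _; rewrite mulr1.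
Unshelve. all: by end_near. Qed.

Lemma unit_vector (N0 : (0 < N)%N) : exists e : 'rV[R]_N, enorm e = 1.
Proof.
exists (delta_mx 0 (Ordinal N0)).
apply/eqP; rewrite -(@pexpr_eq1 _ _ 2) ?enorm_ge0 //.
rewrite sqr_enorm (bigD1 (Ordinal N0)) //= mxE !eqxx expr1n big1 ?addr0 // => k ki.
by rewrite mxE eqxx (negbTE ki) expr0n.
Qed.

(** At infinity the equation of [V1] reads [L V1 <= - V1], because the factor
    [|x|^d V1^(p-1) V2^q] exceeds [m^2 + 1] there. A positive supersolution of
    [L h + h = 0] cannot exist on an annulus where [h = sin (ln |x| - ln E0)] is
    positive inside and zero on the boundary: compare at the maximum of [h / V1]. *)
Lemma oscillation V1 V2 (m p q d c1 c2 : R) : (0 < N)%N -> 0 < d -> 1 < p -> 1 < q ->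
  (forall x, x != 0 -> 0 < V1 x) ->
  (forall x, x != 0 -> {for x, continuous V1}) ->
  (forall x, x != 0 -> cylLap V1 x (m ^+ 2 * V1 x - source V1 V2 p q d x)) ->
  0 < c1 -> 0 < c2 ->
  (forall x, 1 <= enorm x -> c1 <= V1 x /\ c2 <= V2 x) -> False.
Proof.
move=> N0 d0 p1 q1 V1p cV1 eqV c10 c20 low.
have p0 := lt_trans ltr01 p1; have q0 := lt_trans ltr01 q1.
pose k := c1 `^ (p - 1) * c2 `^ q.
have k0 : 0 < k by rewrite mulr_gt0 ?powR_gt0.
pose X := ((m ^+ 2 + 2) / k) `^ d^-1.
(* beyond E0 the potential exceeds m^2 + 1 *)
pose E0 := Num.max 1 X.
have E01 : 1 <= E0 by rewrite le_max lexx.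
have E00 : 0 < E0 by exact: lt_le_trans E01.
have big x : E0 <= enorm x -> m ^+ 2 + 1 < enorm x `^ d * k.
  move=> Ex; rewrite -ltr_pdivrMr //.
  have m2 : 0 <= m ^+ 2 by exact: sqr_ge0.
  apply: (@lt_le_trans _ _ ((m ^+ 2 + 2) / k)).
    by rewrite ltr_pM2r ?invr_gt0 // ltrD2l ltr1n.
  have -> : (m ^+ 2 + 2) / k = X `^ d.
    by rewrite -powRrM mulVf ?powRr1 ?lt0r_neq0 // divr_ge0 ?(ltW k0) // addr_ge0.
  rewrite ge0_ler_powR ?nnegrE ?enorm_ge0 ?powR_ge0 ?(ltW d0) //.
  by apply: le_trans Ex; rewrite le_max lexx orbT.
pose h y := sin (ln (enorm y) - ln E0).
have ln0 y : 0 < enorm y -> {for y, continuous h}.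
  move=> ny; apply: (@continuous_comp _ _ _ (fun y => ln (enorm y) - ln E0) (@sin R)); last exact: continuous_sin.
  apply: (@continuousB _ _ _ (fun y => ln (enorm y)) (cst (ln E0))); last exact: cst_continuous.
  apply: (@continuous_comp _ _ _ (@enorm R N) (@ln R)); first exact: continuous_enorm.
  exact: continuous_ln.
pose K : set 'rV[R]_N := annulus E0 (expR pi * E0).
have K0 y : K y -> 0 < enorm y by move=> /andP[Ey _]; exact: lt_le_trans Ey.
have [e e1] := unit_vector N0.
(* at y1 the sine is 1, so the maximum of h / V1 is positive *)
pose y1 := (expR (pi / 2) * E0) *: e.
have ny1 : enorm y1 = expR (pi / 2) * E0.
  by rewrite enormZ e1 mulr1 ger0_norm // mulr_ge0 ?expR_ge0 // ltW.
have pi0 := @pi_gt0 R.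
have Ky1 : K y1.
  apply/andP; rewrite ny1; split.
    have e2 : expR 0 <= expR (pi / 2) :> R by rewrite ler_expR; lra.
    by rewrite ler_peMl ?(ltW E00) //; move: e2; rewrite expR0.
  by rewrite ler_pM2r // ler_expR; lra.
have hy1 : h y1 = 1.
  by rewrite /h ny1 lnM ?posrE ?expR_gt0 // expRK addrK sin_pihalf.
have V10 y : K y -> 0 < V1 y by move=> Ky; apply: V1p; rewrite -enorm_gt0 K0.
have [|||P KP HP] := @EVT_max_at R N (fun y => h y / V1 y) K.
- by exists y1.
- exact: compact_annulus.
- move=> y Ky; apply: (@continuousM _ _ h (fun y => (V1 y)^-1)); first by apply: ln0; exact: K0.
  apply: (@continuousV _ _ V1); first by rewrite lt0r_neq0 // V10.
  by apply: cV1; rewrite -enorm_gt0 K0.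
pose M := h P / V1 P.
have VP := V10 P KP.
have M0 : 0 < M.
  by apply: lt_le_trans (HP y1 Ky1); rewrite hy1 divr_gt0 // V10.
have hP : h P = M * V1 P by rewrite /M divfK // lt0r_neq0.
have hP0 : 0 < h P by rewrite hP mulr_gt0.
have nP := K0 P KP.
have P0 : P != 0 by rewrite -enorm_gt0.
have [/andP[EP PE]] := KP.
have EP' : E0 < enorm P.
  rewrite lt_neqAle EP andbT; apply/eqP => E.
  by move: hP0; rewrite /h -E subrr sin0 ltxx.
have PE' : enorm P < expR pi * E0.
  rewrite lt_neqAle PE andbT; apply/eqP => E.
  by move: hP0; rewrite /h E lnM ?posrE ?expR_gt0 // expRK addrK sinpi ltxx.
have [dd Hsin] := has2_sin_log (ln E0) nP.
have L := cylLap_lin (-1) (@cylLap_radial _ _ (fun t => sin (ln t - ln E0)) P _ _ Hsin)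
  (cylLap_lin M (eqV P P0) (@cylLap_radial _ _ (fun=> 0) P _ _ (has2_cst 0))).
have : 0 <= -1 * - sin (ln (enorm P) - ln E0) +
    (M * (m ^+ 2 * V1 P - source V1 V2 p q d P) + 0).
  apply: cylLap_min L _; near=> y.
  have Ky : K y.
    apply/andP; split; apply: ltW; near: y; [exact: near_enorm_gt|exact: near_enorm_lt].
  have := HP y Ky; rewrite -/M ler_pdivrMr ?V10 // -/(h y) -/(h P) hP => Hy.
  by rewrite !mulN1r !addr0 addrC addrN addrC subr_ge0.
apply/negP; rewrite -ltNge -/(h P) mulN1r opprK addr0.
have [cl1 cl2] := low P (le_trans E01 EP).
have src : (m ^+ 2 + 1) * V1 P < source V1 V2 p q d P.
  rewrite /source -(mulr_powRB1 (ltW VP) p0).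
  have -> : enorm P `^ d * (V1 P * V1 P `^ (p - 1) * V2 P `^ q) =
    enorm P `^ d * (V1 P `^ (p - 1) * V2 P `^ q) * V1 P by ring.
  rewrite ltr_pM2r //; apply: lt_le_trans (big P EP) _.
  rewrite ler_wpM2l ?powR_ge0 // /k ler_pM ?powR_ge0 //.
    by rewrite ge0_ler_powR ?nnegrE ?(ltW c10) ?(ltW VP) // subr_ge0 ltW.
  by rewrite ge0_ler_powR ?nnegrE ?(ltW c20) ?(ltW q0) // (le_trans (ltW c20)).
have : M * ((m ^+ 2 + 1) * V1 P) < M * source V1 V2 p q d P by rewrite ltr_pM2l.
by rewrite hP; move: (source _ _ _ _ _ _) (V1 P) => *; lra.
Unshelve. all: by end_near. Qed.

End Nonexistence.

(** * Nonexistence *)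

Lemma continuous_epsP (R : realType) (T : topologicalType) (f : T -> R) (x : T) :
  {for x, continuous f} <->
  forall e : R, 0 < e -> \forall y \near x, `|f x - f y| < e.
Proof. by split => [/cvgrPdist_lt|H]; [|apply/cvgrPdist_lt]. Qed.

Lemma open_punctured (R : realType) (N : nat) (U : set 'rV[R]_N) :
  open U -> open (punctured U).
Proof.
move=> oU; rewrite openE => x [Ux /eqP x0]; rewrite /interior.
apply: filterS2 (open_nbhs_nbhs (conj oU Ux)) (near_neq0 x0) => y Uy y0.
by split => //; apply/eqP.
Qed.

Section NonexistenceTheorems.
Context {R : realType} {N : nat} (p q r s a b : R).
Context (hN : (3 <= N)%N) (hp : 1 < p) (hq : 1 < q) (hr : 1 < r) (hs : 1 < s)
  (hba : a - 2 < b) (haN : - N%:R < a - 2).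
Implicit Types (x y : 'rV[R]_N) (u V W : 'rV[R]_N -> R).

Let m : R := (N%:R - 2 + a) / 2.
Let k : R := 2 + b - a.

Let m2_gt0 : 0 < N%:R - 2 + a.
Proof.
have : - N%:R < a - 2 := haN.
by rewrite -subr_gt0 (_ : a - 2 - - N%:R = N%:R - 2 + a) //; ring.
Qed.
Let m_gt0 : 0 < m. Proof. by rewrite divr_gt0. Qed.
Let k_gt0 : 0 < k.
Proof. by move: hba; rewrite -subr_gt0 /k; congr (_ < _); ring. Qed.
Let N_gt0 : (0 < N)%N. Proof. exact: leq_trans hN. Qed.

(** The exponent of the weight in the equation of [|x|^m u] measures the distance to
    the critical value: positive below it, nonpositive above it. *)
Lemma critical_gap (sigma : R) : m + k - m * sigma = m * (p_S N a b - sigma).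
Proof.
have d0 : N%:R - 2 + a != 0 by exact: lt0r_neq0.
by rewrite /p_S /m /k; field.
Qed.

Let weighted u := fun y => enorm y `^ m * u y.

Lemma continuous_weighted u x : x != 0 -> {for x, continuous u} ->
  {for x, continuous (weighted u)}.
Proof.
by move=> x0 cu; apply: continuousM; [exact: continuous_enorm_powR|].
Qed.

(** Below the critical value both weights grow with [|x|], so moving spheres apply to
    [|x|^m u_i], which is then bounded below at infinity along every ray. *)
Theorem liouville u1 u2 : Num.max (p + q) (r + s) < p_S N a b ->
  ~ positive_solution a b p q r s [set: 'rV[R]_N] u1 u2.
Proof.
rewrite gt_max => /andP[sub1 sub2] [pos1 pos2 C2_1 C2_2 C0_1 C0_2 eq1 eq2].
have c1 x : {for x, continuous u1}.
  move: C0_1; rewrite closureT continuous_open_subspace; last exact: openT.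
  by apply; rewrite inE.
have c2 x : {for x, continuous u2}.
  move: C0_2; rewrite closureT continuous_open_subspace; last exact: openT.
  by apply; rewrite inE.
have p1 x : 0 < u1 x by exact: pos1.
have p2 x : 0 < u2 x by exact: pos2.
have oU : open (punctured [set: 'rV[R]_N]).
  exact: (open_punctured openT).
have Ux x : x != 0 -> punctured [set: 'rV[R]_N] x by move=> /eqP x0; split.
pose d1 := m + k - m * (p + q); pose d2 := m + k - m * (s + r).
have d10 : 0 < d1 by rewrite /d1 critical_gap mulr_gt0 // subr_gt0.
have d20 : 0 < d2 by rewrite /d2 critical_gap mulr_gt0 // subr_gt0 addrC.
pose V1 := weighted u1; pose V2 := weighted u2.
have V1p x : x != 0 -> 0 < V1 x.
  by move=> x0; rewrite mulr_gt0 // powR_gt0 // enorm_gt0.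
have V2p x : x != 0 -> 0 < V2 x.
  by move=> x0; rewrite mulr_gt0 // powR_gt0 // enorm_gt0.
have V10 x : 0 <= V1 x by rewrite mulr_ge0 ?powR_ge0 // ltW.
have V20 x : 0 <= V2 x by rewrite mulr_ge0 ?powR_ge0 // ltW.
have cV1 x : x != 0 -> {for x, continuous V1} by move=> x0; exact: continuous_weighted.
have cV2 x : x != 0 -> {for x, continuous V2} by move=> x0; exact: continuous_weighted.
have e1 x : x != 0 -> cylLap V1 x (m ^+ 2 * V1 x - source V1 V2 p q d1 x).
  move=> x0; apply: (cylLap_of_equation oU C2_1 (Ux x x0) x0 (ltW (p1 x)) (ltW (p2 x))).
  exact: eq1 (Ux x x0).
have e2 x : x != 0 -> cylLap V2 x (m ^+ 2 * V2 x - source V2 V1 s r d2 x).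
  move=> x0; apply: (cylLap_of_equation oU C2_2 (Ux x x0) x0 (ltW (p2 x)) (ltW (p1 x))).
  by rewrite [u2 x `^ s * _]mulrC; exact: eq2 (Ux x x0).
have V0 : V1 0 = 0 /\ V2 0 = 0.
  by rewrite /V1 /V2 /weighted enorm0 powR0 ?mul0r // gt_eqF.
have pos0 x : 0 < V1 x -> x != 0.
  by apply: contraTneq => ->; rewrite V0.1 ltxx.
have pos0' x : 0 < V2 x -> x != 0.
  by apply: contraTneq => ->; rewrite V0.2 ltxx.
have small : exists2 rho0 : R, 0 < rho0 & forall x, x != 0 -> enorm x <= rho0 ->
     sensitivity V1 V2 p q d1 x < m ^+ 2 /\ sensitivity V2 V1 s r d2 x < m ^+ 2.
  have m2 : 0 < m ^+ 2 by rewrite exprn_gt0.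
  have n1 x : 0 <= u1 x by exact: ltW. have n2 x : 0 <= u2 x by exact: ltW.
  have [t1 t10 H1] := weighted_source_at_origin k_gt0 hp hq n1 n2 (c1 0) (c2 0) m2.
  have [t2 t20 H2] := weighted_source_at_origin k_gt0 hs hr n2 n1 (c2 0) (c1 0) m2.
  have tm : 0 < Num.min t1 t2 by rewrite lt_min t10.
  exists (Num.min t1 t2 / 2); first by rewrite divr_gt0.
  move=> x x0 xt; have : enorm x < Num.min t1 t2 by apply: le_lt_trans xt _; lra.
  rewrite lt_min => /andP[xt1 xt2].
  rewrite /V1 /V2 /weighted !(sensitivity_powR a) //.
  rewrite (_ : d1 + _ = k); last by rewrite /d1 /m; field.
  rewrite (_ : d2 + _ = k); last by rewrite /d2 /m; field.
  by split; [exact: H1|exact: H2].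
have [rho0 rho00 Hsmall] := small.
have ord (l : R) : 0 < l -> ordered V1 V2 l.
  apply: (@moving_spheres R N V1 V2 m p q r s d1 d2 _ N_gt0 hp hq hr hs
    (ltW d10) (ltW d20) V10 V20 cV1 cV2 _ _ _ _ _ rho0 rho00 Hsmall).
  - exact: lt0r_neq0.
  - by move=> x; split => [/pos0|/pos0'] x0; [exact: V2p|exact: V1p].
  - move=> x t t1 /pos0 x0; apply: V1p; rewrite scaler_eq0 negb_or x0 andbT.
    by rewrite gt_eqF // (lt_le_trans ltr01).
  - by move=> x x0 _ _; exact: e1.
  - by move=> x x0 _ _; exact: e2.
  - move=> e e0; have [t1 t10 H1] := vanish_at_origin m_gt0 (c1 0) e0.
    have [t2 t20 H2] := vanish_at_origin m_gt0 (c2 0) e0.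
    exists (Num.min t1 t2); first by rewrite lt_min t10.
    by move=> x _; rewrite lt_min => /andP[xt1 xt2]; split; [exact: H1|exact: H2].
  - by left.
have [e ne1] := @unit_vector R N N_gt0.
have low V : (forall x, x != 0 -> 0 < V x) -> (forall x, x != 0 -> {for x, continuous V}) ->
    exists2 c : R, 0 < c & forall x, enorm x = 1 -> c <= V x.
  move=> Vp cV.
  have [|||P PK HP] := @EVT_max_at R N (fun x => - V x) (annulus 1 1).
  - by exists e; rewrite /annulus/= ne1 lexx.
  - exact: compact_annulus.
  - move=> y /andP[y1 _]; apply: continuousN; apply: cV.
    by rewrite -enorm_gt0; exact: lt_le_trans y1.
  exists (V P); last by move=> x x1; rewrite -lerN2; apply: HP; rewrite /annulus/= x1 lexx.
  by apply: Vp; rewrite -enorm_gt0; move: PK => /andP[P1 _]; exact: lt_le_trans P1.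
have [c c0 Hc] := low V1 V1p cV1; have [c' c'0 Hc'] := low V2 V2p cV2.
apply: (@oscillation R N V1 V2 m p q d1 c c' N_gt0 d10 hp hq V1p cV1 e1 c0 c'0).
move=> x x1; have n0 : 0 < enorm x by exact: lt_le_trans x1.
have nn := lt0r_neq0 n0.
pose z := (enorm x)^-1 *: x.
have z1 : enorm z = 1 by rewrite enormZ ger0_norm ?invr_ge0 ?(ltW n0) // mulVf.
have z0 : z != 0 by rewrite -enorm_gt0 z1.
have [h1 h2] := ordered_ray ord z0 x1.
have xz : enorm x *: z = x by rewrite scalerA divff // scale1r.
rewrite xz in h1 h2.
by split; [exact: le_trans (Hc z z1) h1|exact: le_trans (Hc' z z1) h2].
Qed.

Definition zero_extension (Omega : set 'rV[R]_N) u y : R := if `[< Omega y >] then u y else 0.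

Lemma zero_extension_in (Omega : set 'rV[R]_N) u y : Omega y -> zero_extension Omega u y = u y.
Proof. by move=> Oy; rewrite /zero_extension; case: asboolP. Qed.

Lemma zero_extension_out (Omega : set 'rV[R]_N) u y : ~ Omega y -> zero_extension Omega u y = 0.
Proof. by move=> Oy; rewrite /zero_extension; case: asboolP. Qed.

Lemma continuous_zero_extension (Omega : set 'rV[R]_N) u : open Omega ->
  {within closure Omega, continuous u} -> (forall x, bdry Omega x -> u x = 0) ->
  continuous (zero_extension Omega u).
Proof.
move=> oO cu u0 x.
have [Ox|nOx] := pselect (Omega x).
  have cux : {for x, continuous u}.
    have : {within Omega, continuous u} by apply: continuous_subspaceW cu; exact: subset_closure.
    by rewrite continuous_open_subspace //; apply; rewrite inE.
  apply/continuous_epsP => e e0; rewrite zero_extension_in //.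
  move/continuous_epsP : cux => /(_ _ e0).
  by apply: filterS2 (open_nbhs_nbhs (conj oO Ox)) => y Oy; rewrite zero_extension_in.
apply/continuous_epsP => e e0; rewrite zero_extension_out //.
have [cOx|ncOx] := pselect (closure Omega x).
  have ux : u x = 0 by apply: u0; split => // /interior_subset.
  have : \forall y \near x, closure Omega y -> `|u x - u y| < e.
    have H : u y @[y --> within (closure Omega) (nbhs x)] --> u x.
      exact: ((subspace_continuousP _ _).1 cu x cOx).
    by have /cvgrPdist_lt/(_ e e0) := H.
  apply: filterS => y; rewrite ux /zero_extension; case: asboolP => [Oy|_ _]; last by rewrite subrr normr0.
  by apply; exact: subset_closure.
have : \forall y \near x, ~ closure Omega y.
  by have := open_nbhs_nbhs (conj (closed_openC (@closed_closure _ Omega)) ncOx).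
by apply: filterS => y ny; rewrite zero_extension_out ?subrr ?normr0 // => /subset_closure.
Qed.

(** From the critical value on the weights do not grow, so [|x|^m u_i] is read through the
    inversion of radius [1], which reverses their growth and sends the origin to
    infinity. After the extension by zero, star-shapedness says that the positivity set
    is stable under expansions and boundedness that it avoids a ball around the origin.
    Monotonicity along rays then contradicts the decay of [|x|^m u_1] at the origin of
    [Omega]. *)
Theorem star_shaped_nonexistence (Omega : set 'rV[R]_N) u1 u2 :
  open Omega -> bounded_set Omega -> Omega 0 -> star_shaped0 Omega ->
  p_S N a b <= Num.min (p + q) (r + s) ->
  positive_solution a b p q r s Omega u1 u2 -> zero_boundary Omega u1 u2 -> False.
Proof.
move=> oO bO O0 starO; rewrite le_min => /andP[sup1 sup2].
move=> [pos1 pos2 C2_1 C2_2 C0_1 C0_2 eq1 eq2] zb.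
pose v1 := zero_extension Omega u1; pose v2 := zero_extension Omega u2.
have c1 : continuous v1 by apply: continuous_zero_extension => // x /zb[].
have c2 : continuous v2 by apply: continuous_zero_extension => // x /zb[].
have v1P x : 0 < v1 x <-> Omega x.
  rewrite /v1 /zero_extension; case: asboolP => Ox; first by split => // _; exact: pos1.
  by split=> //; rewrite ltxx.
have v2P x : 0 < v2 x <-> Omega x.
  rewrite /v2 /zero_extension; case: asboolP => Ox; first by split => // _; exact: pos2.
  by split=> //; rewrite ltxx.
have v10 x : 0 <= v1 x.
  by rewrite /v1 /zero_extension; case: asboolP => // Ox; apply: ltW; exact: pos1.
have v20 x : 0 <= v2 x.
  by rewrite /v2 /zero_extension; case: asboolP => // Ox; apply: ltW; exact: pos2.
pose d1 := - (m + k - m * (p + q)); pose d2 := - (m + k - m * (s + r)).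
have d10 : 0 <= d1.
  by rewrite /d1 critical_gap -mulrN mulr_ge0 ?(ltW m_gt0) // oppr_ge0 subr_le0.
have d20 : 0 <= d2.
  by rewrite /d2 critical_gap -mulrN mulr_ge0 ?(ltW m_gt0) // oppr_ge0 subr_le0 addrC.
pose I := @inversion R N 1.
pose W1 x := weighted v1 (I x); pose W2 x := weighted v2 (I x).
have I0 x : x != 0 -> I x != 0 by move=> x0; apply: inversion_neq0 => //; exact: oner_neq0.
have nI x : enorm (I x) = (enorm x)^-1 by rewrite enorm_inversion expr1n mul1r.
have Iz : I 0 = 0 by rewrite /I /inversion scaler0.
have W1P x : 0 < W1 x <-> x != 0 /\ Omega (I x).
  split=> [|[x0 /v1P H]]; last by rewrite mulr_gt0 // powR_gt0 // enorm_gt0 I0.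
  have [->|x0] := eqVneq x 0.
    by rewrite /W1 Iz /weighted enorm0 powR0 ?mul0r ?ltxx // gt_eqF.
  by rewrite /W1 /weighted pmulr_rgt0 ?powR_gt0 ?enorm_gt0 ?I0 // => /v1P.
have W2P x : 0 < W2 x <-> x != 0 /\ Omega (I x).
  split=> [|[x0 /v2P H]]; last by rewrite mulr_gt0 // powR_gt0 // enorm_gt0 I0.
  have [->|x0] := eqVneq x 0.
    by rewrite /W2 Iz /weighted enorm0 powR0 ?mul0r ?ltxx // gt_eqF.
  by rewrite /W2 /weighted pmulr_rgt0 ?powR_gt0 ?enorm_gt0 ?I0 // => /v2P.
have W10 x : 0 <= W1 x by rewrite mulr_ge0 ?powR_ge0.
have W20 x : 0 <= W2 x by rewrite mulr_ge0 ?powR_ge0.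
have W1z x : ~ Omega (I x) -> W1 x = 0.
  by move=> nO; apply/eqP; have := W10 x; rewrite le_eqVlt eq_sym => /orP[//|/W1P[]].
have W2z x : ~ Omega (I x) -> W2 x = 0.
  by move=> nO; apply/eqP; have := W20 x; rewrite le_eqVlt eq_sym => /orP[//|/W2P[]].
have cW v x : continuous v -> x != 0 -> {for x, continuous (fun y => weighted v (I y))}.
  move=> cv x0; apply: (@continuous_comp _ _ _ I (weighted v)); first exact: continuous_inversion.
  by apply: continuous_weighted; [exact: I0|exact: cv].
have oP : open (punctured Omega) by exact: open_punctured.
have eqn u u' v v' (P Q : R) : Ck 2 (punctured Omega) u ->
    (forall y, Omega y -> v y = u y) -> (forall y, Omega y -> v' y = u' y) ->
    (forall y, Omega y -> 0 <= u y) -> (forall y, Omega y -> 0 <= u' y) ->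
    (forall x, punctured Omega x -> divergence (fun y => enorm y `^ a *: grad u y) x
      + enorm x `^ b * (u x `^ P * u' x `^ Q) = 0) ->
    forall x, x != 0 -> Omega (I x) ->
    cylLap (fun y => weighted v (I y)) x (m ^+ 2 * weighted v (I x) -
      source (fun y => weighted v (I y)) (fun y => weighted v' (I y)) P Q
       (- (m + k - m * (P + Q))) x).
  move=> C2 vu vu' u0 u'0 E x x0 OI.
  have PI : punctured Omega (I x) by split => //; apply/eqP; exact: I0.
  have := cylLap_of_equation oP C2 PI (I0 x x0) (u0 _ OI) (u'0 _ OI) (E _ PI).
  move=> /(@cylLap_inversion _ _ _ x _ 1) L.
  have nearI : \forall y \near x, Omega (I y).
    have cI : {for x, continuous I} by exact: continuous_inversion.
    exact: (cI _ (open_nbhs_nbhs (conj oO OI))).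
  have {L} := cylLap_near _ L; move=> /(_ (fun y => weighted v (I y)))L.
  have : \forall y \near x, enorm (inversion 1 y) `^ m * u (inversion 1 y) = weighted v (I y).
    by apply: filterS nearI => y Oy; rewrite /weighted vu.
  move=> /L; congr cylLap.
  rewrite /source /weighted vu // vu' // nI; congr (_ - _ * _).
  by rewrite -powR_inv1 ?enorm_ge0 // -powRrM mulN1r.
have [M M0 HM] : exists2 M : R, 0 < M & forall y, Omega y -> enorm y < M.
  have [M [_ HM]] := bO.
  have HM1 y : Omega y -> `|y| <= M + 1 by apply: HM; rewrite ltrDl.
  have M1 : 0 <= M + 1 by apply: le_trans (HM1 0 O0).
  exists (N%:R * (M + 1) + 1); first by rewrite ltr_wpDl // mulr_ge0.
  move=> y /HM1 yM; apply: (@le_lt_trans _ _ (N%:R * (M + 1))); last by rewrite ltrDl.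
  rewrite -(@ler_pXn2r _ 2) ?nnegrE ?enorm_ge0 ?mulr_ge0 //.
  rewrite sqr_enorm exprMn.
  apply: (@le_trans _ _ (\sum_(i < N) (M + 1) ^+ 2)).
    apply: ler_sum => i _; rewrite -real_normK ?num_real // lerXn2r ?nnegrE //.
    exact: le_trans (coord_le_norm y i) yM.
  rewrite sumr_const card_ord -[leLHS]mulr_natl ler_wpM2r ?sqr_ge0 //.
  by rewrite -natrX ler_nat -{1}(expn1 N) leq_exp2l // (leq_trans _ hN).
have Wout x : x != 0 -> enorm x <= M^-1 -> ~ Omega (I x).
  move=> x0 xM /HM; rewrite nI; apply/negP; rewrite -leNgt.
  by rewrite -[leLHS]invrK lef_pV2 ?posrE ?invr_gt0 ?enorm_gt0.
have m2 : 0 < m ^+ 2 by rewrite exprn_gt0.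
have ord (l : R) : 0 < l -> ordered W1 W2 l.
  apply: (@moving_spheres R N W1 W2 m p q r s d1 d2 _ N_gt0 hp hq hr hs
    d10 d20 W10 W20 _ _ _ _ _ _ _ M^-1).
  - exact: lt0r_neq0.
  - by move=> x; exact: cW.
  - by move=> x; exact: cW.
  - by move=> x; split => [/W1P/W2P|/W2P/W1P].
  - move=> x t t1 /W1P[x0 OI]; have t0 : t != 0 by rewrite gt_eqF // (lt_le_trans ltr01).
    apply/W1P; split; first by rewrite scaler_eq0 negb_or t0.
    have -> : I (t *: x) = t^-1 *: I x.
      rewrite /I inversion_scale // /inversion scalerA; congr (_ *: _).
      by rewrite invfM mulrCA.
    apply: starO => //; first by rewrite invr_ge0 (le_trans ler01).
    by rewrite invf_le1 // (lt_le_trans ltr01).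
  - move=> x x0 /W1P[_ OI] _; apply: (eqn u1 u2 v1 v2) => //.
    + by move=> y Oy; rewrite /v1 zero_extension_in.
    + by move=> y Oy; rewrite /v2 zero_extension_in.
    + by move=> y Oy; apply: ltW; exact: pos1.
    + by move=> y Oy; apply: ltW; exact: pos2.
  - move=> x x0 /W2P[_ OI] _; apply: (eqn u2 u1 v2 v1) => //.
    + by move=> y Oy; rewrite /v2 zero_extension_in.
    + by move=> y Oy; rewrite /v1 zero_extension_in.
    + by move=> y Oy; apply: ltW; exact: pos2.
    + by move=> y Oy; apply: ltW; exact: pos1.
    + by move=> y Py; rewrite [u2 y `^ s * _]mulrC; exact: eq2.
  - move=> e e0; exists M^-1; first by rewrite invr_gt0.
    move=> x x0 /ltW xM; have nO := Wout x x0 xM.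
    by rewrite W1z // W2z.
  - by rewrite invr_gt0.
  - move=> x x0 xM; have nO := Wout x x0 xM.
    by rewrite !sensitivity_eq0 ?W1z ?W2z.
  - right=> x x0 W1x; have n0 : 0 < enorm x by rewrite enorm_gt0.
    pose t := Num.min (1 / 2) (M^-1 / enorm x).
    have t0 : 0 < t by rewrite lt_min !divr_gt0 // invr_gt0.
    have t2 : t <= 1 / 2 by rewrite ge_min lexx.
    exists t; split => //; first by lra.
    apply: W1z; apply: Wout; first by rewrite scaler_eq0 negb_or lt0r_neq0.
    rewrite enormZ ger0_norm ?(ltW t0) // -ler_pdivlMr //.
    by rewrite ge_min lexx orbT.
have [e ne1] := @unit_vector R N N_gt0.
have [t [t0 Ot]] : exists t : R, 0 < t /\ Omega (t *: e).
  have cs : {for (0 : R), continuous (fun t : R => t *: e)} by apply: continuous_scale_curve.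
  have : \forall t \near (0 : R), Omega (t *: e).
    by apply: cs; rewrite scale0r; exact: open_nbhs_nbhs.
  move=> /nbhs_ballP[d /= d0 Hd]; exists (d / 2); split; first by rewrite divr_gt0.
  by apply: Hd; rewrite /ball/= sub0r normrN ger0_norm; lra.
have e0 : e != 0 by rewrite -enorm_gt0 ne1.
pose y := t *: e; have y0 : y != 0 by rewrite scaler_eq0 negb_or lt0r_neq0.
pose x := I y; have x0 : x != 0 by exact: I0.
have Ix : I x = y by apply: inversionK => //; exact: oner_neq0.
have W1x : 0 < W1 x by apply/W1P; rewrite Ix.
have [rho rho0 Hrho] := vanish_at_origin m_gt0 (c1 0) W1x.
have n0 : 0 < enorm x by rewrite enorm_gt0.
(* far enough out for the preimage of T *: x to be within rho of the origin *)
pose T := Num.max 1 (2 / (rho * enorm x)).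
have T1 : 1 <= T by rewrite le_max lexx.
have T0 : 0 < T by exact: lt_le_trans T1.
have [h1 _] := ordered_ray ord x0 T1.
have : W1 (T *: x) < W1 x.
  apply: Hrho; rewrite nI enormZ ger0_norm ?(ltW T0) //.
  have : 2 / (rho * enorm x) <= T by rewrite le_max lexx orbT.
  rewrite ler_pdivrMr ?mulr_gt0 // => H.
  rewrite -[ltLHS]mul1r ltr_pdivrMr ?mulr_gt0 //.
  by apply: (@lt_le_trans _ _ 2); [rewrite ltr1n|rewrite mulrCA].
by rewrite ltNge h1.
Qed.

End NonexistenceTheorems.

(** * Integral form of the Emden-Fowler equation *)

Section Primitive.
Context {R : realType}.
Implicit Types (f g h : R -> R) (x y : R).

(** The integral starts at [-1] so that the derivative at [0] is two-sided. *)
Lemma primitive_exists h : continuous h ->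
  exists2 H : R -> R, H 0 = 0 & forall x, -1 < x -> isd H x (h x).
Proof.
move=> ch; pose mu := @lebesgue_measure R.
pose F x := (\int[mu]_(t in [set` `[(-1 : R), x]]) (h t))%R.
have dF x : -1 < x -> isd F x (h x).
  move=> x1.
  have xu : x < x + 1 by rewrite ltrDl.
  have hi : mu.-integrable `[-1, x + 1] (EFin \o h).
    apply: continuous_compact_integrable; first exact: segment_compact.
    exact: continuous_subspaceT.
  have [dF1 dF2] := continuous_FTC1_closed xu hi x1 (ch x).
  by split; [exact: dF1|rewrite -derive1E].
exists (fun x => F x - F 0); first by rewrite subrr.
move=> x x1; apply: isd_eq (isdB (dF x x1) (isdC (F 0) x)) _.
by rewrite subr0.
Qed.

Lemma isd_within f (f' : R -> R) (a b : R) :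
  (forall x, a <= x -> x <= b -> isd f x (f' x)) -> {within `[a, b], continuous f}.
Proof.
move=> df; apply: derivable_within_continuous => x; rewrite in_itv/= => /andP[ax xb].
by have [] := df x ax xb.
Qed.

(** The functions [K - G] and [K + G] are both nondecreasing. *)
Lemma mean_value_majorant G (g K k : R -> R) y : 0 <= y ->
  {within `[0, y], continuous G} -> {within `[0, y], continuous K} ->
  (forall s, 0 < s -> s < y -> [/\ isd G s (g s), isd K s (k s) & `|g s| <= k s]) ->
  `|G y - G 0| <= K y - K 0.
Proof.
move=> y0 cG cK H.
move: y0; rewrite le_eqVlt => /orP[/eqP <-|y0]; first by rewrite !subrr normr0.
have pos F (F' : R -> R) : {within `[0, y], continuous F} ->
   (forall s, 0 < s -> s < y -> isd F s (F' s) /\ 0 <= F' s) -> 0 <= F y - F 0.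
  move=> cF HF; have [||c + ->] := @MVT R F F' 0 y y0.
  - by move=> s; rewrite in_itv/= => /andP[s0 sy]; have [] := HF s s0 sy.
  - exact: cF.
  rewrite in_itv/= => /andP[c0 cy]; have [_ F'c] := HF c c0 cy.
  by rewrite subr0 mulr_ge0 // ltW.
have P1 := pos (fun s => K s - G s) (fun s => k s - g s).
have P2 := pos (fun s => K s + G s) (fun s => k s + g s).
rewrite ler_norml; apply/andP; split.
  have {P2} : 0 <= (K y + G y) - (K 0 + G 0).
    apply: P2 => [s|s s0 sy]; first by apply: continuousD; [exact: cK|exact: cG].
    have [dG dK] := H s s0 sy; rewrite ler_norml => /andP[g1 g2].
    by split; [exact: isdD|lra].
  by lra.
have {P1} : 0 <= (K y - G y) - (K 0 - G 0).
  apply: P1 => [s|s s0 sy]; first by apply: continuousB; [exact: cK|exact: cG].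
  have [dG dK] := H s s0 sy; rewrite ler_norml => /andP[g1 g2].
  by split; [exact: isdB|lra].
by lra.
Qed.

(** The intervals of centre [f n] and radius [2 * K / 2 ^+ n] are nested. *)
Lemma geometric_limit (f : nat -> R) (K : R) : 0 <= K ->
  (forall n, `|f n.+1 - f n| <= K / 2 ^+ n) ->
  exists l : R, forall n, `|l - f n| <= 2 * K / 2 ^+ n.
Proof.
move=> K0 H.
pose e n : R := 2 * K / 2 ^+ n.
have eS n : e n.+1 = K / 2 ^+ n by rewrite /e exprS; field; rewrite expf_neq0.
have e2 n : e n = 2 * (K / 2 ^+ n) by rewrite /e mulrA.
have lo n : f n - e n <= f n.+1 - e n.+1.
  by have := H n; rewrite eS e2 ler_norml => /andP[]; lra.
have hi n : f n.+1 + e n.+1 <= f n + e n.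
  by have := H n; rewrite eS e2 ler_norml => /andP[]; lra.
have lo' n j : f n - e n <= f (n + j)%N - e (n + j)%N.
  by elim: j => [|j IH]; rewrite ?addn0 // addnS (le_trans IH).
have hi' n j : f (n + j)%N + e (n + j)%N <= f n + e n.
  by elim: j => [|j IH]; rewrite ?addn0 // addnS (le_trans _ IH).
have e0 n : 0 <= e n by rewrite /e divr_ge0 ?exprn_ge0 // mulr_ge0.
have cross n j : f n - e n <= f j + e j.
  apply: (le_trans (lo' n j)); apply: (@le_trans _ _ (f (n + j)%N + e (n + j)%N)).
    by have := e0 (n + j)%N; lra.
  by rewrite addnC; exact: hi'.
pose S := [set f n - e n | n in [set: nat]].
have supS : has_sup S.
  split; first by exists (f 0%N - e 0%N), 0%N.
  by exists (f 0%N + e 0%N) => _ [n _ <-]; exact: cross.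
exists (sup S) => n; rewrite -/(e n) ler_norml; apply/andP; split.
  have : f n - e n <= sup S by apply: ub_le_sup => //; [exact: supS.2|exists n].
  by lra.
have : sup S <= f n + e n by apply: ge_sup; [exact: supS.1|move=> _ [j _ <-]; exact: cross].
by lra.
Qed.

End Primitive.

Section EmdenFowler.
Context {R : realType} (nu sigma : R).
Context (nu_gt0 : 0 < nu) (sigma_gt1 : 1 < sigma).
Implicit Types (f g h v w : R -> R) (x y s t : R).

(** A bounded and globally Lipschitz nonlinearity that agrees with the power on
    [0, 1], where the solution will turn out to take its values. *)
Definition clamped_power t : R := Num.max 0 (Num.min 1 t) `^ sigma.

Let sigma_gt0 : 0 < sigma. Proof. exact: lt_trans sigma_gt1. Qed.

Lemma clamped_power_bounds t : 0 <= clamped_power t <= 1.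
Proof.
rewrite powR_ge0 /= -[leRHS](_ : 1 `^ sigma = 1); last by rewrite powR1.
by rewrite ge0_ler_powR ?nnegrE ?(ltW sigma_gt0) ?le_max ?lexx // ge_max ler01 ge_min lexx.
Qed.

Lemma clamped_powerE t : 0 <= t -> t <= 1 -> clamped_power t = t `^ sigma.
Proof. by move=> t0 t1; rewrite /clamped_power min_r // max_r. Qed.

Lemma continuous_clamped_power : continuous clamped_power.
Proof.
move=> t; apply: (@continuous_powR_ge0 R R (fun t : R => Num.max 0 (Num.min 1 t))) => //.
  by move=> u; rewrite le_max lexx.
apply: (@continuous_max R R (cst 0) (fun t : R => Num.min 1 t)); first exact: cst_continuous.
by apply: (@continuous_min R R (cst 1) id); [exact: cst_continuous|].
Qed.

Lemma clamped_power_lipschitz s t :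
  `|clamped_power s - clamped_power t| <= sigma * `|s - t|.
Proof.
wlog : s t / s <= t.
  move=> H; case: (leP s t) => st; first exact: H.
  by rewrite distrC [`|s - t|]distrC; apply: H; exact: ltW.
move=> st; rewrite distrC [`|s - t|]distrC.
pose c u : R := Num.max 0 (Num.min 1 u).
have c0 u : 0 <= c u by rewrite /c le_max lexx.
have c1 u : c u <= 1 by rewrite /c ge_max ler01 ge_min lexx.
have cst : c s <= c t /\ c t - c s <= t - s.
  rewrite /c; case: (leP 1 s) => s1; case: (leP 1 t) => t1;
  rewrite ?(max_r (@ler01 R)); try lra;
  (case: (leP 0 s) => s0; case: (leP 0 t) => t0; lra).
have [cc ct] := cst.
have ts : 0 <= t - s by rewrite subr_ge0.
rewrite (ger0_norm ts) ger0_norm; last first.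
  rewrite subr_ge0; apply: (ge0_ler_powR (ltW sigma_gt0)); rewrite ?nnegrE //.
  - exact: (c0 s).
  - exact: (c0 t).
have := c0 t; rewrite le_eqVlt => /orP[/eqP ct0|ct0].
  have cs0 : c s = 0 by apply/eqP; rewrite eq_le c0 andbT ct0.
  rewrite /clamped_power -/(c t) -/(c s) cs0 -ct0 subrr mulr_ge0 //.
  exact: ltW.
apply: le_trans (powR_sub_le (ltW sigma_gt1) ct0 (c0 s) cc) _.
rewrite ler_pM ?subr_ge0 ?mulr_ge0 ?powR_ge0 ?(ltW sigma_gt0) //.
rewrite ger_pMr // -[leRHS](_ : 1 `^ (sigma - 1) = 1); last by rewrite powR1.
by rewrite ge0_ler_powR ?nnegrE // subr_ge0 ltW.
Qed.

(** The solution of [y v'' + (nu + 1) v' = - h] with [v 0 = 1] that is bounded at the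
    origin. In divergence form [(y^(nu+1) v')' = - y^nu h], so the primitives [A] of [h]
    and [B] of [y^nu h] give [v' y = - y `^ (- nu - 1) * B y] and, after a second
    integration by parts, the formula for [v]. *)
Definition green h v A B : Prop :=
  [/\ A 0 = 0, B 0 = 0, forall x, -1 < x -> isd A x (h x),
    forall x, -1 < x -> isd B x (`|x| `^ nu * h x) &
    forall y, v y = if 0 < y then 1 - (A y - y `^ (- nu) * B y) / nu else 1].

Lemma continuous_norm_powR x : {for x, continuous (fun t : R => `|t| `^ nu)}.
Proof.
apply: (@continuous_powR_ge0 R R (fun t : R => `|t|)) => //.
exact: norm_continuous.
Qed.

Lemma green_exists h : continuous h -> exists v A B, green h v A B.
Proof.
move=> ch; have [A A0 dA] := primitive_exists ch.
have [B B0 dB] : exists2 H : R -> R, H 0 = 0 &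
    forall x, -1 < x -> isd H x (`|x| `^ nu * h x).
  apply: primitive_exists => x.
  apply: (@continuousM _ _ (fun t : R => `|t| `^ nu) h); last exact: ch.
  exact: continuous_norm_powR.
by exists (fun y => if 0 < y then 1 - (A y - y `^ (- nu) * B y) / nu else 1), A, B.
Qed.

Lemma green_derivative h v A B y : green h v A B -> 0 < y ->
  isd v y (- (y `^ (- nu - 1) * B y)).
Proof.
move=> [A0 B0 dA dB vE] y0; have y1 : -1 < y by apply: lt_trans y0; rewrite ltrN10.
have near_v : \forall t \near y, 1 - (A t - t `^ (- nu) * B t) / nu = v t.
  near=> t; rewrite vE; case: ifPn => // /negP[].
  by near: t; exact: lt_nbhsr.
apply: isd_near near_v _.
apply: isd_eq.
  apply: isdB; first exact: isdC.
  apply: isdM; last exact: isdC.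
  apply: isdB; first exact: dA.
  by apply: isdM; [exact: isd_powR|exact: dB].
have E : y `^ (- nu) * (y `^ nu) = 1.
  by rewrite -powRD ?addNr ?powRr0 // (lt0r_neq0 y0) implybT.
rewrite /= mulr0 addr0 sub0r (gtr0_norm y0).
rewrite [X in _ - (_ + X)]mulrA E mul1r.
by field; rewrite lt0r_neq0.
Unshelve. all: by end_near. Qed.

Lemma moment_interval h B y : 0 <= y ->
  (forall x, -1 < x -> isd B x (`|x| `^ nu * h x)) -> {within `[0, y], continuous B}.
Proof.
move=> y0 dB; apply: (@isd_within _ B (fun x => `|x| `^ nu * h x)) => x x0 _.
by apply: dB; apply: lt_le_trans x0; rewrite ltrN10.
Qed.

(** The kernel [(1 - (s / y)^nu) / nu] lies between [0] and [1 / nu], and integrating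
    [expR (L * s)] gains the factor [1 / L]. *)
Lemma green_contraction h v A B h' v' A' B' (c L : R) y :
  green h v A B -> green h' v' A' B' -> 0 <= c -> 0 < L -> 0 < y ->
  (forall s, 0 <= s -> s <= y -> `|h s - h' s| <= c * expR (L * s)) ->
  `|v y - v' y| <= c * expR (L * y) / (nu * L).
Proof.
move=> [A0 B0 dA dB vE] [A0' B0' dA' dB' vE'] c0 L0 y0 hh.
have m1 x : 0 <= x -> -1 < x by apply: lt_le_trans; rewrite ltrN10.
rewrite vE vE' y0.
pose G s := (A s - A' s) - y `^ (- nu) * (B s - B' s).
have -> : 1 - (A y - y `^ (- nu) * B y) / nu - (1 - (A' y - y `^ (- nu) * B' y) / nu)
  = - (G y - G 0) / nu by rewrite /G A0 B0 A0' B0'; ring.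
rewrite normrM normrN normfV (gtr0_norm nu_gt0).
rewrite invfM mulrA mulrAC ler_pM2r ?invr_gt0 //.
pose g s := (h s - h' s) - y `^ (- nu) * (`|s| `^ nu * h s - `|s| `^ nu * h' s).
pose K s := c / L * expR (L * s).
pose kk s := c * expR (L * s).
have dG s : 0 <= s -> isd G s (g s).
  move=> s0; apply: isdB; first by apply: isdB; [apply: dA|apply: dA']; exact: m1.
  by apply: isdZ; apply: isdB; [apply: dB|apply: dB']; exact: m1.
have dK s : isd K s (kk s).
  have dl : isd (fun s => L * s) s L by apply: isd_eq (isdZ L (isdI s)) _; rewrite mulr1.
  apply: isd_eq (isdZ (c / L) (@isd_comp _ (@expR R) (fun s => L * s) _ _ _ (isd_expR _) dl)) _.
  by rewrite /kk; field; rewrite lt0r_neq0.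
have : `|G y - G 0| <= K y - K 0.
  apply: (@mean_value_majorant _ G g K kk y (ltW y0)).
  - by apply: isd_within => x x0 _; exact: dG.
  - by apply: isd_within => x x0 _; exact: dK.
  - move=> s s0 sy; split; [by apply: dG; exact: ltW|exact: dK|].
    have -> : g s = (1 - y `^ (- nu) * s `^ nu) * (h s - h' s).
      by rewrite /g (gtr0_norm s0); ring.
    rewrite normrM /kk -[leRHS]mul1r ler_pM //; last by apply: hh; exact: ltW.
    have e1 : y `^ (- nu) * s `^ nu <= 1.
      rewrite powRN mulrC ler_pdivrMr ?powR_gt0 // mul1r.
      by rewrite ge0_ler_powR ?nnegrE ?(ltW nu_gt0) ?(ltW s0) ?(ltW y0) ?(ltW sy).
    have e0 : 0 <= y `^ (- nu) * s `^ nu by rewrite mulr_ge0 ?powR_ge0.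
    by rewrite ger0_norm; lra.
move/le_trans; apply.
rewrite /K mulr0 expR0 mulr1 mulrAC lerBlDr lerDl.
by rewrite divr_ge0 // ltW.
Qed.

Lemma green_near_one h v A B y : green h v A B -> (forall x, 0 <= h x <= 1) -> 0 < y ->
  `|v y - 1| <= y / nu.
Proof.
move=> [A0 B0 dA dB vE] h01 y0.
have m1 x : 0 <= x -> -1 < x by apply: lt_le_trans; rewrite ltrN10.
rewrite vE y0.
pose G s := A s - y `^ (- nu) * B s.
have -> : 1 - (A y - y `^ (- nu) * B y) / nu - 1 = - (G y - G 0) / nu.
  by rewrite /G A0 B0; ring.
rewrite normrM normrN normfV (gtr0_norm nu_gt0) ler_pM2r ?invr_gt0 //.
have -> : y = y - 0 by rewrite subr0.
pose g s := h s - y `^ (- nu) * (`|s| `^ nu * h s).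
have dG s : 0 <= s -> isd G s (g s).
  move=> s0; apply: isdB; first by apply: dA; exact: m1.
  by apply: isdZ; apply: dB; exact: m1.
rewrite subr0 -[leRHS]subr0.
apply: (@mean_value_majorant _ G g (fun s => s) (fun=> 1) y (ltW y0)).
- by apply: isd_within => x x0 _; exact: dG.
- by apply: (@isd_within _ _ (fun=> 1)) => x x0 _; exact: isdI.
- move=> s s0 sy; split; [by apply: dG; exact: ltW|exact: isdI|].
  have -> : g s = (1 - y `^ (- nu) * s `^ nu) * h s.
    by rewrite /g (gtr0_norm s0); ring.
  have e1 : y `^ (- nu) * s `^ nu <= 1.
    rewrite powRN mulrC ler_pdivrMr ?powR_gt0 // mul1r.
    by rewrite ge0_ler_powR ?nnegrE ?(ltW nu_gt0) ?(ltW s0) ?(ltW y0) ?(ltW sy).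
  have e0 : 0 <= y `^ (- nu) * s `^ nu by rewrite mulr_ge0 ?powR_ge0.
  have /andP[h0 h1] := h01 s.
  rewrite normrM !ger0_norm //; last by lra.
  rewrite -[leRHS](mulr1 1) ler_pM //; lra.
Qed.

Lemma green_continuous h v A B : green h v A B -> (forall x, 0 <= h x <= 1) ->
  continuous v.
Proof.
move=> gr h01 y; have [_ _ _ _ vE] := gr.
have [y0|y0|y0] := ltgtP 0 y.
- by apply: isd_continuous (green_derivative gr y0).
- apply/continuous_epsP => e e0.
  have : \forall t \near y, t < 0 by exact: lt_nbhsl.
  apply: filterS => t t0; rewrite !vE.
  by rewrite (ltNge 0 y) (ltW y0) (ltNge 0 t) (ltW t0) /= subrr normr0.
rewrite -y0; apply/continuous_epsP => e e0.
have en : 0 < e * nu by rewrite mulr_gt0.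
have : \forall t \near (0 : R), t < e * nu by exact: lt_nbhsl.
apply: filterS => t te; rewrite vE ltxx distrC.
have [t0|t0] := ltP 0 t; last by rewrite vE (ltNge 0 t) t0 /= subrr normr0.
apply: le_lt_trans (green_near_one gr h01 t0) _.
by rewrite ltr_pdivrMr.
Qed.

(** Picard iteration. In the norm with weight [expR (L * y)], [L = 2 * sigma / nu], the
    map contracts by the factor 1/2 on the whole half line at once. *)
Lemma fixed_point : exists v A B, continuous v /\ green (clamped_power \o v) v A B.
Proof.
pose T h : R -> R := if pselect (exists v, exists A B, green h v A B) is left e
  then projT1 (cid e) else fun=> 1.
have TP h : continuous h -> exists A B, green h (T h) A B.
  move=> ch; rewrite /T; case: pselect => [e|[]]; last exact: green_exists.
  exact: (projT2 (cid e)).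
pose f n := iter n (fun v => T (clamped_power \o v)) (fun=> 1 : R).
have h01 v x : 0 <= (clamped_power \o v) x <= 1 by exact: clamped_power_bounds.
have ccv v : continuous v -> continuous (clamped_power \o v).
  by move=> cv x; apply: continuous_comp; [exact: cv|exact: continuous_clamped_power].
have cf n : continuous (f n).
  elim: n => [|n IH]; first exact: cst_continuous.
  have [A [B gr]] := TP _ (ccv _ IH).
  exact: green_continuous gr (h01 _).
have fS n : exists A B, green (clamped_power \o f n) (f n.+1) A B.
  exact: TP (ccv _ (cf n)).
pose L := 2 * sigma / nu.
have L0 : 0 < L by rewrite divr_gt0 // mulr_gt0.
have nuL : nu * L = 2 * sigma by rewrite /L; field; rewrite lt0r_neq0.
pose C := (2 * sigma)^-1.
have C0 : 0 < C by rewrite invr_gt0 mulr_gt0.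
have green0 : green (fun=> 0) (fun=> 1) (fun=> 0) (fun=> 0).
  split => //; first by move=> x _; exact: isdC.
    by move=> x _; rewrite mulr0; exact: isdC.
  by move=> y; rewrite mulr0 subrr mul0r subr0; case: ifP.
have nonpos n y : y <= 0 -> f n y = 1.
  case: n => [//|n] y0; have [A [B [_ _ _ _ ->]]] := fS n.
  by rewrite ltNge y0.
have CE0 y : 0 <= C * expR (L * y) by rewrite mulr_ge0 ?expR_ge0 // ltW.
have CE2 y : 0 <= 2 * (C * expR (L * y)) by rewrite mulr_ge0.
have CEn n y : 0 <= C * expR (L * y) / 2 ^+ n by rewrite divr_ge0 ?exprn_ge0.
have step n y : `|f n.+1 y - f n y| <= C * expR (L * y) / 2 ^+ n.
  elim: n y => [|n IH] y.
    have [y0|y0] := leP y 0.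
      by rewrite !nonpos // subrr normr0.
    have [A [B gr]] := fS 0%N.
    have := green_contraction (c := 1) gr green0 ler01 L0 y0 _.
    rewrite nuL mul1r expr0 divr1 [C * _]mulrC; apply => s s0 sy.
    rewrite subr0 mul1r ger0_norm; last by have /andP[] := h01 (f 0%N) s.
    apply: (@le_trans _ _ 1); first by have /andP[] := h01 (f 0%N) s.
    by rewrite -expR0 ler_expR mulr_ge0 // ltW.
  have [y0|y0] := leP y 0.
    by rewrite !nonpos // subrr normr0.
  have [A [B gr]] := fS n.+1; have [A' [B' gr']] := fS n.
  have c0 : 0 <= sigma * (C / 2 ^+ n).
    by rewrite mulr_ge0 ?divr_ge0 ?exprn_ge0 // ltW.
  apply: le_trans (green_contraction gr gr' c0 L0 y0 _) _.
    move=> s s0 sy; apply: le_trans (clamped_power_lipschitz _ _) _.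
    rewrite -mulrA ler_pM2l //; apply: le_trans (IH s) _.
    by rewrite mulrAC.
  rewrite nuL exprS le_eqVlt; apply/orP; left; apply/eqP.
  by field; rewrite expf_neq0 // lt0r_neq0.
have lim y : exists l, forall n, `|l - f n y| <= 2 * (C * expR (L * y)) / 2 ^+ n.
  by apply: geometric_limit => [|n]; [exact: CE0|exact: step].
have [v Hv] := choice lim.
have small (e K : R) : 0 < e -> 0 <= K -> exists n, K / 2 ^+ n < e.
  move=> e0 K0; exists (Num.trunc (K / e)).+1.
  rewrite ltr_pdivrMr ?exprn_gt0 // mulrC -ltr_pdivrMr //.
  have Ke : 0 <= K / e by rewrite divr_ge0 // ltW.
  have := Num.Theory.truncnS_gt (K / e) => H.
  apply: lt_le_trans H _.
  by rewrite -natrX ler_nat ltnW // ltn_expl.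
have cv : continuous v.
  move=> y; apply/continuous_epsP => e e0.
  pose K := 2 * (C * expR (L * (y + 1))).
  have K0 : 0 <= K by exact: CE2.
  have e3 : 0 < e / 3 by rewrite divr_gt0.
  have [n Hn] := small _ _ e3 K0.
  have nb t : t <= y + 1 -> `|v t - f n t| < e / 3.
    move=> ty; apply: le_lt_trans (Hv t n) _; apply: le_lt_trans Hn.
    rewrite ler_pM2r ?invr_gt0 ?exprn_gt0 // /K !ler_pM2l // ler_expR.
    by rewrite ler_pM2l.
  have near1 : \forall t \near y, t < y + 1 by apply: lt_nbhsl; rewrite ltrDl.
  have near2 : \forall t \near y, `|f n y - f n t| < e / 3.
    by have /continuous_epsP := cf n y; apply.
  apply: filterS2 near1 near2 => t /ltW ty H.
  have H1 := nb y ltac:(by rewrite lerDl); have H2 := nb t ty.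
  have -> : v y - v t = (v y - f n y) + (f n y - f n t) - (v t - f n t) by ring.
  apply: le_lt_trans (ler_normB _ _) _.
  apply: le_lt_trans (lerD (ler_normD _ _) (lexx _)) _.
  by lra.
have [w [A [B gr]]] := green_exists (ccv _ cv).
suff wv : w = v by rewrite wv in gr; exists v, A, B.
apply/funext => y; have [y0|y0] := leP y 0.
  have [_ _ _ _ ->] := gr; rewrite ltNge y0 /=.
  apply/eqP; rewrite eq_sym -subr_eq0 -normr_le0 leNgt; apply/negP => H.
  have [n] := small _ (2 * (C * expR (L * y))) H (CE2 y).
  by apply/negP; rewrite -leNgt; have := Hv y n; rewrite nonpos.
apply/eqP; rewrite -subr_eq0 -normr_le0 leNgt; apply/negP => H.
have [n Hn] := small _ (2 * (C * expR (L * y))) H (CE2 y).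
have [A' [B' gr']] := fS n.
have c0 : 0 <= sigma * (2 * C / 2 ^+ n).
  by rewrite mulr_ge0 ?divr_ge0 ?exprn_ge0 ?mulr_ge0 // ltW.
have : `|w y - f n.+1 y| <= (2 * (C * expR (L * y))) / 2 ^+ n / 2.
  apply: le_trans (green_contraction gr gr' c0 L0 y0 _) _.
    move=> s s0 sy; apply: le_trans (clamped_power_lipschitz _ _) _.
    rewrite -mulrA ler_pM2l //; apply: le_trans (Hv s n) _.
    by rewrite le_eqVlt; apply/orP; left; apply/eqP; ring.
  rewrite nuL le_eqVlt; apply/orP; left; apply/eqP.
  by field; rewrite expf_neq0 // lt0r_neq0.
have : `|v y - f n.+1 y| <= (2 * (C * expR (L * y))) / 2 ^+ n / 2.
  apply: le_trans (Hv y n.+1) _; rewrite le_eqVlt exprS; apply/orP; left; apply/eqP.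
  by field; rewrite expf_neq0.
move=> Q1 Q2.
have : `|w y - v y| <= `|w y - f n.+1 y| + `|v y - f n.+1 y|.
  by rewrite [`|v y - _|]distrC (_ : w y - v y = (w y - f n.+1 y) + (f n.+1 y - v y)) ?ler_normD //; ring.
by move: Q1 Q2 Hn; move: (_ / 2 ^+ n) => Z; lra.
Qed.

End EmdenFowler.

(** * Positivity of the Emden-Fowler profile *)

Section PositiveProfile.
Context {R : realType} (nu sigma : R).
Context (nu_gt0 : 0 < nu) (sigma_gt1 : 1 < sigma)
  (supercritical : 1 + 2 / nu <= sigma).
Implicit Types (x y s t : R).

Let sigma_gt0 : 0 < sigma. Proof. exact: lt_trans sigma_gt1. Qed.

Section Solution.
Context (phi A B : R -> R) (phi_cont : continuous phi)
  (sol : green nu (clamped_power sigma \o phi) phi A B).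

Let h := clamped_power sigma \o phi.

Let h_bounds x : 0 <= h x <= 1. Proof. exact: (clamped_power_bounds sigma_gt1). Qed.

Let phi0 : phi 0 = 1. Proof. by have [_ _ _ _ ->] := sol; rewrite ltxx. Qed.

Let gtN1 x : 0 <= x -> -1 < x. Proof. by apply: lt_le_trans; rewrite ltrN10. Qed.

Lemma moment_derivative y : 0 < y -> isd B y (y `^ nu * h y).
Proof.
move=> y0; have [_ _ _ dB _] := sol.
by have := dB y (gtN1 (ltW y0)); rewrite (gtr0_norm y0).
Qed.

Lemma moment_within y : 0 <= y -> {within `[0, y], continuous B}.
Proof. by have [_ _ _ dB _] := sol => y0; exact: moment_interval dB. Qed.

Lemma moment_bounds y : 0 < y -> 0 < B y /\ B y <= y `^ (nu + 1).
Proof.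
move=> y0; have [_ B0 _ _ _] := sol.
have mvt s t : 0 <= s -> s < t -> exists c, [/\ s < c, c < t & B t - B s = c `^ nu * h c * (t - s)].
  move=> s0 st; have [||c] := @MVT R B (fun x => x `^ nu * h x) s t st.
  - move=> x; rewrite in_itv/= => /andP[sx _]; apply: moment_derivative.
    exact: le_lt_trans sx.
  - apply: continuous_subspaceW (moment_within (ltW (le_lt_trans s0 st))).
    by move=> x; rewrite /= !in_itv/= => /andP[sx ->]; rewrite (le_trans s0 sx).
  by rewrite in_itv/= => /andP[sc ct] E; exists c.
split; last first.
  have [c [c0 cy]] := mvt 0 y (lexx _) y0; rewrite B0 !subr0 => ->.
  have -> : y `^ (nu + 1) = y `^ nu * 1 * y.
    by rewrite powRD ?powRr1 ?(ltW y0) ?mulr1 // (lt0r_neq0 y0) implybT.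
  have /andP[h0 h1] := h_bounds c.
  rewrite ler_pM2r // ler_pM ?powR_ge0 //.
  by rewrite ge0_ler_powR ?nnegrE ?(ltW nu_gt0) ?(ltW c0) ?(ltW y0) ?(ltW cy).
have : \forall t \near (0 : R), 2^-1 < phi t.
  have c0 : {for (0 : R), continuous phi} by exact: phi_cont.
  by move/cvgr_gt : c0; apply; rewrite phi0 invf_lt1 // ltr1n.
move=> /nbhs_ballP[d /= d0 Hd].
pose z := Num.min y (d / 2).
have z0 : 0 < z by rewrite lt_min y0 divr_gt0.
have zy : z <= y by rewrite ge_min lexx.
have zd : z <= d / 2 by rewrite ge_min lexx orbT.
have [c [c0 cz]] := mvt 0 z (lexx _) z0; rewrite B0 !subr0 => Bz.
have Bz0 : 0 < B z.
  have hc : 0 < h c.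
    rewrite /h /= /clamped_power powR_gt0 //.
    rewrite lt_max; apply/orP; right; rewrite lt_min ltr01 /=.
    have half : 0 < 2^-1 :> R by rewrite invr_gt0.
    apply: lt_trans half _; apply: Hd.
    by rewrite /ball/= sub0r normrN gtr0_norm //; lra.
  rewrite Bz; apply: mulr_gt0 => //; apply: mulr_gt0 => //; exact: powR_gt0.
move: zy; rewrite le_eqVlt => /orP[/eqP <- //|zy].
have [c' [c'0 c'y E]] := mvt z y (ltW z0) zy.
have : 0 <= B y - B z.
  by rewrite E !mulr_ge0 ?powR_ge0 ?subr_ge0 ?(ltW zy) //; have /andP[] := h_bounds c'.
by rewrite subr_ge0; exact: lt_le_trans.
Qed.

Lemma profile_derivative y : 0 < y -> isd phi y (- (y `^ (- nu - 1) * B y)).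
Proof. by move=> y0; exact: (green_derivative nu_gt0 sol y0). Qed.

Lemma profile_decreasing s t : 0 <= s -> s < t -> phi t < phi s.
Proof.
move=> s0 st.
have [||c] := @MVT R phi (fun y => - (y `^ (- nu - 1) * B y)) s t st.
- move=> x; rewrite in_itv/= => /andP[sx _]; apply: profile_derivative.
  exact: le_lt_trans sx.
- by apply: continuous_subspaceT.
rewrite in_itv/= => /andP[sc ct] E.
rewrite -subr_lt0 E mulNr oppr_lt0 mulr_gt0 ?subr_gt0 //.
have c0 : 0 < c by exact: le_lt_trans sc.
by rewrite mulr_gt0 ?powR_gt0 //; have [] := moment_bounds c0.
Qed.

Lemma profile_le1 y : 0 <= y -> phi y <= 1.
Proof.
rewrite le_eqVlt => /orP[/eqP <-|y0]; first by rewrite phi0.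
by rewrite -phi0; apply: ltW; exact: profile_decreasing.
Qed.

(** The Pohozaev energy [y^nu (y^2 phi'^2 / 2 + (nu / 2) y phi phi' +
    y phi^(sigma+1) / (sigma + 1))], with [phi'] expressed through the moment [B]. *)
Definition energy y : R :=
  2^-1 * (y `^ (- nu) * (B y * B y)) - nu / 2 * (phi y * B y)
  + (sigma + 1)^-1 * (y `^ (nu + 1) * phi y `^ (sigma + 1)).

(** The derivative is [y^nu phi^(sigma+1)] times the constant
    [(nu + 1) / (sigma + 1) - nu / 2], nonpositive exactly in the supercritical range. *)
Lemma energy_derivative y : 0 < y -> 0 < phi y -> phi y <= 1 ->
  exists2 c, isd energy y c & c <= 0.
Proof.
move=> y0 p0 p1.
have hE : h y = phi y `^ sigma by rewrite /h /= clamped_powerE // ltW.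
have dB := moment_derivative y0; rewrite hE in dB.
have dp := profile_derivative y0.
have dpow : isd (fun y => phi y `^ (sigma + 1)) y
    ((sigma + 1) * phi y `^ (sigma + 1 - 1) * - (y `^ (- nu - 1) * B y)).
  exact: (@isd_comp _ (fun t : R => t `^ (sigma + 1)) phi _ _ _ (isd_powR (sigma + 1) p0) dp).
exists (y `^ nu * phi y `^ (sigma + 1) * ((nu + 1) / (sigma + 1) - nu / 2)); last first.
  rewrite mulr_ge0_le0 ?mulr_ge0 ?powR_ge0 // subr_le0.
  rewrite ler_pdivrMr; last by rewrite addr_gt0.
  have : (1 + 2 / nu) * nu <= sigma * nu by rewrite ler_pM2r.
  by rewrite mulrDl divfK ?lt0r_neq0 //; lra.
apply: isd_eq.
  apply: isdD; first apply: isdB.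
  - by apply: isdZ; apply: isdM; [exact: isd_powR|apply: isdM; exact: dB].
  - by apply: isdZ; apply: isdM; [exact: dp|exact: dB].
  - by apply: isdZ; apply: isdM; [exact: isd_powR|exact: dpow].
have yn : y != 0 by rewrite lt0r_neq0.
have D (u w : R) : y `^ (u + w) = y `^ u * y `^ w by rewrite powRD // yn implybT.
have e1 : y `^ (- nu) = (y `^ nu)^-1 by exact: powRN.
have e2 : y `^ (- nu - 1) = (y `^ nu)^-1 * y^-1.
  by rewrite D e1; congr (_ * _); rewrite powR_inv1 // ltW.
have e3 : y `^ (nu + 1) = y `^ nu * y by rewrite D powRr1 // ltW.
have e4 : y `^ (nu + 1 - 1) = y `^ nu by congr (_ `^ _); ring.
have e5 : phi y `^ (sigma + 1) = phi y `^ sigma * phi y.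
  by rewrite powRD ?powRr1 ?(ltW p0) // (lt0r_neq0 p0) implybT.
have e6 : phi y `^ (sigma + 1 - 1) = phi y `^ sigma by congr (_ `^ _); ring.
rewrite e1 e2 e3 e4 e5 e6.
have Yn : y `^ nu != 0 by rewrite lt0r_neq0 // powR_gt0.
have sn : sigma + 1 != 0 by rewrite lt0r_neq0 // addr_gt0.
move: (y `^ nu) (phi y `^ sigma) (phi y) (B y) Yn => Y P p b Yn.
by field; rewrite Yn yn sn.
Qed.

(** The energy tends to [0] at the origin and is nonincreasing as long as [phi] is
    positive. At a zero of [phi] it would reduce to its kinetic part, which is positive. *)
Lemma profile_positive y : 0 <= y -> 0 < phi y.
Proof.
move=> y_ge0; rewrite ltNge; apply/negP => phi_le0.
have [Y Y0 phiY] : exists2 Y, 0 < Y & phi Y = 0.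
  have [|Y] := @IVT R phi 0 y 0 y_ge0 (continuous_subspaceT phi_cont).
    by rewrite phi0 min_r ?max_l ?phi_le0 ?ler01 // (le_trans phi_le0).
  rewrite in_itv/= => /andP[Y0 _] E; exists Y => //.
  rewrite lt_neqAle Y0 andbT; apply/eqP => Y0'.
  by move: E; rewrite -Y0' phi0 => /eqP; rewrite oner_eq0.
have pos t : 0 <= t -> t < Y -> 0 < phi t.
  by move=> t0 tY; rewrite -phiY; exact: profile_decreasing.
have [BY _] := moment_bounds Y0.
pose F t : R := 2^-1 * (t `^ (- nu) * (B t * B t)) - nu / 2 * (phi t * B t).
have cB : {for Y, continuous B} by exact: isd_continuous (moment_derivative Y0).
have cF : {for Y, continuous F}.
  have cp : {for Y, continuous phi} by exact: phi_cont.
  apply: (@continuousB _ _ _ (fun t : R => 2^-1 * (t `^ (- nu) * (B t * B t)))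
     (fun t : R => nu / 2 * (phi t * B t))).
    apply: (@continuousM _ _ (cst 2^-1) (fun t : R => t `^ (- nu) * (B t * B t))).
      exact: cst_continuous.
    apply: (@continuousM _ _ (fun t : R => t `^ (- nu)) (fun t : R => B t * B t)).
      exact: continuous_powR.
    exact: (continuousM cB cB).
  apply: (@continuousM _ _ (cst (nu / 2)) (fun t : R => phi t * B t)); first exact: cst_continuous.
  exact: (continuousM cp cB).
pose c0 := F Y.
have c00 : 0 < c0.
  by rewrite /c0 /F phiY mul0r mulr0 subr0 !mulr_gt0 ?powR_gt0 ?invr_gt0.
have : \forall t \near Y, c0 / 2 < F t.
  by move/cvgr_gt : cF; apply; rewrite -/c0; lra.
move=> /nbhs_ballP[d /= d0 Hd].
pose y2 := Y - Num.min (d / 2) (Y / 2).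
have mp : 0 < Num.min (d / 2) (Y / 2) by rewrite lt_min !divr_gt0.
have md : Num.min (d / 2) (Y / 2) <= d / 2 by rewrite ge_min lexx.
have mY : Num.min (d / 2) (Y / 2) <= Y / 2 by rewrite ge_min lexx orbT.
have y2Y : y2 < Y by rewrite /y2; lra.
have y20 : 0 < y2 by rewrite /y2; lra.
have Fy2 : c0 / 2 < F y2 by apply: Hd; rewrite /ball/= ger0_norm /y2; lra.
(* close enough to the origin for the energy to be below c0 / 4 *)
pose y3 := Num.min (Num.min 1 (c0 / 8)) (y2 / 2).
have y30 : 0 < y3 by rewrite !lt_min ltr01 !divr_gt0.
have y31 : y3 <= 1 by rewrite !ge_min lexx.
have y3c : y3 <= c0 / 8 by rewrite !ge_min lexx orbT.
have y32 : y3 <= y2 / 2 by rewrite !ge_min lexx orbT.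
have y3y2 : y3 < y2 by lra.
have en t : y3 <= t -> t <= y2 -> exists2 c, isd energy t c & c <= 0.
  move=> t3 t2; have t0 : 0 < t by exact: lt_le_trans t3.
  apply: energy_derivative => //; last by apply: profile_le1; exact: ltW.
  by apply: pos; [exact: ltW|exact: le_lt_trans y2Y].
have [e' He'] : exists e' : R -> R, forall t, y3 <= t -> t <= y2 -> isd energy t (e' t) /\ e' t <= 0.
  have /choice[e' He'] : forall t, exists c, y3 <= t -> t <= y2 -> isd energy t c /\ c <= 0.
    move=> t; case: (pselect (y3 <= t /\ t <= y2)) => [[t3 t2]|H].
      by have [c H1 H2] := en t t3 t2; exists c.
    by exists 0 => t3 t2; exfalso; apply: H.
  by exists e'.
have mono : energy y2 <= energy y3.
  have [||c] := @MVT R energy e' y3 y2 y3y2.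
  - move=> t; rewrite in_itv/= => /andP[t3 t2].
    by have [] := He' t (ltW t3) (ltW t2).
  - by apply: (@isd_within _ energy e') => t t3 t2; have [] := He' t t3 t2.
  rewrite in_itv/= => /andP[t3 t2] E.
  rewrite -subr_le0 E mulr_le0_ge0 ?subr_ge0 ?(ltW y3y2) //.
  by have [] := He' c (ltW t3) (ltW t2).
have lowE : F y2 <= energy y2.
  by rewrite /energy -/(F y2) lerDl !mulr_ge0 ?invr_ge0 ?powR_ge0 // addr_ge0 // ltW.
have [B30 B3] := moment_bounds y30.
have p3 : 0 < phi y3 by apply: pos; [exact: ltW|exact: lt_trans y2Y].
have p31 : phi y3 <= 1 by apply: profile_le1; exact: ltW.
have pw (k : R) : 1 <= k -> y3 `^ k <= y3.
  move=> k1; rewrite -[leRHS](powRr1 (ltW y30)).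
  by apply: ger_powR => //; rewrite y30.
have T1 : 2^-1 * (y3 `^ (- nu) * (B y3 * B y3)) <= y3.
  have H1 : y3 `^ (- nu) * (B y3 * B y3) <= y3 `^ (- nu) * (y3 `^ (nu + 1) * y3 `^ (nu + 1)).
    by rewrite ler_wpM2l ?powR_ge0 // ler_pM // ltW.
  have H2 : y3 `^ (- nu) * (y3 `^ (nu + 1) * y3 `^ (nu + 1)) = y3 `^ (nu + 2).
    have yn : y3 != 0 by rewrite lt0r_neq0.
    by rewrite -!powRD ?yn ?implybT //; congr (_ `^ _); ring.
  have H3 : y3 `^ (nu + 2) <= y3.
    by apply: pw; apply: ler_wpDl; [exact: ltW|rewrite ler1n].
  rewrite H2 in H1; have : 0 <= y3 `^ (- nu) * (B y3 * B y3).
    by rewrite mulr_ge0 ?powR_ge0 // mulr_ge0 // ltW.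
  by move: (y3 `^ (- nu) * _) H1 => Z; lra.
have T2 : 0 <= nu / 2 * (phi y3 * B y3).
  by apply: mulr_ge0; [rewrite divr_ge0 // ltW|apply: mulr_ge0; exact: ltW].
have T3 : (sigma + 1)^-1 * (y3 `^ (nu + 1) * phi y3 `^ (sigma + 1)) <= y3.
  rewrite -[leRHS]mul1r ler_pM ?invr_ge0 ?mulr_ge0 ?powR_ge0 //.
  - by rewrite addr_ge0 // ltW.
  - by rewrite invf_le1 ?lerDr ?addr_gt0 // ltW.
  rewrite -[leRHS]mulr1 ler_pM ?powR_ge0 //; first by apply: pw; rewrite lerDr ltW.
  rewrite -[leRHS](_ : 1 `^ (sigma + 1) = 1); last by rewrite powR1.
  by rewrite ge0_ler_powR ?nnegrE ?(ltW p3) // addr_ge0 // ltW.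
have : energy y3 <= 2 * y3 by move: T1 T2 T3; rewrite /energy; lra.
by move: Fy2 lowE mono y3c c00; move: (energy y2) (energy y3) (F y2) => *; lra.
Qed.

End Solution.

Theorem emden_fowler : exists phi phi1 phi2 : R -> R,
  [/\ continuous phi, forall y, 0 <= y -> 0 < phi y &
   forall y, 0 < y -> [/\ isd phi y (phi1 y), isd phi1 y (phi2 y),
     {for y, continuous phi2} & y * phi2 y + (nu + 1) * phi1 y + phi y `^ sigma = 0]].
Proof.
have [phi [A [B [cphi sol]]]] := fixed_point nu_gt0 sigma_gt1.
have pos := profile_positive cphi sol.
have hE y : 0 <= y -> clamped_power sigma (phi y) = phi y `^ sigma.
  move=> y0; rewrite clamped_powerE //; first by apply: ltW; exact: pos.
  exact: (profile_le1 cphi sol).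
pose phi1 y := - (y `^ (- nu - 1) * B y).
pose phi2 y := - ((- nu - 1) * y `^ (- nu - 1 - 1) * B y
   + y `^ (- nu - 1) * (y `^ nu * phi y `^ sigma)).
exists phi, phi1, phi2; split => // y y0.
have dB : isd B y (y `^ nu * phi y `^ sigma).
  by have := moment_derivative sol y0; rewrite /= hE // ltW.
split.
- exact: (profile_derivative sol).
- by apply: isdN; apply: isdM => //; exact: isd_powR.
- have cB := isd_continuous dB.
  have cpw (k : R) : {for y, continuous (fun t : R => t `^ k)} by exact: continuous_powR.
  have cps : {for y, continuous (fun t : R => phi t `^ sigma)}.
    apply: (@continuous_comp _ _ _ phi (fun t : R => t `^ sigma)); first exact: cphi.
    by apply: continuous_powR; apply: pos; exact: ltW.
  apply: continuousN; apply: (@continuousD _ _ _ (fun t => (- nu - 1) * t `^ (- nu - 1 - 1) * B t)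
    (fun t => t `^ (- nu - 1) * (t `^ nu * phi t `^ sigma))).
    apply: (continuousM _ cB).
    by apply: (continuousM _ (cpw _)); exact: cst_continuous.
  exact: (continuousM (cpw _) (continuousM (cpw _) cps)).
have yn : y != 0 by rewrite lt0r_neq0.
have D (u w : R) : y `^ (u + w) = y `^ u * y `^ w by rewrite powRD // yn implybT.
have e1 : y `^ (- nu) = (y `^ nu)^-1 by exact: powRN.
have e0 : y `^ (- 1) = y^-1 by rewrite powR_inv1 // ltW.
have Yn : y `^ nu != 0 by rewrite lt0r_neq0 // powR_gt0.
rewrite /phi1 /phi2 !D e1 e0.
move: (y `^ nu) (phi y `^ sigma) (B y) Yn => Y P b Yn.
by field; rewrite Yn yn.
Qed.

End PositiveProfile.

(** * Radial solutions *)

Section RadialFunctions.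
Context {R : realType} {N : nat}.
Implicit Types (x y : 'rV[R]_N) (i j k : 'I_N).

Lemma continuous_near_eq (f g : 'rV[R]_N -> R) x : (\forall y \near x, f y = g y) ->
  {for x, continuous g} -> {for x, continuous f}.
Proof.
move=> fg /continuous_epsP cg; have fgx := nbhs_singleton fg.
apply/continuous_epsP => e /cg.
by apply: filterS2 fg => y -> ; rewrite fgx.
Qed.

Context (psi psi1 psi2 : R -> R)
  (dpsi : forall t : R, 0 < t -> isd psi t (psi1 t))
  (dpsi1 : forall t : R, 0 < t -> isd psi1 t (psi2 t))
  (cpsi2 : forall t : R, 0 < t -> {for t, continuous psi2}).

Let f x := psi (enorm x ^+ 2).

Let sq_gt0 x : x != 0 -> 0 < enorm x ^+ 2.
Proof. by move=> x0; rewrite exprn_gt0 // enorm_gt0. Qed.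

Lemma partial_radial i x : x != 0 ->
  derivable f x (delta_mx 0 i) /\ partial i f x = 2 * x 0 i * psi1 (enorm x ^+ 2).
Proof.
by move=> x0; have [ex val] := is_derive_radial i (dpsi (sq_gt0 x0)); split.
Qed.

Lemma is_derive_coord i j x :
  is_derive x (delta_mx 0 j) (fun y => y 0 i) ((i == j)%:R).
Proof.
apply: isd_line.
rewrite (_ : (fun s : R => _) = (fun s : R => x 0 i + (i == j)%:R * s)).
  by apply: isd_eq (isdD (isdC _ _) (isdZ _ (isdI _))) _; rewrite add0r mulr1.
by apply/funext => s; rewrite !mxE eqxx /= mulrC.
Qed.

Lemma partial2_radial i j x : x != 0 ->
  derivable (partial i f) x (delta_mx 0 j) /\ partial j (partial i f) x =
   2 * (i == j)%:R * psi1 (enorm x ^+ 2) + 4 * (x 0 i * x 0 j) * psi2 (enorm x ^+ 2).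
Proof.
move=> x0.
have D : is_derive x (delta_mx 0 j) (partial i f)
   (2 * (i == j)%:R * psi1 (enorm x ^+ 2) + 4 * (x 0 i * x 0 j) * psi2 (enorm x ^+ 2)).
  apply: (@near_eq_is_derive _ _ _ ((fun y => 2 * psi1 (enorm y ^+ 2)) * (fun y => y 0 i))).
    near=> y; have y0 : y != 0 by near: y; exact: near_neq0.
    have [_ ->] := partial_radial i y0.
    by rewrite -[LHS]/(_ * _); ring.
  have d1 : is_derive x (delta_mx 0 j) (fun y => 2 * psi1 (enorm y ^+ 2))
      (2 * x 0 j * (2 * psi2 (enorm x ^+ 2))).
    exact: (@is_derive_radial _ _ (fun t => 2 * psi1 t) x j _ (isdZ 2 (dpsi1 (sq_gt0 x0)))).
  apply: is_derive_eq (is_deriveM d1 (is_derive_coord i j x)) _.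
  by rewrite -[X in X + _ = _]/(_ * _) -[X in _ + X = _]/(_ * _); ring.
by have [ex val] := D.
Unshelve. all: by end_near. Qed.

Lemma continuous_radial (h : R -> R) x : x != 0 ->
  {for enorm x ^+ 2, continuous h} -> {for x, continuous (fun y => h (enorm y ^+ 2))}.
Proof.
move=> x0 ch; apply: (@continuous_comp _ _ _ (fun y => enorm y ^+ 2) h) => //.
have cn := @continuous_enorm R N x; exact: (continuousM cn cn).
Qed.

Lemma Ck2_radial : Ck 2 (punctured [set: 'rV[R]_N]) f.
Proof.
have oU : open (punctured [set: 'rV[R]_N]) by exact: (open_punctured openT).
have U0 x : punctured [set: 'rV[R]_N] x -> x != 0 by move=> [_ /eqP].
have within (g : 'rV[R]_N -> R) : (forall x, x != 0 -> {for x, continuous g}) ->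
    {within punctured [set: 'rV[R]_N], continuous g}.
  move=> cg; apply: continuous_in_subspaceT => x; rewrite inE => /U0; exact: cg.
have cc i x : {for x, continuous (fun y : 'rV[R]_N => y 0 i)} by exact: coord_continuous.
have c1 x : x != 0 -> {for x, continuous (fun y => psi1 (enorm y ^+ 2))}.
  by move=> x0; apply: continuous_radial => //; apply: isd_continuous (dpsi1 (sq_gt0 x0)).
have c2 x : x != 0 -> {for x, continuous (fun y => psi2 (enorm y ^+ 2))}.
  by move=> x0; apply: continuous_radial => //; exact: cpsi2 (sq_gt0 x0).
have cst c x : {for x, continuous (fun _ : 'rV[R]_N => c : R)} by exact: cst_continuous.
split; first by apply: within => x x0; apply: continuous_radial => //;
  exact: isd_continuous (dpsi (sq_gt0 x0)).
move=> i; split; first by move=> x /U0 x0; have [] := partial_radial i x0.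
split.
  apply: within => x x0.
  apply: (@continuous_near_eq _ (fun y => 2 * y 0 i * psi1 (enorm y ^+ 2))).
    by apply: filterS (near_neq0 x0) => y y0; have [] := partial_radial i y0.
  exact: (continuousM (continuousM (cst 2 x) (cc i x)) (c1 x x0)).
move=> j; split; first by move=> x /U0 x0; have [] := partial2_radial i j x0.
split=> //; apply: within => x x0.
apply: (@continuous_near_eq _ (fun y => 2 * (i == j)%:R * psi1 (enorm y ^+ 2)
    + 4 * (y 0 i * y 0 j) * psi2 (enorm y ^+ 2))).
  by apply: filterS (near_neq0 x0) => y y0; have [] := partial2_radial i j y0.
apply: (continuousD (continuousM (cst _ x) (c1 x x0))).
exact: (continuousM (continuousM (cst 4 x) (continuousM (cc i x) (cc j x))) (c2 x x0)).
Qed.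

Lemma laplacian_radial x : x != 0 -> laplacian f x =
  2 * N%:R * psi1 (enorm x ^+ 2) + 4 * enorm x ^+ 2 * psi2 (enorm x ^+ 2).
Proof.
move=> x0; rewrite /laplacian.
transitivity (\sum_(i < N) (2 * psi1 (enorm x ^+ 2) + 4 * psi2 (enorm x ^+ 2) * x 0 i ^+ 2)).
  by apply: eq_bigr => i _; have [_ ->] := partial2_radial i i x0; rewrite eqxx mulr1; ring.
rewrite big_split /= sumr_const card_ord -mulr_sumr -sqr_enorm -[X in X + _]mulr_natl.
by ring.
Qed.

Lemma radial_deriv_radial x : x != 0 ->
  radial_deriv f x = 2 * enorm x ^+ 2 * psi1 (enorm x ^+ 2).
Proof.
move=> x0; rewrite /radial_deriv.
transitivity (\sum_(i < N) 2 * psi1 (enorm x ^+ 2) * x 0 i ^+ 2).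
  by apply: eq_bigr => i _; have [_ ->] := partial_radial i x0; ring.
by rewrite -mulr_sumr -sqr_enorm; ring.
Qed.

End RadialFunctions.

(** For equal exponents [p + q = r + s] a radial [u1 = u2 = u] solves both equations
    if it solves a scalar one. The variable [y = |x|^k / k^2], [k = 2 + b - a], removes
    the weights, [div (|x|^a Du) + |x|^b u^sigma = 0] becoming
    [y phi'' + (nu + 1) phi' + phi^sigma = 0] with [nu = (N - 2 + a) / k]. The condition
    [p_S <= sigma] becomes [1 + 2 / nu <= sigma]. *)
Theorem radial_solution (R : realType) (N : nat) (p q r s a b : R) :
  a - 2 < b -> - N%:R < a - 2 -> 1 < r + s ->
  p + q = r + s -> p_S N a b <= r + s ->
  exists u1 u2 : 'rV[R]_N -> R, positive_solution a b p q r s [set: 'rV[R]_N] u1 u2.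
Proof.
move=> hba haN sigma1 pqrs sup.
pose m : R := (N%:R - 2 + a) / 2.
pose k : R := 2 + b - a.
have m2 : 0 < N%:R - 2 + a.
  by have := haN; rewrite -subr_gt0 (_ : a - 2 - - N%:R = N%:R - 2 + a) //; ring.
have m0 : 0 < m by rewrite divr_gt0.
have k0 : 0 < k by rewrite /k; lra.
pose nu := 2 * m / k.
have nu0 : 0 < nu by rewrite divr_gt0 // mulr_gt0.
pose sigma := r + s.
have kn := lt0r_neq0 k0; have mn := lt0r_neq0 m0; have m2n := lt0r_neq0 m2.
have super : 1 + 2 / nu <= sigma.
  have -> : 1 + 2 / nu = p_S N a b; last exact: sup.
  rewrite /nu /p_S.
  have -> : N%:R + 2 + 2 * b - a = 2 * m + 2 * k by rewrite /m /k; field.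
  have -> : N%:R - 2 + a = 2 * m by rewrite /m; field.
  by field; rewrite mn kn.
have [phi [phi1 [phi2 [cphi phi0 ode]]]] := emden_fowler nu0 sigma1 super.
pose tau (t : R) := t `^ (k / 2) / k ^+ 2.
have tau0 t : 0 < t -> 0 < tau t by move=> t0; rewrite divr_gt0 ?powR_gt0 ?exprn_gt0.
have dtau t : 0 < t -> isd tau t ((2 * k)^-1 * t `^ (k / 2 - 1)).
  move=> t0; apply: isd_eq (isdM (isd_powR (k / 2) t0) (isdC _ _)) _.
  by rewrite mulr0 addr0; move: (_ `^ _) => T; field.
pose psi t := phi (tau t).
pose psi1 t := phi1 (tau t) * ((2 * k)^-1 * t `^ (k / 2 - 1)).
pose psi2 t := phi2 (tau t) * ((2 * k)^-1 * t `^ (k / 2 - 1)) * ((2 * k)^-1 * t `^ (k / 2 - 1))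
  + phi1 (tau t) * ((2 * k)^-1 * ((k / 2 - 1) * t `^ (k / 2 - 1 - 1))).
have d0 t : 0 < t -> isd psi t (psi1 t).
  by move=> t0; have [d1 _ _ _] := ode _ (tau0 t t0); exact: isd_comp d1 (dtau t t0).
have d1 t : 0 < t -> isd psi1 t (psi2 t).
  move=> t0; have [_ d2 _ _] := ode _ (tau0 t t0).
  apply: isdM; first exact: isd_comp d2 (dtau t t0).
  by apply: isdZ; exact: isd_powR.
have c2 t : 0 < t -> {for t, continuous psi2}.
  move=> t0; have [_ d2 c2 _] := ode _ (tau0 t t0).
  have ct := isd_continuous (dtau t t0).
  have cpw (l : R) : {for t, continuous (fun t : R => t `^ l)} by exact: continuous_powR.
  have ccst (c : R) : {for t, continuous (fun _ : R => c)} by exact: cst_continuous.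
  have cp1 : {for t, continuous (fun t => phi1 (tau t))}.
    by apply: (@continuous_comp _ _ _ tau phi1) => //; exact: isd_continuous d2.
  have cp2 : {for t, continuous (fun t => phi2 (tau t))}.
    by apply: (@continuous_comp _ _ _ tau phi2).
  have cw := continuousM (ccst (2 * k)^-1) (cpw (k / 2 - 1)).
  apply: (continuousD (continuousM (continuousM cp2 cw) cw)).
  exact: (continuousM cp1 (continuousM (ccst _) (continuousM (ccst _) (cpw _)))).
pose u (x : 'rV[R]_N) := psi (enorm x ^+ 2).
have C2u : Ck 2 (punctured [set: 'rV[R]_N]) u by exact: Ck2_radial d0 d1 c2.
have cu : continuous u.
  move=> x; apply: (@continuous_comp _ _ _ (fun y => tau (enorm y ^+ 2)) phi); last exact: cphi.
  apply: (@continuousM _ _ (fun y : 'rV[R]_N => (enorm y ^+ 2) `^ (k / 2)) (fun=> (k ^+ 2)^-1)); last exact: cst_continuous.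
  apply: continuous_powR_ge0; first by rewrite divr_gt0.
    by move=> y; exact: sqr_ge0.
  by have cn := @continuous_enorm R N x; exact: (continuousM cn cn).
have u0 x : 0 < u x.
  by apply: phi0; rewrite divr_ge0 ?powR_ge0 ?sqr_ge0.
have oU : open (punctured [set: 'rV[R]_N]) by exact: (open_punctured openT).
have eqn (P Q : R) : P + Q = sigma -> forall x, punctured [set: 'rV[R]_N] x ->
    divergence (fun y => enorm y `^ a *: grad u y) x
      + enorm x `^ b * (u x `^ P * u x `^ Q) = 0.
  move=> PQ x Px; have x0 : x != 0 by have [_ /eqP] := Px.
  have n0 : 0 < enorm x by rewrite enorm_gt0.
  have nn := lt0r_neq0 n0.
  rewrite (divergence_weighted_grad a oU C2u Px x0).
  rewrite (laplacian_radial d0 d1 x0) (radial_deriv_radial d0 x0).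
  have -> : u x `^ P * u x `^ Q = u x `^ sigma.
    by rewrite -PQ powRD // (lt0r_neq0 (u0 x)) implybT.
  set t := enorm x ^+ 2.
  have t0 : 0 < t by rewrite exprn_gt0.
  have tn := lt0r_neq0 t0.
  have [_ _ _ E] := ode _ (tau0 t t0).
  pose T := t `^ (k / 2).
  have DT (v w : R) : t `^ (v + w) = t `^ v * t `^ w by rewrite powRD // tn implybT.
  have Dn (v w : R) : enorm x `^ (v + w) = enorm x `^ v * enorm x `^ w.
    by rewrite powRD // nn implybT.
  have e1 : t `^ (-1) = t^-1 by rewrite powR_inv1 // ltW.
  have e2 : enorm x `^ (- 2) = t^-1 by rewrite powRN powR_mulrn // ltW.
  have e3 : enorm x `^ k = T by rewrite powR_enorm.
  have -> : enorm x `^ b = enorm x `^ a * t^-1 * T.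
    by rewrite -e2 -e3 -!Dn; congr (_ `^ _); rewrite /k; ring.
  rewrite Dn e2 /psi1 /psi2 !DT e1 -/T.
  have -> : u x `^ sigma = - (tau t * phi2 (tau t) + (nu + 1) * phi1 (tau t)).
    by apply/eqP; rewrite -addr_eq0 addrC; apply/eqP.
  have -> : tau t = T / k ^+ 2 by [].
  have Na : N%:R = 2 * m + 2 - a by rewrite /m; field.
  rewrite Na /nu.
  clear e3; move: T (enorm x `^ a) (phi1 (T / k ^+ 2)) (phi2 (T / k ^+ 2)) => T X f1 f2.
  by field; rewrite kn tn.
have cw : {within closure [set: 'rV[R]_N], continuous u} by exact: continuous_subspaceT.
exists u, u; split => //; [exact: eqn|exact: eqn].
Qed.

Unset Implicit Arguments.
Set Strict Implicit.
Set Printing Implicit Defensive.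

Theorem corollary2 (R : realType) (N : nat) (p q r s a b : R)
    (hN : (3 <= N)%N)
    (hp : 1 < p) (hq : 1 < q) (hr : 1 < r) (hs : 1 < s)
    (hba : a - 2 < b) (haN : - N%:R < a - 2) :
  (* (a) *)
  (Num.max (p + q) (r + s) < p_S N a b ->
     ~ exists u1 u2 : 'rV[R]_N -> R,
         positive_solution a b p q r s [set: 'rV[R]_N] u1 u2)
  /\
  (* (b) *)
  ((forall Omega : set 'rV[R]_N,
      open Omega -> connected Omega -> bounded_set Omega ->
      smooth_boundary Omega -> Omega 0 -> star_shaped0 Omega ->
      p_S N a b <= Num.min (p + q) (r + s) ->
      ~ exists u1 u2 : 'rV[R]_N -> R,
          positive_solution a b p q r s Omega u1 u2 /\
          zero_boundary Omega u1 u2)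
   /\
   (q - s = r - p -> 1 <= r - p -> p_S N a b <= r + s ->
      exists u1 u2 : 'rV[R]_N -> R,
        positive_solution a b p q r s [set: 'rV[R]_N] u1 u2)).
Proof.
split=> [sub [u1 [u2 sol]]|].
  exact: (liouville hN hp hq hr hs hba haN sub sol).
split; last by move=> qs _ super; apply: radial_solution => //; lra.
move=> Omega oO _ bO _ O0 star super [u1 [u2 [sol zb]]].
exact: (star_shaped_nonexistence hN hp hq hr hs haN oO bO O0 star super sol zb).
Qed.
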